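(* Let $\mathcal{J}$ be a set of $n$ jobs with rewards in $[1,w]$. For any $\varepsilon>0$, there exists a fully dynamic algorithm for $\left(\frac{M^M}{M^M-(M-1)^M}(1+\varepsilon)\right)$-approximate weighted interval scheduling of $\mathcal{J}$ on $M$ machines performing updates in $O\left(\frac{Mw\log(w)\log(n)}{\varepsilon^3}\right)$ worst-case time and queries in $O(\log n)$ worst-case time.
   Context: Weighted interval scheduling on $M$ machines: each job $j$ has start $s_j\ge0$, length $l_j\ge1$ (interval $[s_j,s_j+l_j]$) and reward $w_j$; a feasible schedule assigns a subset of the jobs to the $M$ machines so that jobs on the same machine pairwise do not overlap; its value is the total reward of scheduled jobs. An $\alpha$-approximate solution has value at least $1/\alpha$ times the optimum. A fully dynamic algorithm maintains a feasible solution under insertions and deletions of jobs and answers queries about the maintained solution.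
   Formalization: In the time bounds log(w), log(n) and ε are read as ln(w+1), ln(n+2) and min(ε,1), since the stated update bound is zero at w=1 or n=1 and vanishes as ε grows; for w,n≥2 and ε≤1 the bounds agree up to a constant factor. *)

(* Defs.v *)
From HB Require Import structures.
From mathcomp Require Import all_boot all_order all_algebra finmap.
From mathcomp Require Import reals exp.

Set Implicit Arguments.
Unset Strict Implicit.
Unset Printing Implicit Defensive.

Import Order.TTheory GRing.Theory Num.Theory.
Local Open Scope ring_scope.
Local Open Scope fset_scope.

(* The identifier lets distinct jobs carry the same interval and reward. *)
Record job (R : realType) := Job {
  jid : nat;
  start : R;
  len : R;
  reward : R
}.

Section JobChoice.
Variable R : realType.

Definition job_tuple (j : job R) : nat * R * R * R :=
  (jid j, start j, len j, reward j).
Definition tuple_job (x : nat * R * R * R) : job R :=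
  let: (i, s, l, v) := x in Job i s l v.
Lemma job_tupleK : cancel job_tuple tuple_job.
Proof. by case. Qed.

HB.instance Definition _ := Choice.copy (job R) (can_type job_tupleK).
End JobChoice.

Section Scheduling.
Variable R : realType.
Implicit Types (i j : job R) (J : {fset job R}) (M : nat).

Definition valid_job (w : R) j : bool :=
  [&& 0 <= start j, 1 <= len j & 1 <= reward j <= w].

Definition finish j : R := start j + len j.

(* Intervals overlap when their interiors meet: a machine may start a job at
   the very time another one finishes. *)
Definition overlap i j : bool := (start i < finish j) && (start j < finish i).

(* [S j = Some m]: job j runs on machine m; [S j = None]: j is not scheduled. *)
Definition schedule J M : finType := {ffun J -> option 'I_M}.

Definition feasible J M (S : schedule J M) : bool :=
  [forall i, forall j,
    [&& i != j, isSome (S i) & S i == S j] ==> ~~ overlap (val i) (val j)].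

Definition value J M (S : schedule J M) : R :=
  \sum_(j : J | isSome (S j)) reward (val j).

(* The empty schedule is feasible with value 0, so the default value 0 of the
   maximum is harmless. *)
Definition opt J M : R :=
  \big[Num.max/0]_(S : schedule J M | feasible S) value S.

Definition approximate (alpha : R) J M (S : schedule J M) : Prop :=
  feasible S /\ alpha^-1 * opt J M <= value S.
End Scheduling.

(* Unit-cost real RAM. There are two unbounded memories, one of integers and
   one of reals, and integers serve as addresses. Instructions are
   three-address, so that each does a constant amount of work. As usual there
   is no rounding from reals to integers; there is no integer multiplication
   and there are no bit operations either. *)
Inductive zop := ZAdd | ZSub.
Inductive rop := RAdd | RSub | RMul | RDiv.

(* Arguments are direct addresses, the first one being the destination; the
   address is taken from the integer memory in the Load instructions (second
   argument) and the Store instructions (first argument). *)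
Inductive instr :=
| ZConst of nat & nat
| ZOp of zop & nat & nat & nat
| ZLoad of nat & nat
| ZStore of nat & nat
| ROfNat of nat & nat
| ROp of rop & nat & nat & nat
| RLoad of nat & nat
| RStore of nat & nat.

Inductive test :=
| ZLe of nat & nat
| RLe of nat & nat.

Inductive cmd :=
| Instr of instr
| Seq of cmd & cmd
| If of test & cmd & cmd
| While of test & cmd.

Section Machine.
Variable R : realType.

Record state := State { zmem : nat -> nat; rmem : nat -> R }.

Definition upd (T : Type) (f : nat -> T) (a : nat) (v : T) : nat -> T :=
  fun x => if x == a then v else f x.

Definition zset (s : state) a v := State (upd (zmem s) a v) (rmem s).
Definition rset (s : state) a v := State (zmem s) (upd (rmem s) a v).

Definition eval_zop (o : zop) (x y : nat) : nat :=
  match o with ZAdd => (x + y)%N | ZSub => (x - y)%N end.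

Definition eval_rop (o : rop) (x y : R) : R :=
  match o with
  | RAdd => x + y | RSub => x - y | RMul => x * y | RDiv => x / y
  end.

Definition eval_instr (c : instr) (s : state) : state :=
  let z := zmem s in
  let r := rmem s in
  match c with
  | ZConst a v => zset s a v
  | ZOp o a b c => zset s a (eval_zop o (z b) (z c))
  | ZLoad a b => zset s a (z (z b))
  | ZStore a b => zset s (z a) (z b)
  | ROfNat a b => rset s a (z b)%:R
  | ROp o a b c => rset s a (eval_rop o (r b) (r c))
  | RLoad a b => rset s a (r (z b))
  | RStore a b => rset s (z a) (r b)
  end.

Definition eval_test (b : test) (s : state) : bool :=
  match b with
  | ZLe a b => (zmem s a <= zmem s b)%N
  | RLe a b => rmem s a <= rmem s b
  end.

(* [exec c s s' t]: started in s, c halts in s' after t instructions and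
   tests. *)
Inductive exec : cmd -> state -> state -> nat -> Prop :=
| ExecInstr i s : exec (Instr i) s (eval_instr i s) 1
| ExecSeq c1 c2 s1 s2 s3 t1 t2 :
    exec c1 s1 s2 t1 -> exec c2 s2 s3 t2 -> exec (Seq c1 c2) s1 s3 (t1 + t2)%N
| ExecIfTrue b c1 c2 s s' t :
    eval_test b s -> exec c1 s s' t -> exec (If b c1 c2) s s' t.+1
| ExecIfFalse b c1 c2 s s' t :
    ~~ eval_test b s -> exec c2 s s' t -> exec (If b c1 c2) s s' t.+1
| ExecWhileFalse b c s : ~~ eval_test b s -> exec (While b c) s s 1
| ExecWhileTrue b c s1 s2 s3 t1 t2 :
    eval_test b s1 -> exec c s1 s2 t1 -> exec (While b c) s2 s3 t2 ->
    exec (While b c) s1 s3 (t1 + t2).+1%N.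
End Machine.

(* The three programs share the memory, which persists between operations. *)
Record dyn_alg := DynAlg { insert : cmd; delete : cmd; query : cmd }.

Section Dynamic.
Variables (R : realType) (A : dyn_alg) (M : nat) (w eps : R).
Implicit Types (J : {fset job R}) (j : job R) (s : state R).

(* There is no preprocessing: before the first operation the memory holds only
   the parameters. *)
Definition init_state : state R :=
  State (fun a => if a == 1%N then M else 0%N)
        (fun a => if a == 3%N then w else if a == 4%N then eps else 0).

(* The argument of an operation is passed in fixed cells. *)
Definition with_input j s : state R :=
  zset (rset (rset (rset s 0 (start j)) 1 (len j)) 2 (reward j)) 0 (jid j).

(* Query result: 0 for a job that is not scheduled, m + 1 for machine m. *)
Definition answer s : nat := zmem s 0.
Definition encode (o : option 'I_M) : nat :=
  if o is Some m then m.+1 else 0%N.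

Definition insertable J j : bool :=
  valid_job w j && [forall i : J, jid (val i) != jid j].

(* [reach J s]: s is the memory after some finite sequence of insertions,
   deletions and queries, started from the empty set of jobs, and J is the
   resulting current set of jobs. *)
Inductive reach : {fset job R} -> state R -> Prop :=
| ReachInit : reach fset0 init_state
| ReachInsert J s j s' t :
    reach J s -> insertable J j ->
    exec (insert A) (with_input j s) s' t -> reach (j |` J) s'
| ReachDelete J s j s' t :
    reach J s -> j \in J ->
    exec (delete A) (with_input j s) s' t -> reach (J `\ j) s'
| ReachQuery J s j s' t :
    reach J s -> j \in J ->
    exec (query A) (with_input j s) s' t -> reach J s'.

(* [sol J s] is the solution maintained in memory s; queries report it and do
   not change it. *)
Definition maintains_approx (alpha : R) : Prop :=
  exists sol : forall J, state R -> schedule J M,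
  forall J s, reach J s ->
    approximate alpha (sol J s) /\
    forall (j : J) s' t, exec (query A) (with_input (val j) s) s' t ->
      answer s' = encode (sol J s j) /\ sol J s' = sol J s.

(* [T n] bounds the time of an operation on a current set of n jobs. *)
Definition update_time (T : nat -> R) : Prop :=
  forall J s, reach J s ->
    (forall j, insertable J j ->
       exists s' t, exec (insert A) (with_input j s) s' t
                    /\ t%:R <= T #|` J|) /\
    (forall j, j \in J ->
       exists s' t, exec (delete A) (with_input j s) s' t
                    /\ t%:R <= T #|` J|).

Definition query_time (T : nat -> R) : Prop :=
  forall J s, reach J s -> forall j, j \in J ->
    exists s' t, exec (query A) (with_input j s) s' t /\ t%:R <= T #|` J|.
End Dynamic.

Definition greedy_ratio (R : realType) (M : nat) : R :=
  M%:R ^+ M / (M%:R ^+ M - (M%:R - 1) ^+ M).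

(* O-bounds with an absolute constant in front. The shifts in the logarithms
   and the cap on eps matter only for n < 2, w < 2 or eps > 1, where
   M w log w log n / eps^3 drops below one step or vanishes; otherwise they
   change the bound by at most a constant factor. *)
Definition update_bound (R : realType) (M : nat) (w eps : R) (n : nat) : R :=
  M%:R * w * ln (w + 1) * ln (n%:R + 2) / Num.min eps 1 ^+ 3.

Definition query_bound (R : realType) (n : nat) : R := ln (n%:R + 2).

(* Main.v *)
From HB Require Import structures.
Require Import Defs.
From mathcomp Require Import all_boot all_order all_algebra finmap.
From mathcomp Require Import boolp reals exp.
From mathcomp Require Import zify ring lra.

Set Implicit Arguments.
Unset Strict Implicit.
Unset Printing Implicit Defensive.

Import Order.TTheory GRing.Theory Num.Theory.

(* Rewards are rounded down to about Q log w values, powers of 1 + 1/Q in units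
   of 1/Q with Q = O(1/eps). Each value gets a balanced tree ordered by start
   that finds the job of earliest finish starting after a given time.

   The time line is partitioned into regions. In a region the machines are
   filled one after the other, each with an optimal chain of the jobs left over;
   a machine gains at least 1/M of what remains of the optimum, whence the ratio
   M^M / (M^M - (M-1)^M). An optimal chain is found by a dynamic program over
   the weight v, which keeps the earliest finish of a chain of weight v.

   The value of a region stays between th and O(th) units, where
   th = M Q (Q w). Hence the jobs that cross a boundary cost only a fraction 1/Q
   of the total value, and solving a region again costs O(th (Q log w) log n).
   An update solves only the region around the job again, after merging it with
   a neighbour if its value has dropped below th, and splits it if its value has
   become too large.

   The algorithm is a purely functional program. [computes f T] says that some
   RAM program evaluates f on heap representations in time O(T); it is closed
   under composition and recursion. *)

(** * RAM programs on heap data *)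

(** Running [M] dynamic programs of up to [O(th)] steps each in a region would put a factor [M] too
    much into the time. But a run stops one step after it has reached the weight of the chain it
    returns, and the chains of all machines together form one solution of the region. So a single
    budget of [64 * th] steps, passed on from machine to machine, is enough. The optimum of a region
    is never known, only the weight of its solution. As [(1 - 1/M)^M <= 1/2], the optimum is at most
    twice that weight; thresholds on the maintained weight therefore control the optimum, and with
    it the time. Three losses of a factor [1 + 1/Q] have to fit into [1 + eps]: rounding to powers,
    rounding to units, and the region boundaries. This is arranged by [Q > 16 / min(eps, 1)].
    Amortisation occurs only inside one run of the dynamic program, so the bounds on operations are
    worst-case bounds. *)

Ltac upds := rewrite /= /upd /=;
  repeat match goal with |- context [@eq_op _ ?a ?b] =>
    rewrite (_ : (a == b) = false); [|by lia] end.

Ltac keeps_solve :=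
  split; [ upds; lia
         | move=> p hp; by upds
         | split; by upds
         | move=> p hp; by upds ].

Section Execution.
Variable R : realType.
Implicit Types s : state R.

(** Correctness lemmas exhibit one execution, whereas [reach] and [maintains_approx] speak of an
    arbitrary one; determinism identifies the two. *)
Lemma exec_det (c : cmd) s s1 t1 : exec c s s1 t1 ->
  forall s2 t2, exec c s s2 t2 -> s1 = s2 /\ t1 = t2.
Proof.
elim=> {c s s1 t1};
  intros; match goal with H : exec _ _ ?s' ?t' |- _ = ?s' /\ _ = ?t' =>
    inversion H; subst end;
  repeat match goal with
  | IH : (forall s2 t2, exec ?c ?s s2 t2 -> _), H : exec ?c ?s _ _ |- _ =>
      case: (IH _ _ H) => ? ?; subst; clear H IH
  | H1 : is_true ?b, H2 : is_true (~~ ?b) |- _ => by rewrite H1 in H2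
  end; by [].
Qed.

Fixpoint block (i : instr) (l : seq instr) : cmd :=
  if l is j :: l' then Seq (Instr i) (block j l') else Instr i.

Lemma exec_block i l s :
  exec (block i l) s (foldl (fun s i => eval_instr i s) s (i :: l)) (size l).+1.
Proof.
elim: l i s => [|j l IH] i s /=; first exact: ExecInstr.
by apply: (ExecSeq (t1 := 1)); [exact: ExecInstr | exact: IH].
Qed.

(** Blocks carry no mark of the constructor they hold: the type of a value fixes its shape, and sums
    store their tag as a [VN]. Every block takes two addresses, even for a single number, so the
    free pointer always advances by two. *)
Inductive datum := VN of nat | VR of R | VP of datum & datum.

(* Register conventions on the integer memory: cell 2 is the first free heap
   address, cell 3 the maintained data structure, cell 4 both the argument and
   the result of a routine, cell 5 a stack of saved pointers, cells 6-9 are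
   scratch; the heap starts at 16. Heap blocks are never modified, so that a
   representation stays valid for ever. *)
Fixpoint rep s (p : nat) (v : datum) : Prop :=
  (15 < p /\ p.+1 < zmem s 2)%N /\
  match v with
  | VN n => zmem s p = n
  | VR r => rmem s p = r
  | VP a b => rep s (zmem s p) a /\ rep s (zmem s p.+1) b
  end.

(** Cells 0, 1, 3 and the reals 0 to 4 hold the arguments, the parameters and the maintained
    structure, which a routine must leave alone. Cell 5 is missing because pushes and pops change
    it; complete routines restore it, which is [extends]. *)
Definition keeps s s' :=
  [/\ (zmem s 2 <= zmem s' 2)%N,
      forall p, (15 < p < zmem s 2)%N ->
        zmem s' p = zmem s p /\ rmem s' p = rmem s p,
      [/\ zmem s' 0 = zmem s 0, zmem s' 1 = zmem s 1 & zmem s' 3 = zmem s 3] &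
      forall p, (p < 5)%N -> rmem s' p = rmem s p].

Definition extends s s' := keeps s s' /\ zmem s' 5 = zmem s 5.

Lemma rep_keeps s s' p v : keeps s s' -> rep s p v -> rep s' p v.
Proof.
case=> H1 H2 _ _; elim: v p => [n|r|a IHa b IHb] p /= [[h1 h2] h3];
  have [e1 e2] := H2 p ltac:(lia); (split; first by split; lia).
- by rewrite e1.
- by rewrite e2.
- have [e3 _] := H2 p.+1 ltac:(lia).
  by rewrite e1 e3; case: h3 => ? ?; split; [exact: IHa | exact: IHb].
Qed.

Lemma keeps_trans s1 s2 s3 : keeps s1 s2 -> keeps s2 s3 -> keeps s1 s3.
Proof.
case=> a1 b1 [c1 d1 e1] f1 [a2 b2 [c2 d2 e2] f2]; split.
- by lia.
- by move=> p hp; have [-> ->] := b2 p ltac:(lia); apply: b1.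
- by rewrite c2 d2 e2.
- by move=> p hp; rewrite f2 // f1.
Qed.

Lemma extends_trans s1 s2 s3 : extends s1 s2 -> extends s2 s3 -> extends s1 s3.
Proof.
by move=> [k1 e1] [k2 e2]; split; [exact: keeps_trans k1 k2 | rewrite e2].
Qed.

Lemma rep_extends s s' p v : extends s s' -> rep s p v -> rep s' p v.
Proof. by case=> + _; apply: rep_keeps. Qed.

Lemma keeps_heap s s' : keeps s s' -> (15 < zmem s 2)%N -> (15 < zmem s' 2)%N.
Proof. by case=> + _ _ _; lia. Qed.

(* Cells 6 and 7 hold the components. *)
Definition cons_cell : cmd :=
  block (ZConst 8 1) [:: ZOp ZAdd 9 2 8; ZStore 2 6; ZStore 9 7;
    ZConst 8 0; ZOp ZAdd 4 2 8; ZConst 8 2; ZOp ZAdd 2 2 8].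

Lemma cons_cellP s : (15 < zmem s 2)%N ->
  exists s', [/\ exec cons_cell s s' 8, extends s s', zmem s' 4 = zmem s 2,
    zmem s' 2 = (zmem s 2).+2 &
    [/\ zmem s' (zmem s 2) = zmem s 6, zmem s' (zmem s 2).+1 = zmem s 7,
        zmem s' 6 = zmem s 6 & zmem s' 10 = zmem s 10]].
Proof.
move=> h; eexists; split; first exact: exec_block.
- by split; [keeps_solve | upds].
- by upds; rewrite addn0.
- by upds; rewrite addn2.
- by split; upds; rewrite ?addn1 ?eqxx.
Qed.

Definition alloc_nat : cmd :=
  block (ZStore 2 6) [:: ZConst 8 0; ZOp ZAdd 4 2 8; ZConst 8 2; ZOp ZAdd 2 2 8].

Definition alloc_real : cmd :=
  block (RStore 2 5) [:: ZConst 8 0; ZOp ZAdd 4 2 8; ZConst 8 2; ZOp ZAdd 2 2 8].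

Lemma alloc_natP s : (15 < zmem s 2)%N ->
  exists s', [/\ exec alloc_nat s s' 5, extends s s' &
    rep s' (zmem s' 4) (VN (zmem s 6))].
Proof.
move=> h; eexists; split; first exact: exec_block.
- by split; [keeps_solve | upds].
- by split; upds; rewrite addn0 ?eqxx //; split; lia.
Qed.

Lemma alloc_realP s : (15 < zmem s 2)%N ->
  exists s', [/\ exec alloc_real s s' 5, extends s s' &
    rep s' (zmem s' 4) (VR (rmem s 5))].
Proof.
move=> h; eexists; split; first exact: exec_block.
- by split; [keeps_solve | upds].
- by split; upds; rewrite addn0 ?eqxx //; split; lia.
Qed.

Lemma cons_rep s a b : (15 < zmem s 2)%N ->
  rep s (zmem s 6) a -> rep s (zmem s 7) b ->
  exists s', [/\ exec cons_cell s s' 8, extends s s' &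
    rep s' (zmem s' 4) (VP a b)].
Proof.
move=> h ha hb; have [s' [h1 h2 h3 h4 [h5 h6 _ _]]] := cons_cellP h.
exists s'; split=> //; rewrite h3 /= h5 h6; split; first by split; lia.
by split; apply: rep_extends h2 _.
Qed.

Lemma rep_heap s p v : rep s p v -> (15 < zmem s 2)%N.
Proof. by case: v => [n|r|a b] [[h1 h2] _]; lia. Qed.

(** Different types may share encodings: [bool] with the numbers 0 and 1, [option A] with
    [unit + A], [seq A] with [option (A * seq A)]. Through [comp_ext] a program for one type then
    serves the other at no cost. *)
Class Enc (A : Type) := enc : A -> datum.

#[global] Instance enc_datum : Enc datum := id.
#[global] Instance enc_nat : Enc nat := VN.
#[global] Instance enc_real : Enc R := VR.
#[global] Instance enc_bool : Enc bool := fun b => VN (nat_of_bool b).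
#[global] Instance enc_unit : Enc unit := fun=> VN 0.
#[global] Instance enc_prod A B `{Enc A} `{Enc B} : Enc (A * B) :=
  fun x => VP (enc x.1) (enc x.2).
#[global] Instance enc_sum A B `{Enc A} `{Enc B} : Enc (A + B) :=
  fun x => match x with
           | inl a => VP (VN 0) (enc a)
           | inr b => VP (VN 1) (enc b)
           end.
#[global] Instance enc_option A `{Enc A} : Enc (option A) :=
  fun x => if x is Some a then VP (VN 1) (enc a) else VP (VN 0) (VN 0).
Fixpoint enc_list A (e : A -> datum) (l : seq A) : datum :=
  if l is a :: l' then VP (VN 1) (VP (e a) (enc_list e l')) else VP (VN 0) (VN 0).
#[global] Instance enc_seq A `{Enc A} : Enc (seq A) := enc_list enc.

(* Running time is measured up to a constant factor and an additive constant:
   [T = 0] means constant time. *)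
Definition computes A B `{Enc A} `{Enc B} (f : A -> B) (T : A -> nat) :=
  exists c K, forall s a, rep s (zmem s 4) (enc a) ->
    exists s' t, [/\ exec c s s' t, (t <= K * (T a).+1)%N, extends s s' &
                    rep s' (zmem s' 4) (enc (f a))].

Lemma comp_le A B `{Enc A} `{Enc B} (f : A -> B) (T T' : A -> nat) k :
  computes f T -> (forall a, (T a).+1 <= k * (T' a).+1)%N -> computes f T'.
Proof.
move=> [c [K Hc]] hT; exists c, (K * k)%N => s a ha.
have [s' [t [h1 h2 h3 h4]]] := Hc s a ha; exists s', t; split=> //.
by apply: leq_trans h2 _; rewrite -mulnA leq_mul2l hT orbT.
Qed.

Lemma comp_ext A B C `{Enc A} `{Enc B} `{Enc C} (f : A -> B) (g : A -> C)
    (T : A -> nat) :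
  (forall a, enc (f a) = enc (g a)) -> computes f T -> computes g T.
Proof.
move=> e [c [K Hc]]; exists c, K => s a ha.
have [s' [t [h1 h2 h3 h4]]] := Hc s a ha; exists s', t; split=> //.
by rewrite -e.
Qed.

Lemma comp_cast A B `{Enc A} `{Enc B} (f : A -> B) :
  (forall a, enc (f a) = enc a) -> computes f (fun=> 0%N).
Proof.
(* [cmd] has no empty program; a write to a scratch cell takes its place. *)
move=> e; exists (Instr (ZConst 6 0)), 1%N => s a ha; eexists; exists 1%N; split.
- exact: ExecInstr.
- by [].
- by split; [keeps_solve | upds].
- by rewrite e; have ? := rep_heap ha; apply: rep_keeps ha; keeps_solve.
Qed.

Lemma comp_id A `{Enc A} : computes (fun a : A => a) (fun=> 0%N).
Proof. exact: comp_cast. Qed.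

Lemma comp_comp A B C `{Enc A} `{Enc B} `{Enc C}
    (g : B -> C) Tg (f : A -> B) Tf :
  computes g Tg -> computes f Tf ->
  computes (fun a => g (f a)) (fun a => Tf a + Tg (f a))%N.
Proof.
move=> [cg [Kg Hg]] [cf [Kf Hf]]; exists (Seq cf cg), (Kf + Kg)%N => s a ha.
have [s1 [t1 [h1 h2 h3 h4]]] := Hf s a ha.
have [s2 [t2 [k1 k2 k3 k4]]] := Hg s1 _ h4.
exists s2, (t1 + t2)%N; split=> //.
- exact: ExecSeq h1 k1.
- by nia.
- exact: extends_trans h3 k3.
Qed.

Lemma comp_fst A B `{Enc A} `{Enc B} : computes (fun x : A * B => x.1) (fun=> 0%N).
Proof.
exists (Instr (ZLoad 4 4)), 1%N => s [a b] /= [h1 [h2 h3]].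
have e : extends s (eval_instr (ZLoad 4 4) s) by split; [keeps_solve | upds].
eexists; exists 1%N; split; first exact: ExecInstr.
- by [].
- exact: e.
- by rewrite {2}/eval_instr /= /upd /=; apply: rep_extends e _.
Qed.

Lemma comp_snd A B `{Enc A} `{Enc B} : computes (fun x : A * B => x.2) (fun=> 0%N).
Proof.
exists (block (ZConst 6 1) [:: ZOp ZAdd 6 4 6; ZLoad 4 6]), 3%N.
move=> s [a b] [h1 [h2 h3]].
set s' := foldl (fun s i => eval_instr i s) s
            [:: ZConst 6 1; ZOp ZAdd 6 4 6; ZLoad 4 6].
have e : extends s s' by split; [keeps_solve | upds].
exists s', 3%N; split=> //; first exact: exec_block.
have -> : zmem s' 4 = zmem s (zmem s 4).+1 by upds; rewrite addn1.
exact: rep_extends e _.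
Qed.

(** The stack is a linked list of heap cells, so it needs no memory area of its own, and a push
    never overwrites a block. *)
Definition push_arg : cmd :=
  Seq (block (ZConst 8 0) [:: ZOp ZAdd 6 4 8; ZOp ZAdd 7 5 8])
  (Seq cons_cell (block (ZConst 8 0) [:: ZOp ZAdd 5 4 8; ZOp ZAdd 4 6 8])).

Lemma push_argP s : (15 < zmem s 2)%N ->
  exists s1, [/\ exec push_arg s s1 14, keeps s s1, zmem s1 4 = zmem s 4 &
    [/\ 15 < zmem s1 5, (zmem s1 5).+1 < zmem s1 2,
        zmem s1 (zmem s1 5).+1 = zmem s 5 & zmem s1 (zmem s1 5) = zmem s 4]%N].
Proof.
move=> hs.
set r1 := foldl (fun s i => eval_instr i s) s
            [:: ZConst 8 0; ZOp ZAdd 6 4 8; ZOp ZAdd 7 5 8].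
have k1 : extends s r1 by split; [keeps_solve | upds].
have [r2 [x1 [x2 _] x3 x4 [x5 x6 x7 x8]]] := @cons_cellP r1 ltac:(by []).
set r3 := foldl (fun s i => eval_instr i s) r2
            [:: ZConst 8 0; ZOp ZAdd 5 4 8; ZOp ZAdd 4 6 8].
have hr2 : zmem r2 2 = (zmem s 2).+2 by rewrite x4; upds.
have k3 : keeps r2 r3 by keeps_solve.
have e5 : zmem r3 5 = zmem s 2 by upds; rewrite addn0 x3; upds.
exists r3; split.
- apply: (ExecSeq (t1 := 3) (t2 := 11)); first exact: exec_block.
  by apply: (ExecSeq (t1 := 8) (t2 := 3) x1); exact: exec_block.
- by case: k1 => k1 _; apply: keeps_trans k1 (keeps_trans x2 k3).
- by upds; rewrite addn0 x7; upds; rewrite addn0.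
- rewrite e5; split=> //; first by upds; rewrite hr2.
  + by move: x6; upds => ->; rewrite addn0.
  + by move: x5; upds => ->; rewrite addn0.
Qed.

(** Used between the two evaluations of a pair: the first result replaces the saved argument on top
    of the stack, and the argument returns to cell 4. *)
Definition swap_arg : cmd :=
  Seq (block (ZConst 8 1)
    [:: ZOp ZAdd 9 5 8; ZLoad 7 9; ZConst 8 0; ZOp ZAdd 6 4 8; ZLoad 10 5])
  (Seq cons_cell (block (ZConst 8 0) [:: ZOp ZAdd 5 4 8; ZOp ZAdd 4 10 8])).

Lemma swap_argP s : (15 < zmem s 2)%N -> (15 < zmem s 5)%N ->
  exists s1, [/\ exec swap_arg s s1 17, keeps s s1,
    zmem s1 4 = zmem s (zmem s 5) &
    [/\ 15 < zmem s1 5, (zmem s1 5).+1 < zmem s1 2,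
        zmem s1 (zmem s1 5).+1 = zmem s (zmem s 5).+1 &
        zmem s1 (zmem s1 5) = zmem s 4]%N].
Proof.
move=> hs h5.
set r1 := foldl (fun s i => eval_instr i s) s
  [:: ZConst 8 1; ZOp ZAdd 9 5 8; ZLoad 7 9; ZConst 8 0; ZOp ZAdd 6 4 8;
      ZLoad 10 5].
have k1 : extends s r1 by split; [keeps_solve | upds].
have [r2 [x1 [x2 _] x3 x4 [x5 x6 x7 x8]]] := @cons_cellP r1 ltac:(by []).
set r3 := foldl (fun s i => eval_instr i s) r2
            [:: ZConst 8 0; ZOp ZAdd 5 4 8; ZOp ZAdd 4 10 8].
have hr2 : zmem r2 2 = (zmem s 2).+2 by rewrite x4; upds.
have k3 : keeps r2 r3 by keeps_solve.
have e5 : zmem r3 5 = zmem s 2 by upds; rewrite addn0 x3; upds.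
exists r3; split.
- apply: (ExecSeq (t1 := 6) (t2 := 11)); first exact: exec_block.
  by apply: (ExecSeq (t1 := 8) (t2 := 3) x1); exact: exec_block.
- by case: k1 => k1 _; apply: keeps_trans k1 (keeps_trans x2 k3).
- by upds; rewrite addn0 x8; upds.
- rewrite e5; split=> //; first by upds; rewrite hr2.
  + by move: x6; upds => ->; rewrite addn1.
  + by move: x5; upds => ->; rewrite addn0.
Qed.

Definition pop_cons : cmd :=
  Seq (block (ZLoad 6 5)
    [:: ZConst 8 0; ZOp ZAdd 7 4 8; ZConst 8 1; ZOp ZAdd 9 5 8; ZLoad 5 9])
  cons_cell.

Lemma pop_consP s a b : (15 < zmem s 5)%N ->
  rep s (zmem s (zmem s 5)) a -> rep s (zmem s 4) b ->
  exists s1, [/\ exec pop_cons s s1 14, keeps s s1,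
    zmem s1 5 = zmem s (zmem s 5).+1 & rep s1 (zmem s1 4) (VP a b)].
Proof.
move=> h5 ha hb; have hs := rep_heap ha.
set r1 := foldl (fun s i => eval_instr i s) s
  [:: ZLoad 6 5; ZConst 8 0; ZOp ZAdd 7 4 8; ZConst 8 1; ZOp ZAdd 9 5 8;
      ZLoad 5 9].
have k1 : keeps s r1 by keeps_solve.
have [||s2 [x1 [x2 x3] x4]] := @cons_rep r1 a b ltac:(by []).
- by apply: (rep_keeps k1); upds.
- by apply: (rep_keeps k1); upds; rewrite addn0.
exists s2; split=> //.
- by apply: (ExecSeq (t1 := 6) (t2 := 8) _ x1); exact: exec_block.
- exact: keeps_trans k1 x2.
- by rewrite x3; upds; rewrite addn1.
Qed.

Lemma comp_pair A B C `{Enc A} `{Enc B} `{Enc C}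
    (f : A -> B) Tf (g : A -> C) Tg :
  computes f Tf -> computes g Tg ->
  computes (fun a => (f a, g a)) (fun a => Tf a + Tg a)%N.
Proof.
move=> [cf [Kf Hf]] [cg [Kg Hg]].
exists (Seq push_arg (Seq cf (Seq swap_arg (Seq cg pop_cons)))).
exists (Kf + Kg + 50)%N => s a ha.
have [s1 [e1 k1 p1 [q1 q2 q3 q4]]] := push_argP (rep_heap ha).
have ha1 : rep s1 (zmem s1 4) (enc a) by rewrite p1; exact: rep_keeps k1 ha.
have [s2 [t2 [e2 l2 [k2 k25] r2]]] := Hf s1 a ha1.
have [s3 [e3 k3 p3 [u1 u2 u3 u4]]] := @swap_argP s2 (rep_heap r2) ltac:(lia).
have h2 : zmem s2 (zmem s2 5) = zmem s 4.
  by rewrite k25; case: k2 => _ /(_ (zmem s1 5) ltac:(lia)) [-> _] _ _.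
have h3 : zmem s2 (zmem s2 5).+1 = zmem s 5.
  by rewrite k25; case: k2 => _ /(_ (zmem s1 5).+1 ltac:(lia)) [-> _] _ _.
have k13 := keeps_trans k1 (keeps_trans k2 k3).
have ha3 : rep s3 (zmem s3 4) (enc a).
  by rewrite p3 h2; apply: rep_keeps k13 ha.
have [s4 [t4 [e4 l4 [k4 k45] r4]]] := Hg s3 a ha3.
have h4 : zmem s4 (zmem s4 5) = zmem s2 4.
  by rewrite k45; case: k4 => _ /(_ (zmem s3 5) ltac:(lia)) [-> _] _ _.
have h5 : zmem s4 (zmem s4 5).+1 = zmem s 5.
  rewrite k45; case: k4 => _ /(_ (zmem s3 5).+1 ltac:(lia)) [-> _] _ _.
  by rewrite u3.
have [|||s5 [e5 k5 p5 r5]] := @pop_consP s4 (enc (f a)) (enc (g a)).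
- by rewrite k45.
- by rewrite h4; apply: (rep_keeps k4); apply: (rep_keeps k3).
- by [].
exists s5, (14 + (t2 + (17 + (t4 + 14))))%N; split.
- by do !(apply: ExecSeq; first by eassumption).
- by nia.
- by split; [exact: keeps_trans k13 (keeps_trans k4 k5) | rewrite p5 h5].
- exact: r5.
Qed.

Lemma comp_constn A `{Enc A} (n : nat) : computes (fun _ : A => n) (fun=> 0%N).
Proof.
exists (Seq (Instr (ZConst 6 n)) alloc_nat), 6%N => s a ha.
have hs := rep_heap ha; set s1 := eval_instr (ZConst 6 n) s.
have k1 : extends s s1 by split; [keeps_solve | upds].
have [s2 [x1 x2 x3]] := @alloc_natP s1 hs.
exists s2, 6%N; split=> //.
- by apply: (ExecSeq (t1 := 1) (t2 := 5) _ x1); exact: ExecInstr.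
- exact: extends_trans k1 x2.
Qed.

Definition get_ptrs : cmd :=
  block (ZLoad 6 4) [:: ZConst 7 1; ZOp ZAdd 7 4 7; ZLoad 7 7].

Lemma get_ptrsP s : (15 < zmem s 4)%N -> (15 < zmem s 2)%N ->
  exists s1, [/\ exec get_ptrs s s1 4, extends s s1,
    zmem s1 6 = zmem s (zmem s 4) & zmem s1 7 = zmem s (zmem s 4).+1].
Proof.
move=> h4 h; eexists; split; first exact: exec_block.
- by split; [keeps_solve | upds].
- by upds.
- by upds; rewrite addn1.
Qed.

Definition nat_args : cmd := Seq get_ptrs (block (ZLoad 6 6) [:: ZLoad 7 7]).

Lemma nat_argsP s a b : rep s (zmem s 4) (VP (VN a) (VN b)) ->
  exists s1, [/\ exec nat_args s s1 6, extends s s1, zmem s1 6 = a &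
    zmem s1 7 = b].
Proof.
move=> hr; have hs := rep_heap hr; case: hr => [[h1 h2] [[h3 h4] [h5 h6]]].
have [s1 [x1 x2 x3 x4]] := @get_ptrsP s h1 hs.
have hs1 := keeps_heap x2.1 hs.
have k : extends s1 (foldl (fun s i => eval_instr i s) s1 [:: ZLoad 6 6; ZLoad 7 7]).
  by split; [keeps_solve | upds].
case: (x2) => [[_ k1 _ _] _].
eexists; split.
- by apply: (ExecSeq (t1 := 4) (t2 := 2) x1); exact: exec_block.
- exact: extends_trans x2 k.
- upds; rewrite x3.
  by have [->] := k1 (zmem s (zmem s 4)) ltac:(lia).
- upds; rewrite x4.
  have [e _] := k1 (zmem s (zmem s 4).+1) ltac:(lia).
  by rewrite e.
Qed.

Definition real_args : cmd := Seq get_ptrs (block (RLoad 5 6) [:: RLoad 6 7]).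

Lemma real_argsP s a b : rep s (zmem s 4) (VP (VR a) (VR b)) ->
  exists s1, [/\ exec real_args s s1 6, extends s s1, rmem s1 5 = a &
    rmem s1 6 = b].
Proof.
move=> hr; have hs := rep_heap hr; case: hr => [[h1 h2] [[h3 h4] [h5 h6]]].
have [s1 [x1 x2 x3 x4]] := @get_ptrsP s h1 hs.
have hs1 := keeps_heap x2.1 hs.
have k : extends s1 (foldl (fun s i => eval_instr i s) s1 [:: RLoad 5 6; RLoad 6 7]).
  by split; [keeps_solve | upds].
case: (x2) => [[_ k1 _ _] _].
eexists; split.
- by apply: (ExecSeq (t1 := 4) (t2 := 2) x1); exact: exec_block.
- exact: extends_trans x2 k.
- upds; rewrite x3.
  by have [_ ->] := k1 (zmem s (zmem s 4)) ltac:(lia).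
- upds; rewrite x4.
  have [_ e] := k1 (zmem s (zmem s 4).+1) ltac:(lia).
  by rewrite e.
Qed.

Lemma comp_zop0 (o : zop) :
  computes (fun x : nat * nat => eval_zop o x.1 x.2) (fun=> 0%N).
Proof.
exists (Seq nat_args (Seq (Instr (ZOp o 6 6 7)) alloc_nat)), 12%N => s [a b] ha.
have hs := rep_heap ha.
have [s1 [x1 x2 x3 x4]] := nat_argsP ha.
have hs1 := keeps_heap x2.1 hs; set s2 := eval_instr (ZOp o 6 6 7) s1.
have k2 : extends s1 s2 by split; [keeps_solve | upds].
have [s3 [y1 y2 y3]] := @alloc_natP s2 hs1.
exists s3, 12%N; split=> //.
- apply: (ExecSeq (t1 := 6) (t2 := 6) x1).
  by apply: (ExecSeq (t1 := 1) (t2 := 5) _ y1); exact: ExecInstr.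
- exact: extends_trans x2 (extends_trans k2 y2).
- by move: y3; rewrite /s2 /= x3 x4.
Qed.

Lemma comp_rop0 (o : rop) :
  computes (fun x : R * R => eval_rop o x.1 x.2) (fun=> 0%N).
Proof.
exists (Seq real_args (Seq (Instr (ROp o 5 5 6)) alloc_real)), 12%N => s [a b] ha.
have hs := rep_heap ha.
have [s1 [x1 x2 x3 x4]] := real_argsP ha.
have hs1 := keeps_heap x2.1 hs; set s2 := eval_instr (ROp o 5 5 6) s1.
have k2 : extends s1 s2 by split; [keeps_solve | upds].
have [s3 [y1 y2 y3]] := @alloc_realP s2 hs1.
exists s3, 12%N; split=> //.
- apply: (ExecSeq (t1 := 6) (t2 := 6) x1).
  by apply: (ExecSeq (t1 := 1) (t2 := 5) _ y1); exact: ExecInstr.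
- exact: extends_trans x2 (extends_trans k2 y2).
- by move: y3; rewrite /s2 /= x3 x4.
Qed.

Definition flag_of (b : test) : cmd :=
  Seq (If b (Instr (ZConst 6 1)) (Instr (ZConst 6 0))) alloc_nat.

Lemma flag_ofP b s : (15 < zmem s 2)%N ->
  exists s', [/\ exec (flag_of b) s s' 7, extends s s' &
    rep s' (zmem s' 4) (enc (eval_test b s))].
Proof.
move=> hs.
set s1 := eval_instr (ZConst 6 (eval_test b s)) s.
have k1 : extends s s1 by split; [keeps_solve | upds].
have [s2 [x1 x2 x3]] := @alloc_natP s1 hs.
exists s2; split=> //; last exact: extends_trans k1 x2.
apply: (ExecSeq (t1 := 2) (t2 := 5) _ x1).
case h : (eval_test b s); rewrite /s1 h.
- by apply: ExecIfTrue => //; exact: ExecInstr.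
- by apply: ExecIfFalse; [rewrite h | exact: ExecInstr].
Qed.

Lemma comp_leqn0 : computes (fun x : nat * nat => x.1 <= x.2)%N (fun=> 0%N).
Proof.
exists (Seq nat_args (flag_of (ZLe 6 7))), 13%N => s [a b] ha.
have [s1 [x1 x2 x3 x4]] := nat_argsP ha.
have [s2 [y1 y2 y3]] := flag_ofP (ZLe 6 7) (keeps_heap x2.1 (rep_heap ha)).
exists s2, 13%N; split=> //; first exact: ExecSeq x1 y1.
- exact: extends_trans x2 y2.
- by move: y3; rewrite /= x3 x4.
Qed.

Lemma comp_ler0 : computes (fun x : R * R => x.1 <= x.2)%R (fun=> 0%N).
Proof.
exists (Seq real_args (flag_of (RLe 5 6))), 13%N => s [a b] ha.
have [s1 [x1 x2 x3 x4]] := real_argsP ha.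
have [s2 [y1 y2 y3]] := flag_ofP (RLe 5 6) (keeps_heap x2.1 (rep_heap ha)).
exists s2, 13%N; split=> //; first exact: ExecSeq x1 y1.
- exact: extends_trans x2 y2.
- by move: y3; rewrite /= x3 x4.
Qed.

Lemma comp_natr0 : computes (fun n : nat => n%:R : R)%R (fun=> 0%N).
Proof.
exists (Seq (block (ZLoad 6 4) [:: ROfNat 5 6]) alloc_real), 7%N => s a ha.
have hs := rep_heap ha; case: (ha) => [[h1 h2] h3].
set s1 := foldl (fun s i => eval_instr i s) s [:: ZLoad 6 4; ROfNat 5 6].
have k1 : extends s s1 by split; [keeps_solve | upds].
have [s3 [y1 y2 y3]] := @alloc_realP s1 hs.
exists s3, 7%N; split=> //.
- by apply: (ExecSeq (t1 := 2) (t2 := 5) _ y1); exact: exec_block.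
- exact: extends_trans k1 y2.
- by move: y3; rewrite /s1 /= /upd /= h3.
Qed.

(* Cells 6 and 7 receive the tag and the constant 0 it is compared with. *)
Definition open_tag : cmd := Seq get_ptrs
  (block (ZConst 8 0) [:: ZLoad 6 6; ZOp ZAdd 4 7 8; ZConst 7 0]).

Lemma open_tagP s n v : rep s (zmem s 4) (VP (VN n) v) ->
  exists s1, [/\ exec open_tag s s1 8, extends s s1,
    zmem s1 6 = n /\ zmem s1 7 = 0%N & rep s1 (zmem s1 4) v].
Proof.
move=> hr; have hs := rep_heap hr; case: hr => [[h1 h2] [[[h3 h4] h5] h6]].
have [s1 [x1 x2 x3 x4]] := @get_ptrsP s h1 hs.
have hs1 := keeps_heap x2.1 hs.
set s2 := foldl (fun s i => eval_instr i s) s1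
  [:: ZConst 8 0; ZLoad 6 6; ZOp ZAdd 4 7 8; ZConst 7 0].
have k : extends s1 s2 by split; [keeps_solve | upds].
case: (x2) => [[_ k1 _ _] _].
exists s2; split.
- by apply: (ExecSeq (t1 := 4) (t2 := 4) x1); exact: exec_block.
- exact: extends_trans x2 k.
- split; last by [].
  by upds; rewrite x3; have [->] := k1 (zmem s (zmem s 4)) ltac:(lia).
- apply: (rep_extends k); apply: (rep_extends x2).
  by upds; rewrite addn0 x4.
Qed.

(** The cost [t] decreases with every iteration and so proves termination as well. The body runs
    once before the loop, because [While] tests a tag that only the body produces. *)
Lemma comp_loop_rel A B `{Enc A} `{EB : Enc B} (step : A -> A + B) Ts
    (runs : A -> B -> nat -> Prop) (f : A -> B) T :
  computes step Ts ->
  (forall a b t, runs a b t ->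
     match step a with
     | inl a' => exists2 t', runs a' b t' & ((Ts a).+1 + t' <= t)%N
     | inr b' => b = b' /\ (Ts a <= t)%N
     end) ->
  (forall a, runs a (f a) (T a)) -> computes f T.
Proof.
move=> [cs [K Hs]] Hr Hf.
pose body := Seq cs open_tag.
exists (Seq body (While (ZLe 6 7) body)), (K + 9)%N => s a ha.
suff [s' [t1 [t2 [s1 [h1 h2 h3 h4 h5]]]]] : exists s' t1 t2 s1,
    [/\ exec body s s1 t1, exec (While (ZLe 6 7) body) s1 s' t2,
      (t1 + t2 <= (K + 9) * (T a).+1)%N, extends s s' &
      rep s' (zmem s' 4) (@enc B EB (f a))].
  by exists s', (t1 + t2)%N; split=> //; exact: ExecSeq h1 h2.
move: (f a) (T a) (Hf a) => b t hab.
elim: t {-2}t (leqnn t) s a ha b hab => [|N IH] t ht s a ha b hab.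
all: have := Hr _ _ _ hab; have [s1 [t1 [e1 l1 k1 r1]]] := Hs s a ha.
all: case e : (step a) r1 => [a'|b'] r1.
- by case=> t' _ h; lia.
- move=> [-> h].
  have [s2 [e2 k2 [h6 h7] r2]] := open_tagP r1.
  exists s2, (t1 + 8)%N, 1%N, s2; split=> //.
  + exact: ExecSeq e1 e2.
  + by apply: ExecWhileFalse; rewrite /= h6 h7.
  + by nia.
  + exact: extends_trans k1 k2.
- case=> t' ht' h.
  have [s2 [e2 k2 [h6 h7] r2]] := open_tagP r1.
  have [s' [t3 [t4 [s3 [i1 i2 i3 i4 i5]]]]] := IH t' ltac:(lia) s2 a' r2 b ht'.
  exists s', (t1 + 8)%N, (t3 + t4).+1, s2; split=> //.
  + exact: ExecSeq e1 e2.
  + by apply: ExecWhileTrue i1 i2; rewrite /= h6 h7.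
  + by nia.
  + exact: extends_trans k1 (extends_trans k2 i4).
- move=> [-> h].
  have [s2 [e2 k2 [h6 h7] r2]] := open_tagP r1.
  exists s2, (t1 + 8)%N, 1%N, s2; split=> //.
  + exact: ExecSeq e1 e2.
  + by apply: ExecWhileFalse; rewrite /= h6 h7.
  + by nia.
  + exact: extends_trans k1 k2.
Qed.

Lemma comp_loop A B `{Enc A} `{Enc B} (step : A -> A + B) Ts
    (f : A -> B) T :
  computes step Ts ->
  (forall a, match step a with
     | inl a' => f a = f a' /\ ((Ts a).+1 + T a' <= T a)%N
     | inr b => f a = b /\ (Ts a <= T a)%N
     end) -> computes f T.
Proof.
move=> cs h.
apply: (comp_loop_rel (runs := fun a b t => b = f a /\ t = T a) cs) => //.
move=> a b t [-> ->]; have := h a; case: (step a) => // a' [-> ?].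
by exists (T a').
Qed.

Lemma comp_sum A B C D `{Enc A} `{Enc B} `{Enc C} `{Enc D}
    (h : A -> B + C) Th (f : B -> D) Tf (g : C -> D) Tg :
  computes h Th -> computes f Tf -> computes g Tg ->
  computes (fun a => match h a with inl x => f x | inr y => g y end)
    (fun a => Th a + match h a with inl x => Tf x | inr y => Tg y end)%N.
Proof.
move=> [ch [Kh Hh]] [cf [Kf Hf]] [cg [Kg Hg]].
exists (Seq ch (Seq open_tag (If (ZLe 6 7) cf cg))), (Kh + Kf + Kg + 9)%N.
move=> s a ha; have [s1 [t1 [e1 l1 k1 r1]]] := Hh s a ha.
case e : (h a) r1 => [x|y] r1; have [s2 [e2 k2 [h6 h7] r2]] := open_tagP r1.
- have [s3 [t3 [e3 l3 k3 r3]]] := Hf _ _ r2.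
  exists s3, (t1 + (8 + t3.+1))%N; split=> //.
  + apply: (ExecSeq e1); apply: (ExecSeq e2).
    by apply: ExecIfTrue => //; rewrite /= h6 h7.
  + by nia.
  + exact: extends_trans k1 (extends_trans k2 k3).
- have [s3 [t3 [e3 l3 k3 r3]]] := Hg _ _ r2.
  exists s3, (t1 + (8 + t3.+1))%N; split=> //.
  + apply: (ExecSeq e1); apply: (ExecSeq e2).
    by apply: ExecIfFalse => //; rewrite /= h6 h7.
  + by nia.
  + exact: extends_trans k1 (extends_trans k2 k3).
Qed.

Section Lifted.
Context {A B C D : Type} {EA : Enc A} {EB : Enc B} {EC : Enc C} {ED : Enc D}.

Lemma c_fst (f : A -> B * C) T : computes f T -> computes (fun a => (f a).1) T.
Proof.
move=> h; apply: (comp_le (k := 1) (comp_comp (@comp_fst B C EB EC) h)) => a /=; lia.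
Qed.

Lemma c_snd (f : A -> B * C) T : computes f T -> computes (fun a => (f a).2) T.
Proof.
move=> h; apply: (comp_le (k := 1) (comp_comp (@comp_snd B C EB EC) h)) => a /=; lia.
Qed.

Lemma c_app (h : B -> C) Th (f : A -> B) Tf :
  computes h Th -> computes f Tf -> computes (fun a => h (f a)) (fun a => Tf a + Th (f a))%N.
Proof. exact: comp_comp. Qed.

Lemma c_app2 (h : B -> C -> D) Th (f : A -> B) Tf (g : A -> C) Tg :
  computes (fun p => h p.1 p.2) Th -> computes f Tf -> computes g Tg ->
  computes (fun a => h (f a) (g a)) (fun a => Tf a + Tg a + Th (f a, g a))%N.
Proof. by move=> ch cf cg; have := comp_comp ch (comp_pair cf cg). Qed.

Lemma c_true : computes (fun _ : A => true) (fun=> 0%N).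
Proof. by apply: comp_ext (comp_constn 1). Qed.

Lemma c_false : computes (fun _ : A => false) (fun=> 0%N).
Proof. by apply: comp_ext (comp_constn 0). Qed.

Lemma c_tt : computes (fun _ : A => tt) (fun=> 0%N).
Proof. by apply: comp_ext (comp_constn 0). Qed.

Lemma c_inl (f : A -> B) T : computes f T -> computes (fun a => inl (f a) : B + C) T.
Proof.
move=> h; have := comp_pair (comp_constn 0) h.
by move=> h'; apply: (comp_ext _ h').
Qed.

Lemma c_inr (f : A -> C) T : computes f T -> computes (fun a => inr (f a) : B + C) T.
Proof.
move=> h; have := comp_pair (comp_constn 1) h.
by move=> h'; apply: (comp_ext _ h').
Qed.

Lemma c_some (f : A -> B) T : computes f T -> computes (fun a => Some (f a)) T.
Proof.
move=> h; have := comp_pair (comp_constn 1) h.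
by move=> h'; apply: (comp_ext _ h').
Qed.

Lemma c_none : computes (fun _ : A => None : option B) (fun=> 0%N).
Proof.
have h := comp_pair (@comp_constn A EA 0) (@comp_constn A EA 0).
exact: (comp_ext (fun=> erefl) h).
Qed.

Lemma c_nil : computes (fun _ : A => [::] : seq B) (fun=> 0%N).
Proof.
have h := comp_pair (@comp_constn A EA 0) (@comp_constn A EA 0).
exact: (comp_ext (fun=> erefl) h).
Qed.

Lemma c_cons (f : A -> B) Tf (g : A -> seq B) Tg :
  computes f Tf -> computes g Tg -> computes (fun a => f a :: g a) (fun a => Tf a + Tg a)%N.
Proof.
move=> cf cg; have := comp_pair (comp_constn 1) (comp_pair cf cg).
by move=> h'; apply: (comp_ext _ h').
Qed.

Lemma c_if (b : A -> bool) Tb (f g : A -> B) Tf Tg :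
  computes b Tb -> computes f Tf -> computes g Tg ->
  computes (fun a => if b a then f a else g a)
    (fun a => Tb a + if b a then Tf a else Tg a)%N.
Proof.
move=> cb cf cg; have := comp_pair cb (comp_id (A := A)).
(* The pair [(b a, a)] and the sum on the right have the same encoding, so a conditional is a case
   distinction on a sum. *)
move=> h; have {}h : computes (fun a => if b a then inr a else inl a : A + A)
    (fun a => Tb a + 0)%N by apply: (comp_ext _ h) => a; case: (b a).
apply: (comp_le (k := 1)).
  by apply: (comp_ext _ (comp_sum h cg cf)) => a; case: (b a).
by move=> a /=; case: (b a); lia.
Qed.

End Lifted.

Section Matching.
Context {A B C D : Type} {EA : Enc A} {EB : Enc B} {EC : Enc C} {ED : Enc D}.

Lemma c_sum (h : A -> B + C) Th (f : A -> B -> D) Tf (g : A -> C -> D) Tg :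
  computes h Th -> computes (fun p => f p.1 p.2) Tf -> computes (fun p => g p.1 p.2) Tg ->
  computes (fun a => match h a with inl x => f a x | inr y => g a y end)
    (fun a => Th a + match h a with inl x => Tf (a, x) | inr y => Tg (a, y) end)%N.
Proof.
move=> ch cf cg.
(* The payload is kept as an untyped [datum], so that [a] can be inserted behind the tag by
   projections alone. This evaluates [h] twice, whence the factor 2 below. *)
pose tag (x : B + C) : nat * datum :=
  match x with inl b => (0%N, EB b) | inr c => (1%N, EC c) end.
have ct : computes (fun a => tag (h a)) Th by apply: comp_ext ch => a; case: (h a).
have := comp_pair (c_fst ct) (comp_pair (comp_id (A := A)) (c_snd ct)).
pose d a : (A * B) + (A * C) :=
  match h a with inl x => inl (a, x) | inr y => inr (a, y) end.
move=> hd; have {}hd : computes d (fun a => Th a + (0 + Th a))%N.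
  by apply: (comp_ext _ hd) => a; rewrite /d /tag; case: (h a).
apply: (comp_le (k := 2)).
  by apply: (comp_ext _ (comp_sum hd cf cg)) => a; rewrite /d; case: (h a).
by move=> a /=; rewrite /d; case: (h a) => ?; lia.
Qed.

End Matching.

Section MatchingOption.
Context {A B C D : Type} {EA : Enc A} {EB : Enc B} {EC : Enc C} {ED : Enc D}.

Lemma c_option (h : A -> option B) Th (f : A -> B -> D) Tf (g : A -> D) Tg :
  computes h Th -> computes (fun p => f p.1 p.2) Tf -> computes g Tg ->
  computes (fun a => match h a with Some x => f a x | None => g a end)
    (fun a => Th a + match h a with Some x => Tf (a, x) | None => Tg a end)%N.
Proof.
move=> ch cf cg.
have ch' : computes (fun a => if h a is Some x then inr x else inl tt : unit + B) Th.
  by apply: comp_ext ch => a; case: (h a).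
have := c_sum (f := fun a _ => g a) ch' (comp_comp cg (@comp_fst A unit EA _)) cf.
move=> hs; apply: (comp_le (k := 1)).
  by apply: (comp_ext _ hs) => a; case: (h a).
by move=> a /=; case: (h a) => [?|]; lia.
Qed.

End MatchingOption.

Section MatchingList.
Context {A B C D : Type} {EA : Enc A} {EB : Enc B} {EC : Enc C} {ED : Enc D}.

Lemma c_list (h : A -> seq B) Th (f : A -> B -> seq B -> D) Tf (g : A -> D) Tg :
  computes h Th -> computes (fun p => f p.1 p.2.1 p.2.2) Tf -> computes g Tg ->
  computes (fun a => match h a with x :: l => f a x l | [::] => g a end)
    (fun a => Th a + match h a with x :: l => Tf (a, (x, l)) | [::] => Tg a end)%N.
Proof.
move=> ch cf cg.
have ch' : computes (fun a => if h a is x :: l then Some (x, l) else None) Th.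
  by apply: comp_ext ch => a; case: (h a).
have hs := c_option (f := fun a x => f a x.1 x.2) ch' cf cg.
apply: (comp_le (k := 1)).
  by apply: (comp_ext _ hs) => a; case: (h a).
by move=> a /=; case: (h a) => [|? ?]; lia.
Qed.

End MatchingList.

Section LiftedArith.
Context {A : Type} {EA : Enc A}.

Lemma c_addn (f g : A -> nat) Tf Tg : computes f Tf -> computes g Tg ->
  computes (fun a => f a + g a)%N (fun a => Tf a + Tg a)%N.
Proof.
move=> cf cg; have h := comp_comp (comp_zop0 ZAdd) (comp_pair cf cg).
by apply: (comp_le (k := 1) h) => a; lia.
Qed.

Lemma c_subn (f g : A -> nat) Tf Tg : computes f Tf -> computes g Tg ->
  computes (fun a => f a - g a)%N (fun a => Tf a + Tg a)%N.
Proof.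
move=> cf cg; have h := comp_comp (comp_zop0 ZSub) (comp_pair cf cg).
by apply: (comp_le (k := 1) h) => a; lia.
Qed.

Lemma c_succn (f : A -> nat) Tf : computes f Tf -> computes (fun a => (f a).+1) Tf.
Proof.
move=> cf; have h := c_addn (comp_constn 1) cf.
by apply: (comp_le (k := 1) h) => a; lia.
Qed.

Lemma c_leqn (f g : A -> nat) Tf Tg : computes f Tf -> computes g Tg ->
  computes (fun a => f a <= g a)%N (fun a => Tf a + Tg a)%N.
Proof.
move=> cf cg; have h := comp_comp comp_leqn0 (comp_pair cf cg).
by apply: (comp_le (k := 1) h) => a; lia.
Qed.

Lemma c_eqn (f g : A -> nat) Tf Tg : computes f Tf -> computes g Tg ->
  computes (fun a => f a == g a) (fun a => Tf a + Tg a)%N.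
Proof.
move=> cf cg; have h := c_if (c_leqn cf cg) (c_leqn cg cf) c_false.
apply: (comp_le (k := 2)); first by apply: (comp_ext _ h) => a; rewrite eqn_leq.
by move=> a /=; case: ifP; lia.
Qed.

Lemma c_addr (f g : A -> R) Tf Tg : computes f Tf -> computes g Tg ->
  computes (fun a => f a + g a)%R (fun a => Tf a + Tg a)%N.
Proof.
move=> cf cg; have h := comp_comp (comp_rop0 RAdd) (comp_pair cf cg).
by apply: (comp_le (k := 1) h) => a; lia.
Qed.

Lemma c_subr (f g : A -> R) Tf Tg : computes f Tf -> computes g Tg ->
  computes (fun a => f a - g a)%R (fun a => Tf a + Tg a)%N.
Proof.
move=> cf cg; have h := comp_comp (comp_rop0 RSub) (comp_pair cf cg).
by apply: (comp_le (k := 1) h) => a; lia.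
Qed.

Lemma c_mulr (f g : A -> R) Tf Tg : computes f Tf -> computes g Tg ->
  computes (fun a => f a * g a)%R (fun a => Tf a + Tg a)%N.
Proof.
move=> cf cg; have h := comp_comp (comp_rop0 RMul) (comp_pair cf cg).
by apply: (comp_le (k := 1) h) => a; lia.
Qed.

Lemma c_divr (f g : A -> R) Tf Tg : computes f Tf -> computes g Tg ->
  computes (fun a => f a / g a)%R (fun a => Tf a + Tg a)%N.
Proof.
move=> cf cg; have h := comp_comp (comp_rop0 RDiv) (comp_pair cf cg).
by apply: (comp_le (k := 1) h) => a; lia.
Qed.

Lemma c_ler (f g : A -> R) Tf Tg : computes f Tf -> computes g Tg ->
  computes (fun a => f a <= g a)%R (fun a => Tf a + Tg a)%N.
Proof.
move=> cf cg; have h := comp_comp comp_ler0 (comp_pair cf cg).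
by apply: (comp_le (k := 1) h) => a; lia.
Qed.

Lemma c_negb (f : A -> bool) Tf : computes f Tf -> computes (fun a => ~~ f a) Tf.
Proof.
move=> cf; have h := c_if cf c_false c_true.
by apply: (comp_le (k := 1) h) => a; case: ifP; lia.
Qed.

Lemma c_ltr (f g : A -> R) Tf Tg : computes f Tf -> computes g Tg ->
  computes (fun a => f a < g a)%R (fun a => Tf a + Tg a)%N.
Proof.
move=> cf cg; have h := c_negb (c_ler cg cf).
apply: (comp_le (k := 1)); first by apply: (comp_ext _ h) => a; rewrite -ltNge.
by move=> a; lia.
Qed.

Lemma c_andb (f g : A -> bool) Tf Tg : computes f Tf -> computes g Tg ->
  computes (fun a => f a && g a) (fun a => Tf a + Tg a)%N.
Proof.
move=> cf cg; have h := c_if cf cg c_false.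
apply: (comp_le (k := 1)); first by apply: (comp_ext _ h).
by move=> a /=; case: ifP; lia.
Qed.

Lemma c_orb (f g : A -> bool) Tf Tg : computes f Tf -> computes g Tg ->
  computes (fun a => f a || g a) (fun a => Tf a + Tg a)%N.
Proof.
move=> cf cg; have h := c_if cf c_true cg.
apply: (comp_le (k := 1)); first by apply: (comp_ext _ h).
by move=> a /=; case: ifP; lia.
Qed.

Lemma c_natr (f : A -> nat) Tf : computes f Tf -> computes (fun a => (f a)%:R : R)%R Tf.
Proof.
move=> cf; have h := comp_comp comp_natr0 cf.
by apply: (comp_le (k := 1) h) => a; lia.
Qed.

End LiftedArith.

End Execution.

(** The hook of [cstep]: it is redefined after each group of operations, so that programs are read
    off the syntax of functions built from them. *)
Ltac cuser := fail.

Ltac cstep := cbv beta; lazymatch goal with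
  | |- computes (fun x => x) _ => apply comp_id
  | |- computes fst _ => apply comp_fst
  | |- computes snd _ => apply comp_snd
  | |- computes (fun _ => true) _ => apply c_true
  | |- computes (fun _ => false) _ => apply c_false
  | |- computes (fun _ => tt) _ => apply c_tt
  | |- computes (fun _ => None) _ => apply c_none
  | |- computes (fun _ => nil) _ => apply c_nil
  | |- @computes _ _ nat _ _ (fun _ => ?n) _ => apply comp_constn
  | |- computes (fun x => pair (@?f x) (@?g x)) _ => eapply (comp_pair (f:=f) (g:=g))
  | |- computes (fun x => fst (@?f x)) _ => eapply (c_fst (f:=f))
  | |- computes (fun x => snd (@?f x)) _ => eapply (c_snd (f:=f))
  | |- computes (fun x => inl (@?f x)) _ => eapply (c_inl (f:=f))
  | |- computes (fun x => inr (@?f x)) _ => eapply (c_inr (f:=f))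
  | |- computes (fun x => Some (@?f x)) _ => eapply (c_some (f:=f))
  | |- computes (fun x => cons (@?f x) (@?g x)) _ => eapply (c_cons (f:=f) (g:=g))
  | |- computes (fun x => S (@?f x)) _ => eapply (c_succn (f:=f))
  | |- computes (fun x => addn (@?f x) (@?g x)) _ => eapply (c_addn (f:=f) (g:=g))
  | |- computes (fun x => subn (@?f x) (@?g x)) _ => eapply (c_subn (f:=f) (g:=g))
  | |- computes (fun x => leq (@?f x) (@?g x)) _ => eapply (c_leqn (f:=f) (g:=g))
  | |- computes (fun x => @eq_op _ (@?f x) (@?g x)) _ => eapply (c_eqn (f:=f) (g:=g))
  | |- computes (fun x => negb (@?f x)) _ => eapply (c_negb (f:=f))
  | |- computes (fun x => andb (@?f x) (@?g x)) _ => eapply (c_andb (f:=f) (g:=g))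
  | |- computes (fun x => orb (@?f x) (@?g x)) _ => eapply (c_orb (f:=f) (g:=g))
  | |- computes (fun x => GRing.natmul (GRing.one _) (@?f x)) _ => eapply (c_natr (f:=f))
  | |- computes (fun x => GRing.add (@?f x) (GRing.opp (@?g x))) _ => eapply (c_subr (f:=f) (g:=g))
  | |- computes (fun x => GRing.add (@?f x) (@?g x)) _ => eapply (c_addr (f:=f) (g:=g))
  | |- computes (fun x => GRing.mul (@?f x) (GRing.inv (@?g x))) _ => eapply (c_divr (f:=f) (g:=g))
  | |- computes (fun x => GRing.mul (@?f x) (@?g x)) _ => eapply (c_mulr (f:=f) (g:=g))
  | |- computes (fun x => Order.le (@?f x) (@?g x)) _ => eapply (c_ler (f:=f) (g:=g))
  | |- computes (fun x => Order.lt (@?f x) (@?g x)) _ => eapply (c_ltr (f:=f) (g:=g))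
  | |- computes (fun x => match @?h x with _ => _ end) _ =>
      let t := type of h in
      lazymatch t with
      | _ -> sum _ _ => eapply (c_sum (h:=h))
      | _ -> option _ => eapply (c_option (h:=h))
      | _ -> list _ => eapply (c_list (h:=h))
      | _ -> bool => eapply (c_if (b:=h))
      | _ => cuser
      end
  | _ => cuser
  end.

Ltac csolve := repeat cstep.

Ltac csplit := repeat match goal with
  | |- context [match ?x with _ => _ end] => destruct x
  end.

Ltac c0 := eapply (comp_le (k := 1)); [by csolve | by intros; simpl; csplit].

(** * Linear recursion *)

Section LinRec.
Variable R : realType.
Local Notation Enc := (Enc R).

(** A recursion that is not a tail recursion becomes a loop with an explicit stack of the pending
    [c]: state [inl] descends, state [inr] unwinds. Each level takes one iteration in either
    direction, hence the doubled [T] in [TF]. *)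
Lemma comp_linrec A B C `{EA : Enc A} `{EB : Enc B} `{EC : Enc C}
    (step : A -> (A * C) + B) Ts (post : C -> B -> B) Tp (f : A -> B) T :
  computes step Ts -> computes (fun p => post p.1 p.2) Tp ->
  (forall a, match step a with
     | inl (a', c) =>
         f a = post c (f a') /\ ((Ts a + Tp (c, f a')).+1 + T a' <= T a)%N
     | inr b => f a = b /\ (Ts a <= T a)%N
     end) -> computes f T.
Proof.
move=> cs cp h.
pose sstep (x : (A + B) * seq C) : (A + B) * seq C + B :=
  match x.1 with
  | inl a => match step a with
             | inl y => inl (inl y.1, y.2 :: x.2)
             | inr b => inl (inr b, x.2)
             end
  | inr b => match x.2 with
             | c :: st => inl (inr (post c b), st)
             | [::] => inr b
             end
  end.
pose unwind b st := foldl (fun b c => post c b) b st.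
pose F (x : (A + B) * seq C) :=
  match x.1 with inl a => unwind (f a) x.2 | inr b => unwind b x.2 end.
pose Tu := fix Tu b st := if st is c :: st' then (Tp (c, b)).+1 + Tu (post c b) st'
  else 0%N.
pose TF (x : (A + B) * seq C) :=
  match x.1 with inl a => (T a).*2.+1 + Tu (f a) x.2 | inr b => Tu b x.2 end.
pose TS (x : (A + B) * seq C) :=
  match x.1 with
  | inl a => Ts a
  | inr b => if x.2 is c :: _ then Tp (c, b) else 0%N
  end.
have cF : computes F TF.
  apply: (@comp_loop _ _ _ _ _ sstep TS).
    rewrite /sstep; eapply (comp_le (k := 1)).
      csolve; [eapply (c_app cs); by csolve | eapply (c_app2 cp); by csolve].
    move=> [[a|b] st] /=; rewrite /TS /=; first by case: (step a) => ? /=; lia.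
    by case: st => [|c st] /=; lia.
  move=> [[a|b] st]; rewrite /sstep /F /TF /TS /=.
    have := h a; case: (step a) => [[a' c]|b] [-> ?] /=; split=> //; lia.
  by case: st => [|c st] //=.
have cI : computes (fun a => F (inl a, [::])) (fun a => TF (inl a, [::])).
  eapply (comp_le (k := 1)); first by eapply (c_app cF); csolve.
  by move=> a; lia.
by apply: (comp_le (k := 2) cI) => a; rewrite /TF /=; lia.
Qed.

End LinRec.

(** * Programs on lists *)

Section Lists.
Variable R : realType.
Local Notation Enc := (Enc R).
Context {G S X Y : Type} {EG : Enc G} {ES : Enc S} {EX : Enc X} {EY : Enc Y}.

Lemma comp_catrev : computes (R := R) (fun p : seq X * seq X => catrev p.1 p.2)
  (fun p => size p.1).
Proof.
apply: (@comp_loop _ _ _ _ _ (fun p : seq X * seq X =>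
  match p.1 with x :: l => inl (l, x :: p.2) | [::] => inr p.2 end) (fun=> 0%N)).
  by c0.
by move=> [[|x l] acc] /=.
Qed.

Lemma comp_rev : computes (R := R) (fun s : seq X => rev s) (fun s => size s).
Proof.
eapply (comp_le (k := 1)); first by eapply (c_app2 comp_catrev); csolve.
by move=> s /=; lia.
Qed.

Lemma comp_cat : computes (R := R) (fun p : seq X * seq X => p.1 ++ p.2)
  (fun p => size p.1).
Proof.
apply: (@comp_linrec _ _ _ _ _ _ _ (fun p : seq X * seq X =>
  match p.1 with x :: l => inl ((l, p.2), x) | [::] => inr p.2 end) (fun=> 0%N)
  (fun x r => x :: r) (fun=> 0%N)).
- by c0.
- by c0.
- by move=> [[|x l] acc] /=.
Qed.

Lemma comp_map (g : G -> X -> Y) Tg : computes (R := R) (fun p => g p.1 p.2) Tg ->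
  computes (R := R) (fun p : G * seq X => [seq g p.1 x | x <- p.2])
    (fun p => sumn [seq (Tg (p.1, x)).+1 | x <- p.2]).
Proof.
move=> cg.
apply: (@comp_linrec _ _ _ _ _ _ _ (fun p : G * seq X =>
  match p.2 with x :: l => inl ((p.1, l), g p.1 x) | [::] => inr [::] end)
  (fun p => if p.2 is x :: _ then Tg (p.1, x) else 0%N)
  (fun y r => y :: r) (fun=> 0%N)).
- eapply (comp_le (k := 1)).
    by csolve; eapply (c_app2 cg); csolve.
  by move=> [c [|x l]] /=; lia.
- by c0.
- by move=> [c [|x l]] /=; split=> //; lia.
Qed.

Lemma comp_filter (g : G -> X -> bool) :
  computes (R := R) (fun p => g p.1 p.2) (fun=> 0%N) ->
  computes (R := R) (fun p : G * seq X => [seq x <- p.2 | g p.1 x])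
    (fun p => size p.2).
Proof.
move=> cg.
apply: (@comp_linrec _ _ _ _ _ _ _ (fun p : G * seq X =>
  match p.2 with x :: l => inl ((p.1, l), (g p.1 x, x)) | [::] => inr [::] end)
  (fun=> 0%N)
  (fun y r => if y.1 then y.2 :: r else r) (fun=> 0%N)).
- eapply (comp_le (k := 1)); first by csolve; eapply (c_app2 cg); csolve.
  by move=> [c [|x l]] /=; lia.
- by c0.
- by move=> [c [|x l]] /=.
Qed.

Fixpoint foldl_cost (T : S -> X -> nat) (h : S -> X -> S) s l : nat :=
  if l is x :: l' then (T s x).+1 + foldl_cost T h (h s x) l' else 0.

Lemma comp_foldl (h : G -> S -> X -> S) Th :
  computes (R := R) (fun p => h p.1 p.2.1 p.2.2) Th ->
  computes (R := R) (fun p : G * (S * seq X) => foldl (h p.1) p.2.1 p.2.2)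
    (fun p => foldl_cost (fun s x => Th (p.1, (s, x))) (h p.1) p.2.1 p.2.2).
Proof.
move=> ch.
apply: (@comp_loop _ _ _ _ _ (fun p : G * (S * seq X) =>
  match p.2.2 with
  | x :: l => inl (p.1, (h p.1 p.2.1 x, l))
  | [::] => inr p.2.1
  end) (fun p => if p.2.2 is x :: _ then Th (p.1, (p.2.1, x)) else 0%N)).
- eapply (comp_le (k := 1)).
    csolve.
    refine (c_app (f := fun p : (G * (S * seq X)) * (X * seq X) =>
      (p.1.1, (p.1.2.1, p.2.1))) ch _); by csolve.
  by move=> [c [s [|x l]]] /=; lia.
- by move=> [c [s [|x l]]] /=.
Qed.

Lemma foldl_cost_le (T : S -> X -> nat) (h : S -> X -> S) (P : S -> Prop)
    (Q : X -> Prop) N s l :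
  (forall s x, P s -> Q x -> P (h s x) /\ (T s x <= N)%N) ->
  P s -> (forall x, List.In x l -> Q x) ->
  (foldl_cost T h s l <= N.+1 * size l)%N.
Proof.
move=> H; elim: l s => [|x l IH] s hs hl //=.
have [h1 h2] := H s x hs (hl x (or_introl erefl)).
have := IH (h s x) h1 (fun y hy => hl y (or_intror hy)).
by lia.
Qed.

Lemma comp_nseq : computes (R := R) (fun p : nat * X => nseq p.1 p.2)
  (fun p => p.1).
Proof.
apply: (@comp_linrec _ _ _ _ _ _ _ (fun p : nat * X =>
  if p.1 == 0 then inr [::] else inl ((p.1 - 1, p.2), p.2))%N (fun=> 0%N)
  (fun x r => x :: r) (fun=> 0%N)).
- by c0.
- by c0.
- by move=> [[|n] x] //=; rewrite subn1 /=; split=> //; lia.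
Qed.

End Lists.

(** * Products, integer parts and rounding to powers *)

Section Arith.
Variable R : realType.

(** Repeated addition is linear in the first factor; callers therefore put a constant, [M] or [Q]
    first. *)
Lemma comp_muln : computes (R := R) (fun p : nat * nat => p.1 * p.2)%N
  (fun p => p.1).
Proof.
apply: (@comp_linrec _ _ _ _ _ _ _ (fun p : nat * nat =>
  if p.1 == 0 then inr 0 else inl ((p.1 - 1, p.2), p.2))%N (fun=> 0%N)
  (fun x r => x + r)%N (fun=> 0%N)).
- by c0.
- by c0.
- by move=> [[|n] x] //=; rewrite subn1 /= mulSn; split=> //; lia.
Qed.

Lemma c_constr A `{Enc R A} (n : nat) : computes (R := R) (fun _ : A => n%:R : R)%R (fun=> 0%N).
Proof. by apply: c_natr; apply: comp_constn. Qed.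

Lemma c_zeror A `{Enc R A} : computes (R := R) (fun _ : A => 0%R : R) (fun=> 0%N).
Proof. exact: (c_constr 0). Qed.

Lemma c_oner A `{Enc R A} : computes (R := R) (fun _ : A => 1%R : R) (fun=> 0%N).
Proof. exact: (c_constr 1). Qed.

Lemma truncnB1 (y : R) : (1 <= y)%R -> Num.truncn y = (Num.truncn (y - 1)%R).+1.
Proof.
move=> h; have h0 : (0 <= y - 1)%R by rewrite subr_ge0.
apply: truncn_def; have /andP[a b] := truncn_itv h0.
by move: a b; rewrite -!natr1 => a b; apply/andP; split; lra.
Qed.

(** The integer part is counted by subtracting 1 as long as possible. The cost is the result itself,
    which the parameters and weights computed this way keep within [O(th)]. *)
Lemma comp_truncn : computes (R := R) (fun y : R => Num.truncn y) (fun y => Num.truncn y).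
Proof.
have c : computes (R := R) (fun p : R * nat => p.2 + Num.truncn p.1)%N
    (fun p => Num.truncn p.1).
  apply: (@comp_loop _ _ _ _ _ (fun p : R * nat =>
    if (1 <= p.1)%R then inl (p.1 - 1, p.2.+1)%R else inr p.2) (fun=> 0%N)).
    eapply (comp_le (k := 1)); first by csolve; apply: c_oner.
    by move=> p /=; case: ifP.
  move=> [y n] /=; case: ifP => h; first by rewrite (truncnB1 h) /=; split; lia.
  suff -> : Num.truncn y = 0%N by rewrite addn0.
  by apply/truncn0Pn; rewrite h.
eapply (comp_le (k := 1)).
  refine (c_app (f := fun y : R => (y, 0%N)) c _); by csolve.
by move=> y /=; lia.
Qed.

(** The number of times [y] can be divided by [g] before it drops below [g], in closed form;
    [glog_step] and [glog_stop] are the recursion equations that the program follows. *)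
Definition glog (g y : R) : nat := Num.truncn (ln y / ln g)%R.

Lemma glog_step (g y : R) : (1 < g)%R -> (g <= y)%R ->
  glog g y = (glog g (y / g)%R).+1.
Proof.
move=> g1 gy; have g0 : (0 < g)%R by lra.
have lg : (0 < ln g)%R by apply: ln_gt0.
rewrite /glog truncnB1.
  by rewrite ln_div ?posrE //; [rewrite mulrBl divff //; lra | lra].
by rewrite ler_pdivlMr // mul1r ler_ln ?posrE //; lra.
Qed.

Lemma glog_stop (g y : R) : (1 < g)%R -> (y < g)%R -> glog g y = 0%N.
Proof.
move=> g1 gy; have lg : (0 < ln g)%R by apply: ln_gt0.
apply/truncn0Pn; rewrite -ltNge.
have [y0|y0] := leP y 0%R.
  by rewrite ltr_pdivrMr // mul1r; apply: le_lt_trans lg; apply: ln_le0; lra.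
by rewrite ltr_pdivrMr // mul1r ltr_ln ?posrE //; lra.
Qed.

(** The argument is [q] with [Q = q.+1], so that [Q] is positive whatever the truncation yields. *)
Definition gbase (q : nat) : R := (1 + q.+1%:R^-1)%R.

Lemma gbase_gt1 q : (1 < gbase q)%R.
Proof. by rewrite /gbase ltrDl invr_gt0 ltr0n. Qed.

Lemma comp_gbase : computes (R := R) gbase (fun=> 0%N).
Proof.
have h : computes (R := R) (fun q : nat => 1 + 1 / q.+1%:R : R)%R (fun=> 0%N).
  by eapply (comp_le (k := 1)); [csolve; apply: c_oner | ].
by apply: (comp_ext _ h) => q; rewrite /gbase div1r.
Qed.

(* The largest power of [gbase q] that is at most [y]. *)
Definition gfloor (q : nat) (y : R) : R := (gbase q ^+ glog (gbase q) y)%R.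

Lemma comp_gfloor : computes (R := R) (fun p : nat * R => gfloor p.1 p.2)
  (fun p => glog (gbase p.1) p.2).
Proof.
have c : computes (R := R) (fun p : nat * (R * R) => p.2.2 * gfloor p.1 p.2.1)%R
    (fun p => glog (gbase p.1) p.2.1).
  apply: (@comp_loop _ _ _ _ _ (fun p : nat * (R * R) =>
    if (gbase p.1 <= p.2.1)%R then
      inl (p.1, (p.2.1 / gbase p.1, p.2.2 * gbase p.1))%R
    else inr p.2.2) (fun=> 0%N)).
    eapply (comp_le (k := 1)).
      by csolve; eapply (c_app comp_gbase); csolve.
    by move=> p /=; case: ifP.
  move=> [q [y t]] /=; case: ifP => h.
    rewrite /gfloor (glog_step (gbase_gt1 q) h) /=; split; last by lia.
    by rewrite exprS mulrA.
  rewrite /gfloor (glog_stop (gbase_gt1 q)) ?expr0 ?mulr1 //.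
  by rewrite ltNge h.
have h : computes (R := R) (fun p : nat * R => 1 * gfloor p.1 p.2)%R
    (fun p => glog (gbase p.1) p.2).
  eapply (comp_le (k := 1)).
    refine (c_app (f := fun p : nat * R => (p.1, (p.2, 1%R))) c _).
    by csolve; apply: c_oner.
  by move=> p /=; lia.
by apply: (comp_ext _ h) => p; rewrite mul1r.
Qed.

Lemma gfloor_itv q (y : R) : (1 <= y)%R ->
  (1 <= gfloor q y /\ gfloor q y <= y /\ y < gfloor q y * gbase q)%R.
Proof.
move=> y1; have g1 := gbase_gt1 q; set g := gbase q in g1 *.
have lg : (0 < ln g)%R by apply: ln_gt0.
have h0 : (0 <= ln y / ln g)%R by rewrite divr_ge0 ?ln_ge0 //; lra.
have g0 : (0 < g)%R by lra.
have pk k : (0 < g ^+ k)%R by apply: exprn_gt0.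
have /andP[a b] := truncn_itv h0; rewrite /gfloor -/g /glog.
move: (Num.truncn _) a b => k a b.
split; first by apply: exprn_ege1; lra.
have yp : (0 < y)%R by lra.
split.
  rewrite -(ler_ln (x := (g ^+ k)%R)) ?posrE // lnXn // -[leLHS]mulr_natl.
  by rewrite -ler_pdivlMr.
rewrite -exprSr -(ltr_ln (x := y)) ?posrE // lnXn // -[ltRHS]mulr_natl.
by rewrite -ltr_pdivrMr.
Qed.

End Arith.

(** * Balanced search trees *)

Section Trees.
Variable R : realType.
Local Notation Enc := (Enc R).

(** Lexicographic, the identifier separating jobs that start together. The second disjunct has [<=]
    in place of an equality since the machine tests reals by [<=] only. *)
Definition klt (a b : R * nat) : bool :=
  (a.1 < b.1)%R || ((a.1 <= b.1)%R && (a.2 < b.2)%N).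

Lemma klt_irr a : klt a a = false.
Proof. by rewrite /klt ltxx ltnn andbF. Qed.

Lemma klt_trans : transitive klt.
Proof.
move=> [b n] [a m] [c k]; rewrite /klt /=.
case/orP=> [h1|/andP[h1 h2]] /orP[h3|/andP[h3 h4]].
- by rewrite (lt_trans h1 h3).
- by rewrite (lt_le_trans h1 h3).
- by rewrite (le_lt_trans h1 h3).
- by rewrite (le_trans h1 h3) (ltn_trans h2 h4) orbT.
Qed.

Lemma klt_total a b : ~~ klt a b -> ~~ klt b a -> a = b.
Proof.
case: a b => [a m] [b n]; rewrite /klt /=.
by case: (ltgtP a b) => //= ->; rewrite -!leqNgt => h1 h2; congr pair; lia.
Qed.

Lemma klt_le a b : klt a b -> (a.1 <= b.1)%R.
Proof. by case/orP=> [/ltW|/andP[]]. Qed.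

Lemma klt_ne a b : klt a b -> (a == b) = false.
Proof. by move=> h; apply/eqP => e; move: h; rewrite e klt_irr. Qed.

Lemma klt_gt_ne a b : klt a b -> (b == a) = false.
Proof. by rewrite eq_sym; apply: klt_ne. Qed.

Notation elt A := ((R * nat) * (R * A))%type.

(* [Node l e r h b]: h is the height and b the entry of least priority. *)
Inductive tree (A : Type) :=
  Leaf | Node of tree A & elt A & tree A & nat & elt A.
Arguments Leaf {A}.

(** Classical equality: it lets entries that contain trees occur in membership statements and is
    never part of a program. *)
HB.instance Definition _ (A : Type) := gen_eqMixin (tree A).

Section TreeFun.
Variable A : Type.
Implicit Types (t l r : tree A) (e : elt A).

Definition ht t := if t is Node _ _ _ h _ then h else 0%N.

Definition best e t := if t is Node _ _ _ _ b then
  (if (e.2.1 <= b.2.1)%R then e else b) else e.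

Definition node l e r := Node l e r (maxn (ht l) (ht r)).+1 (best (best e l) r).

(** The AVL rotations for a left subtree that is too high: single if its outer child is at least as
    high as its inner one, double otherwise. *)
Definition balr l e r :=
  match l with
  | Node ll le lr _ _ =>
      if (ht lr <= ht ll)%N then node ll le (node lr e r) else
      match lr with
      | Node lrl lre lrr _ _ => node (node ll le lrl) lre (node lrr e r)
      | Leaf => node l e r
      end
  | Leaf => node l e r
  end.

Definition ball l e r :=
  match r with
  | Node rl re rr _ _ =>
      if (ht rl <= ht rr)%N then node (node l e rl) re rr else
      match rl with
      | Node rll rle rlr _ _ => node (node l e rll) rle (node rlr re rr)
      | Leaf => node l e r
      end
  | Leaf => node l e r
  end.

Definition bal l e r :=
  if ((ht r).+1 < ht l)%N then balr l e r else
  if ((ht l).+1 < ht r)%N then ball l e r else node l e r.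

Fixpoint ins e t :=
  match t with
  | Leaf => node Leaf e Leaf
  | Node l x r _ _ =>
      if klt e.1 x.1 then bal (ins e l) x r else bal l x (ins e r)
  end.

Fixpoint delmin t : option (elt A * tree A) :=
  match t with
  | Leaf => None
  | Node l x r _ _ =>
      match delmin l with
      | None => Some (x, r)
      | Some y => Some (y.1, bal y.2 x r)
      end
  end.

Definition join l r :=
  match delmin r with None => l | Some y => bal l y.1 y.2 end.

Fixpoint del k t :=
  match t with
  | Leaf => Leaf
  | Node l x r _ _ =>
      if klt k x.1 then bal (del k l) x r
      else if klt x.1 k then bal l x (del k r) else join l r
  end.

(** If the key at the root is at least [x], so are all keys on the right, and the minimum cached
    there replaces a visit. Hence only one child is ever entered, and the time is proportional to
    the depth. *)
Fixpoint qmin (x : R) t : option (elt A) :=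
  match t with
  | Leaf => None
  | Node l e r _ _ =>
      if (x <= e.1.1)%R then
        match qmin x l with
        | Some y => Some (best (best y (node Leaf e Leaf)) r)
        | None => Some (best e r)
        end
      else qmin x r
  end.

Fixpoint qpred (x : R) t : option (elt A) :=
  match t with
  | Leaf => None
  | Node l e r _ _ =>
      if (e.1.1 <= x)%R then
        match qpred x r with Some y => Some y | None => Some e end
      else qpred x l
  end.

Fixpoint look (k : R * nat) t : option A :=
  match t with
  | Leaf => None
  | Node l e r _ _ =>
      if klt k e.1 then look k l else if klt e.1 k then look k r
      else Some e.2.2
  end.

Fixpoint inorder t : seq (elt A) :=
  if t is Node l e r _ _ then inorder l ++ e :: inorder r else [::].

Fixpoint dep t : nat :=
  if t is Node l _ r _ _ then (maxn (dep l) (dep r)).+1 else 0.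

Fixpoint wft t : Prop :=
  if t is Node l e r h b then
    [/\ wft l, wft r, h = (maxn (ht l) (ht r)).+1, b = best (best e l) r &
        (ht l <= (ht r).+1)%N && (ht r <= (ht l).+1)%N]
  else True.

Lemma inorder_bal l e r : inorder (bal l e r) = inorder l ++ e :: inorder r.
Proof.
rewrite /bal /balr /ball; case: ifP => _.
  case: l => [|ll le lr h b] //; case: ifP => _ /=; first by rewrite -catA.
  by case: lr => [|lrl lre lrr h' b'] //=; rewrite -!catA /= -catA.
case: ifP => _ //; case: r => [|rl re rr h b] //; case: ifP => _ /=.
  by rewrite -!catA.
by case: rl => [|rll rle rlr h' b'] //=; rewrite -!catA.
Qed.

(** One insertion or deletion below puts the heights at most two apart. After a rotation the height
    is known only up to one; the last conjunct is the case without rotation, where it is exact. *)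
Lemma bal_wft l e r : wft l -> wft r ->
  (ht l <= (ht r).+2)%N -> (ht r <= (ht l).+2)%N ->
  [/\ wft (bal l e r), (maxn (ht l) (ht r) <= ht (bal l e r))%N,
      (ht (bal l e r) <= (maxn (ht l) (ht r)).+1)%N &
      (ht l <= (ht r).+1)%N -> (ht r <= (ht l).+1)%N ->
      ht (bal l e r) = (maxn (ht l) (ht r)).+1].
Proof.
move=> wl wr h1 h2; rewrite /bal /balr /ball; case: ifP => h3.
  case: l wl h1 h2 h3 => [|ll le lr h b] /=; first by move=> *; lia.
  move=> [w1 w2 eh eb /andP[b1 b2]] h1 h2 h3; case: ifP => h4.
    by split=> /=; try lia; repeat split=> //=; lia.
  case: lr w2 eh eb b1 b2 h4 => [|x y z h' b'] /=; first by move=> *; lia.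
  move=> [w3 w4 eh' eb' /andP[b3 b4]] eh eb b1 b2 h4.
  by split=> /=; try lia; repeat split=> //=; lia.
case: ifP => h4.
  case: r wr h1 h2 h3 h4 => [|rl re rr h b] /=; first by move=> *; lia.
  move=> [w1 w2 eh eb /andP[b1 b2]] h1 h2 h3 h4; case: ifP => h5.
    by split=> /=; try lia; repeat split=> //=; lia.
  case: rl w1 eh eb b1 b2 h5 => [|x y z h' b'] /=; first by move=> *; lia.
  move=> [w3 w4 eh' eb' /andP[b3 b4]] eh eb b1 b2 h5.
  by split=> /=; try lia; repeat split=> //=; lia.
by split=> /=; try lia; repeat split=> //=; lia.
Qed.

Lemma ins_wft e t : wft t ->
  [/\ wft (ins e t), (ht t <= ht (ins e t))%N & (ht (ins e t) <= (ht t).+1)%N].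
Proof.
elim: t => [|l IHl x r IHr h b] /=; first by [].
move=> [wl wr eh eb bb]; case: ifP => _.
  have [w1 h1 h2] := IHl wl.
  by have [||? ? ? ?] := @bal_wft (ins e l) x r w1 wr; try split=> //; lia.
have [w1 h1 h2] := IHr wr.
by have [||? ? ? ?] := @bal_wft l x (ins e r) wl w1; try split=> //; lia.
Qed.

Lemma delmin_wft t : wft t -> forall x t', delmin t = Some (x, t') ->
  [/\ wft t', (ht t <= (ht t').+1)%N, (ht t' <= ht t)%N &
      inorder t = x :: inorder t'].
Proof.
elim: t => [|l IHl x r IHr h b] //= [wl wr eh eb bb] y t'.
case e : (delmin l) => [[z l']|] /=; last first.
  case=> <- <-; case: l wl IHl e eh eb bb => [|l1 l2 l3 l4 l5] /=.
    by move=> *; split=> //; lia.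
  by case: (delmin l1).
have [w1 h1 h2 h3] := IHl wl _ _ e.
have [||w2 h4 h5 h6] := @bal_wft l' x r w1 wr; [lia|lia|].
by case=> <- <-; split=> //; [lia|lia|rewrite inorder_bal h3].
Qed.

Lemma delmin_none t : delmin t = None -> t = Leaf.
Proof. by case: t => [|l x r h b] //=; case: (delmin l). Qed.

Lemma del_wft k t : wft t ->
  [/\ wft (del k t), (ht t <= (ht (del k t)).+1)%N & (ht (del k t) <= ht t)%N].
Proof.
elim: t => [|l IHl x r IHr h b] /=; first by [].
move=> [wl wr eh eb bb]; have [w1 h1 h2] := IHl wl; have [w2 h3 h4] := IHr wr.
case: ifP => _.
  by have [||? ? ? ?] := @bal_wft (del k l) x r w1 wr; try split=> //; lia.
case: ifP => _.
  by have [||? ? ? ?] := @bal_wft l x (del k r) wl w2; try split=> //; lia.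
rewrite /join; case e : (delmin r) => [[y r']|] /=.
  have [w3 h5 h6 _] := delmin_wft wr e.
  by have [||? ? ? ?] := @bal_wft l y r' wl w3; try split=> //; lia.
by move: eh bb; rewrite (delmin_none e) /= => *; split=> //; lia.
Qed.

Lemma ht_dep t : wft t -> ht t = dep t.
Proof. by elim: t => //= l IHl x r IHr h b [/IHl <- /IHr <-]. Qed.

(** Both children have height at least [h - 2], so the size plus one doubles with every two levels.
    This is weaker than the Fibonacci bound by a constant factor only. *)
Lemma size_wft t : wft t -> (2 ^ (ht t)./2 <= (size (inorder t)).+1)%N.
Proof.
move: {2}(ht t) (leqnn (ht t)) => n; elim: n t => [|n IH] t.
  by case: t => //= l x r h b; rewrite leqn0 => /eqP ->.
case: t => [|l x r h b] //= hh [wl wr eh _ bb].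
rewrite size_cat /= -addnS.
have [h1|h1] := leqP h 1; first by case: h h1 eh {hh} => [|[|]] //= *; lia.
have m t k : wft t -> (k <= ht t)%N -> (ht t <= n)%N ->
    (2 ^ k./2 <= (size (inorder t)).+1)%N.
  move=> w hk hn; apply: leq_trans (IH t hn w).
  by apply: leq_pexp2l => //; apply: half_leq.
have := m l (h - 2)%N wl ltac:(lia) ltac:(lia).
have := m r (h - 2)%N wr ltac:(lia) ltac:(lia).
rewrite (_ : h = (h - 2).+2) /=; last by lia.
by rewrite expnS subn2 /=; lia.
Qed.

(** A bound on the depth of a balanced tree with [n] entries. It is positive also for [n = 0], so
    that products containing it dominate their other factors. *)
Definition dlog (n : nat) : nat := (trunc_log 2 n.+1).*2.+1.

Lemma dep_dlog t : wft t -> (dep t <= dlog (size (inorder t)))%N.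
Proof.
move=> w; rewrite -ht_dep // /dlog; have := size_wft w.
move=> /(trunc_log_max (p := 2) isT); move: (trunc_log _ _) => k h.
by have := odd_double_half (ht t); case: (odd _); lia.
Qed.

Lemma leq_dlog m n : (m <= n)%N -> (dlog m <= dlog n)%N.
Proof. by move=> h; rewrite /dlog ltnS leq_double; apply: leq_trunc_log; lia. Qed.

End TreeFun.

Section TreeSpec.
Variable A : eqType.
Implicit Types (t l r : tree A) (e x y : elt A).

Definition elt_lt x y := klt x.1 y.1.

Definition srt t := pairwise elt_lt (inorder t).

Lemma srt_node l e r h b : srt (Node l e r h b) ->
  [/\ srt l, srt r, (forall x, x \in inorder l -> klt x.1 e.1) &
      forall x, x \in inorder r -> klt e.1 x.1].
Proof.
rewrite /srt /= pairwise_cat pairwise_cons => /and3P[/allrelP h1 h2].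
case/andP=> /allP h3 h4; split=> //.
by move=> x hx; apply: (h1 x e hx); rewrite mem_head.
Qed.

Lemma perm_ins e t : perm_eq (inorder (ins e t)) (e :: inorder t).
Proof.
elim: t => [|l IHl x r IHr h b] //=; case: ifP => _; rewrite inorder_bal.
  by rewrite -cat_cons perm_cat2r.
apply/permP => a; rewrite /= !count_cat /=; have /permP/(_ a) := IHr.
by rewrite /=; lia.
Qed.

Lemma mem_ins e t x : (x \in inorder (ins e t)) = (x == e) || (x \in inorder t).
Proof. by rewrite (perm_mem (perm_ins e t)) inE. Qed.

Lemma srt_ins e t : srt t -> (forall x, x \in inorder t -> x.1 != e.1) ->
  srt (ins e t).
Proof.
elim: t => [|l IHl x r IHr h b] //= st hk.
have [sl sr hl hr] := srt_node st.
have kx : x.1 != e.1 by apply: hk; rewrite mem_cat mem_head orbT.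
move: st; rewrite /srt /= pairwise_cat pairwise_cons => /and3P[].
move=> /allrelP alr _ /andP[_ _].
case: ifP => he; rewrite inorder_bal pairwise_cat pairwise_cons.
  apply/and3P; split.
  - apply/allrelP => u v; rewrite mem_ins => /orP[/eqP ->|hu] hv.
      move: hv; rewrite inE => /orP[/eqP -> //|/hr]; exact: klt_trans.
    exact: alr.
  - by apply: IHl => // u hu; apply: hk; rewrite mem_cat hu.
  - by apply/andP; split=> //; apply/allP => u; apply: hr.
have ex : klt x.1 e.1.
  by apply/negPn/negP => h'; move/eqP: kx; apply; apply: klt_total; rewrite ?he.
apply/and3P; split=> //.
- apply/allrelP => u v hu; rewrite inE mem_ins => /orP[/eqP ->|/orP[/eqP ->|hv]].
  + exact: hl.
  + exact: klt_trans (hl _ hu) ex.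
  + by apply: alr => //; rewrite inE hv orbT.
- apply/andP; split.
    by apply/allP => u; rewrite mem_ins => /orP[/eqP -> //|]; apply: hr.
  by apply: IHr => // u hu; apply: hk; rewrite mem_cat inE hu !orbT.
Qed.

Lemma filter_key k (s : seq (elt A)) :
  (forall x, x \in s -> klt k x.1 \/ klt x.1 k) -> [seq x <- s | x.1 != k] = s.
Proof.
move=> h; apply/all_filterP/allP => x /h [] hx; apply/negP => /eqP e;
  by move: hx; rewrite e klt_irr.
Qed.

Lemma inorder_del k t : wft t -> srt t ->
  inorder (del k t) = [seq x <- inorder t | x.1 != k].
Proof.
elim: t => [|l IHl x r IHr h b] //= [wl wr _ _ _] st.
have [sl sr hl hr] := srt_node st.
rewrite filter_cat /=; case: ifP => hk.
  rewrite inorder_bal IHl // (klt_gt_ne hk) /=; congr (_ ++ _ :: _).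
  by rewrite filter_key // => y /hr hy; left; apply: klt_trans hk hy.
case: ifP => hk'.
  rewrite inorder_bal IHr // (klt_ne hk') /=; congr (_ ++ _).
  by rewrite filter_key // => y /hl hy; right; apply: klt_trans hy hk'.
have e : x.1 = k by apply: klt_total; rewrite ?hk ?hk'.
rewrite e eqxx /= filter_key; last by move=> y /hl; rewrite e; right.
rewrite filter_key; last by move=> y /hr; rewrite e; left.
rewrite /join; case ed : (delmin r) => [[y r']|] /=.
  by have [_ _ _ ->] := delmin_wft wr ed; rewrite inorder_bal.
by rewrite (delmin_none ed) cats0.
Qed.

Lemma srt_del k t : wft t -> srt t -> srt (del k t).
Proof.
move=> w s; rewrite /srt inorder_del //.
by apply: subseq_pairwise s; apply: filter_subseq.
Qed.

Lemma size_del k t : wft t -> srt t ->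
  (size (inorder (del k t)) <= size (inorder t))%N.
Proof. by move=> w s; rewrite inorder_del // size_filter count_size. Qed.

Lemma srt_uniq t : srt t -> uniq (inorder t).
Proof.
rewrite /srt; elim: (inorder t) => //= x s IH /andP[/allP h /IH ->].
by rewrite andbT; apply/negP => /h; rewrite /elt_lt klt_irr.
Qed.

Lemma srt_key_inj t x y : srt t -> x \in inorder t -> y \in inorder t ->
  x.1 = y.1 -> x = y.
Proof.
rewrite /srt; elim: (inorder t) => //= z s IH /andP[/allP h ps].
rewrite !inE => /orP[/eqP ->|hx] /orP[/eqP ->|hy] // e.
- by have := h _ hy; rewrite /elt_lt e klt_irr.
- by have := h _ hx; rewrite /elt_lt e klt_irr.
- exact: IH.
Qed.

Lemma best_spec e t : wft t ->
  [/\ best e t = e \/ best e t \in inorder t,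
      ((best e t).2.1 <= e.2.1)%R &
      forall y, y \in inorder t -> ((best e t).2.1 <= y.2.1)%R].
Proof.
elim: t e => [|l IHl x r IHr h b] e /=; first by move=> _; split=> //; left.
move=> [wl wr _ eb _].
have [m1 p1 q1] := IHl x wl; have [m2 p2 q2] := IHr (best x l) wr.
have hb y : y \in inorder l ++ x :: inorder r -> (b.2.1 <= y.2.1)%R.
  rewrite eb mem_cat inE => /orP[hy|/orP[/eqP ->|hy]].
  - exact: le_trans p2 (q1 _ hy).
  - exact: le_trans p2 p1.
  - exact: q2.
have mb : b \in inorder l ++ x :: inorder r.
  rewrite eb mem_cat inE; case: m2 => [->|->]; last by rewrite !orbT.
  by case: m1 => ->; rewrite ?eqxx ?orbT.
case: leP => h'; split=> //.
- by left.
- by move=> y /hb; apply: le_trans.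
- by right.
- exact: ltW.
Qed.

Lemma qmin_spec (x : R) t : wft t -> srt t ->
  match qmin x t with
  | Some e => [/\ e \in inorder t, (x <= e.1.1)%R &
      forall y, y \in inorder t -> (x <= y.1.1)%R -> (e.2.1 <= y.2.1)%R]
  | None => forall y, y \in inorder t -> (x <= y.1.1)%R -> False
  end.
Proof.
elim: t => [|l IHl e r IHr h b] //= [wl wr _ _ _] st.
have [sl sr hl hr] := srt_node st.
have {IHl} := IHl wl sl; have {IHr} := IHr wr sr; case: ifP => he; last first.
  move=> + _; case: (qmin x r) => [y|].
    move=> [h1 h2 h3]; split=> //; first by rewrite mem_cat inE h1 !orbT.
    move=> z; rewrite mem_cat inE => /orP[hz|/orP[/eqP ->|hz]] xz.
    - by have := le_trans xz (klt_le (hl _ hz)); rewrite he.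
    - by rewrite he in xz.
    - exact: h3.
  move=> h3 z; rewrite mem_cat inE => /orP[hz|/orP[/eqP ->|hz]] xz.
  - by have := le_trans xz (klt_le (hl _ hz)); rewrite he.
  - by rewrite he in xz.
  - exact: h3 hz xz.
move=> _; have xr z : z \in inorder r -> (x <= z.1.1)%R.
  by move=> /hr /klt_le; apply: le_trans.
case: (qmin x l) => [y|].
  move=> [h1 h2 h3].
  have [m1 p1 q1] := @best_spec y (node Leaf e Leaf) ltac:(by []).
  have [m2 p2 q2] := best_spec (best y (node Leaf e Leaf)) wr.
  split.
  - rewrite mem_cat inE; case: m2 => ->; last by rewrite !orbT.
    by case: m1 => [->|]; rewrite ?h1 // inE => ->; rewrite orbT.
  - case: m2 => [->|]; last exact: xr.
    by case: m1 => [-> //|]; rewrite inE => /eqP ->.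
  - move=> z; rewrite mem_cat inE => /orP[hz|/orP[/eqP ->|hz]] xz.
    + exact: le_trans p2 (le_trans p1 (h3 _ hz xz)).
    + by apply: le_trans p2 (q1 _ _); rewrite inE.
    + exact: q2.
move=> h3; have [m2 p2 q2] := best_spec e wr; split.
- by rewrite mem_cat inE; case: m2 => ->; rewrite ?eqxx !orbT.
- by case: m2 => [-> //|]; exact: xr.
- move=> z; rewrite mem_cat inE => /orP[hz|/orP[/eqP -> //|hz]] xz.
  + by case: (h3 z hz xz).
  + exact: q2.
Qed.

Lemma qpred_spec (x : R) t : srt t ->
  match qpred x t with
  | Some e => [/\ e \in inorder t, (e.1.1 <= x)%R &
      forall y, y \in inorder t -> (y.1.1 <= x)%R -> (y.1.1 <= e.1.1)%R]
  | None => forall y, y \in inorder t -> (y.1.1 <= x)%R -> False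
  end.
Proof.
elim: t => [|l IHl e r IHr h b] //= st.
have [sl sr hl hr] := srt_node st.
have {IHl} := IHl sl; have {IHr} := IHr sr; case: ifP => he.
  move=> + _; case: (qpred x r) => [y|].
    move=> [h1 h2 h3]; split=> //; first by rewrite mem_cat inE h1 !orbT.
    move=> z; rewrite mem_cat inE => /orP[hz|/orP[/eqP ->|hz]] zx.
    - exact: le_trans (klt_le (hl _ hz)) (klt_le (hr _ h1)).
    - exact: klt_le (hr _ h1).
    - exact: h3.
  move=> h3; split=> //; first by rewrite mem_cat mem_head orbT.
  move=> z; rewrite mem_cat inE => /orP[hz|/orP[/eqP -> //|hz]] zx.
  - exact: klt_le (hl _ hz).
  - by case: (h3 z hz zx).
move=> _; case: (qpred x l) => [y|].
  move=> [h1 h2 h3]; split=> //; first by rewrite mem_cat h1.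
  move=> z; rewrite mem_cat inE => /orP[hz|/orP[/eqP ->|hz]] zx.
  - exact: h3.
  - by rewrite he in zx.
  - by have := le_trans (klt_le (hr _ hz)) zx; rewrite he.
move=> h3 z; rewrite mem_cat inE => /orP[hz|/orP[/eqP ->|hz]] zx.
- exact: h3 hz zx.
- by rewrite he in zx.
- by have := le_trans (klt_le (hr _ hz)) zx; rewrite he.
Qed.

Lemma look_mem x t : srt t -> x \in inorder t -> look x.1 t = Some x.2.2.
Proof.
elim: t => [|l IHl e r IHr h b] //= st.
have [sl sr hl hr] := srt_node st.
rewrite mem_cat inE => /orP[hx|/orP[/eqP ->|hx]].
- by rewrite (hl _ hx) IHl.
- by rewrite klt_irr.
- have ex := hr _ hx; rewrite ex; case: ifP => [xe|_]; last exact: IHr.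
  by have := klt_trans ex xe; rewrite klt_irr.
Qed.

Lemma look_none k t : srt t -> (forall x, x \in inorder t -> x.1 != k) ->
  look k t = None.
Proof.
elim: t => [|l IHl e r IHr h b] //= st hk.
have [sl sr hl hr] := srt_node st; case: ifP => h1.
  by apply: IHl => // x hx; apply: hk; rewrite mem_cat hx.
case: ifP => h2.
  by apply: IHr => // x hx; apply: hk; rewrite mem_cat inE hx !orbT.
have := hk e; rewrite mem_cat mem_head orbT => /(_ isT) /eqP; case.
by apply: klt_total; rewrite ?h1 ?h2.
Qed.

End TreeSpec.

End Trees.

Lemma c_app3 (R : realType) A B C D E `{Enc R A} `{Enc R B} `{Enc R C}
    `{Enc R D} `{Enc R E} (h : B -> C -> D -> E) Th (f : A -> B) Tf
    (g : A -> C) Tg (k : A -> D) Tk :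
  computes (R := R) (fun p => h p.1 p.2.1 p.2.2) Th ->
  computes f Tf -> computes g Tg -> computes k Tk ->
  computes (R := R) (fun a => h (f a) (g a) (k a))
    (fun a => Tf a + Tg a + Tk a + Th (f a, (g a, k a)))%N.
Proof.
move=> ch cf cg ck; have := comp_comp ch (comp_pair cf (comp_pair cg ck)).
by move=> h'; apply: (comp_le (k := 1) h') => a /=; lia.
Qed.

Section EncTree.
Variable R : realType.
Local Notation elt A := ((R * nat) * (R * A))%type.

Fixpoint enc_tree_rec A `{Enc R A} (t : tree R A) : datum R :=
  match t with
  | Leaf => VP (VN R 0) (VN R 0)
  | Node l e r h b => VP (VN R 1) (VP (enc_tree_rec l) (VP (enc e)
      (VP (enc_tree_rec r) (VP (enc h) (enc b)))))
  end.
#[global] Instance enc_tree A `{Enc R A} : Enc R (tree R A) :=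
  @enc_tree_rec A _.

Context {A X D : Type} {EA : Enc R A} {EX : Enc R X} {ED : Enc R D}.

Lemma c_leaf : computes (R := R) (fun _ : A => @Leaf R X) (fun=> 0%N).
Proof.
have h := comp_pair (@comp_constn R A EA 0) (@comp_constn R A EA 0).
exact: (comp_ext (fun=> erefl) h).
Qed.

Lemma c_Node (l : A -> tree R X) Tl (e : A -> elt X) Te (r : A -> tree R X) Tr
    (h : A -> nat) Th (b : A -> elt X) Tb :
  computes l Tl -> computes e Te -> computes r Tr -> computes h Th ->
  computes b Tb -> computes (fun a => Node (l a) (e a) (r a) (h a) (b a))
    (fun a => Tl a + (Te a + (Tr a + (Th a + Tb a))))%N.
Proof.
move=> cl ce cr ch cb.
have h' := comp_pair (@comp_constn R A EA 1)
  (comp_pair cl (comp_pair ce (comp_pair cr (comp_pair ch cb)))).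
exact: (comp_ext (fun=> erefl) h').
Qed.

Lemma c_tree (h : A -> tree R X) Th
    (f : A -> tree R X -> elt X -> tree R X -> nat -> elt X -> D) Tf
    (g : A -> D) Tg :
  computes h Th ->
  computes (fun p => f p.1 p.2.1 p.2.2.1 p.2.2.2.1 p.2.2.2.2.1 p.2.2.2.2.2) Tf ->
  computes g Tg ->
  computes (fun a => match h a with
                     | Leaf => g a | Node l e r k b => f a l e r k b end)
    (fun a => Th a + match h a with
       | Leaf => Tg a | Node l e r k b => Tf (a, (l, (e, (r, (k, b))))) end)%N.
Proof.
move=> ch cf cg.
have ch' : computes (R := R) (fun a => match h a with
    | Leaf => None | Node l e r k b => Some (l, (e, (r, (k, b)))) end) Th.
  by apply: (comp_ext _ ch) => a; case: (h a).
have hs := c_option (f := fun a x =>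
  f a x.1 x.2.1 x.2.2.1 x.2.2.2.1 x.2.2.2.2) ch' cf cg.
apply: (comp_le (k := 1)).
  by apply: (comp_ext _ hs) => a; case: (h a).
by move=> a /=; case: (h a) => [|? ? ? ? ?]; lia.
Qed.

End EncTree.

Ltac cuser0 := lazymatch goal with
  | |- computes (fun x => match @?h x with _ => _ end) _ => eapply (c_tree (h:=h))
  | |- computes (fun _ => @Leaf _ _) _ => apply c_leaf
  | |- computes (fun _ => GRing.zero) _ => apply c_zeror
  | |- computes (fun _ => GRing.one _) _ => apply c_oner
  | |- computes (fun x => Node (@?l x) (@?e x) (@?r x) (@?h x) (@?b x)) _ =>
      eapply (c_Node (l:=l) (e:=e) (r:=r) (h:=h) (b:=b))
  end.
Ltac cuser ::= cuser0.

Section CompTree.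
Variable R : realType.
Context {X : Type} {EX : Enc R X}.
Local Notation elt := ((R * nat) * (R * X))%type.
Local Notation tree := (tree R X).

Lemma comp_klt : computes (R := R) (fun p => klt (R := R) p.1 p.2) (fun=> 0%N).
Proof. by rewrite /klt; c0. Qed.

Lemma comp_ht : computes (R := R) (@ht R X) (fun=> 0%N).
Proof. by rewrite /ht; c0. Qed.

Lemma comp_best : computes (R := R) (fun p : elt * tree => best p.1 p.2) (fun=> 0%N).
Proof. by rewrite /best; c0. Qed.

Lemma comp_maxn : computes (R := R) (fun p : nat * nat => maxn p.1 p.2) (fun=> 0%N).
Proof. by rewrite /maxn; c0. Qed.

End CompTree.

Ltac cuser1 := lazymatch goal with
  | |- computes (@ht _ _) _ => eapply comp_ht
  | |- computes (fun x => ht (@?f x)) _ => eapply (c_app (f:=f) (@comp_ht _ _ _))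
  | |- computes (fun x => klt (@?f x) (@?g x)) _ =>
      eapply (c_app2 (f:=f) (g:=g) (@comp_klt _))
  | |- computes (fun x => best (@?f x) (@?g x)) _ =>
      eapply (c_app2 (f:=f) (g:=g) (@comp_best _ _ _))
  | |- computes (fun x => maxn (@?f x) (@?g x)) _ =>
      eapply (c_app2 (f:=f) (g:=g) (@comp_maxn _))
  | _ => cuser0
  end.
Ltac cuser ::= cuser1.

Section CompBal.
Variable R : realType.
Context {X : Type} {EX : Enc R X}.
Local Notation elt := ((R * nat) * (R * X))%type.
Local Notation tree := (tree R X).

Lemma comp_node : computes (R := R)
  (fun p : tree * (elt * tree) => node p.1 p.2.1 p.2.2) (fun=> 0%N).
Proof. by rewrite /node; c0. Qed.

End CompBal.

Ltac cuser2 := lazymatch goal with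
  | |- computes (fun x => node (@?f x) (@?g x) (@?k x)) _ =>
      eapply (c_app3 (f:=f) (g:=g) (k:=k) (@comp_node _ _ _))
  | _ => cuser1
  end.
Ltac cuser ::= cuser2.

Section CompBal2.
Variable R : realType.
Context {X : Type} {EX : Enc R X}.
Local Notation elt := ((R * nat) * (R * X))%type.
Local Notation tree := (tree R X).

Lemma comp_balr : computes (R := R)
  (fun p : tree * (elt * tree) => balr p.1 p.2.1 p.2.2) (fun=> 0%N).
Proof. by rewrite /balr; c0. Qed.

Lemma comp_ball : computes (R := R)
  (fun p : tree * (elt * tree) => ball p.1 p.2.1 p.2.2) (fun=> 0%N).
Proof. by rewrite /ball; c0. Qed.

Lemma comp_bal : computes (R := R)
  (fun p : tree * (elt * tree) => bal p.1 p.2.1 p.2.2) (fun=> 0%N).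
Proof.
rewrite /bal; eapply (comp_le (k := 1)).
  csolve; [eapply (c_app3 comp_balr) | eapply (c_app3 comp_ball)]; by csolve.
by move=> p /=; csplit.
Qed.

End CompBal2.

Ltac cuser3 := lazymatch goal with
  | |- computes (fun x => bal (@?f x) (@?g x) (@?k x)) _ =>
      eapply (c_app3 (f:=f) (g:=g) (k:=k) (@comp_bal _ _ _))
  | _ => cuser2
  end.
Ltac cuser ::= cuser3.

Section CompOps.
Variable R : realType.
Context {X : Type} {EX : Enc R X}.
Local Notation elt := ((R * nat) * (R * X))%type.
Local Notation tree := (tree R X).

(** The pending datum of a level is a zipper frame: the direction taken, the root and the other
    subtree. *)
Lemma comp_ins : computes (R := R) (fun p : elt * tree => ins p.1 p.2)
  (fun p => dep p.2).
Proof.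
apply: (@comp_linrec _ _ _ _ _ _ _ (fun p : elt * tree =>
  match p.2 with
  | Leaf => inr (node (@Leaf R X) p.1 (@Leaf R X))
  | Node l x r _ _ =>
      if klt p.1.1 x.1 then inl ((p.1, l), (true, (x, r)))
      else inl ((p.1, r), (false, (x, l)))
  end) (fun=> 0%N)
  (fun (c : bool * (elt * tree)) b =>
     if c.1 then bal b c.2.1 c.2.2 else bal c.2.2 c.2.1 b) (fun=> 0%N)).
- by c0.
- by c0.
- by move=> [e [|l x r h b]] //=; case: ifP => _ /=; split=> //; lia.
Qed.

Lemma comp_delmin : computes (R := R) (@delmin R X) (fun t => dep t).
Proof.
apply: (@comp_linrec _ _ _ _ _ _ _ (fun t : tree =>
  match t with
  | Leaf => inr (None : option (elt * tree))
  | Node l x r _ _ => inl (l, (x, r))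
  end) (fun=> 0%N)
  (fun (c : elt * tree) b =>
      match b with
      | None => Some (c.1, c.2)
      | Some y => Some (y.1, bal y.2 c.1 c.2)
      end) (fun=> 0%N)).
- by c0.
- by c0.
- by move=> [|l x r h b] //=; split=> //; lia.
Qed.

Lemma comp_join : computes (R := R) (fun p : tree * tree => join p.1 p.2)
  (fun p => dep p.2).
Proof.
rewrite /join; eapply (comp_le (k := 1)).
  by csolve; eapply (c_app comp_delmin); csolve.
by move=> p /=; case: delmin => [?|] /=; lia.
Qed.

Lemma comp_del : computes (R := R) (fun p : (R * nat) * tree => del p.1 p.2)
  (fun p => dep p.2).
Proof.
apply: (@comp_linrec _ _ _ _ _ _ _ (fun p : (R * nat) * tree =>
  match p.2 with
  | Leaf => inr (@Leaf R X)
  | Node l x r _ _ =>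
      if klt p.1 x.1 then inl ((p.1, l), (true, (x, r)))
      else if klt x.1 p.1 then inl ((p.1, r), (false, (x, l)))
      else inr (join l r)
  end) (fun p => match p.2 with
                 | Leaf => 0%N
                 | Node l x r _ _ => if klt p.1 x.1 || klt x.1 p.1 then 0%N
                                     else dep r end)
  (fun (c : bool * (elt * tree)) b =>
     if c.1 then bal b c.2.1 c.2.2 else bal c.2.2 c.2.1 b) (fun=> 0%N)).
- eapply (comp_le (k := 1)).
    by csolve; eapply (c_app2 comp_join); csolve.
  by move=> [k [|l x r h b]] //=; case: ifP => _ //=; case: ifP => _ /=; lia.
- by c0.
- move=> [k [|l x r h b]] //=; case: ifP => _ /=; first by split=> //; lia.
  by case: ifP => _ /=; split=> //; lia.
Qed.

Lemma comp_qmin : computes (R := R) (fun p : R * tree => qmin p.1 p.2)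
  (fun p => dep p.2).
Proof.
apply: (@comp_linrec _ _ _ _ _ _ _ (fun p : R * tree =>
  match p.2 with
  | Leaf => inr (None : option elt)
  | Node l e r _ _ =>
      if (p.1 <= e.1.1)%R then inl ((p.1, l), Some (e, r))
      else inl ((p.1, r), None)
  end) (fun=> 0%N)
  (fun (c : option (elt * tree)) b =>
     match c with
     | None => b
     | Some er =>
        match b with
        | Some y => Some (best (best y (node (@Leaf R X) er.1 (@Leaf R X))) er.2)
        | None => Some (best er.1 er.2)
        end
     end) (fun=> 0%N)).
- by c0.
- by c0.
- by move=> [x [|l e r h b]] //=; case: ifP => _ /=; split=> //; lia.
Qed.

Lemma comp_qpred : computes (R := R) (fun p : R * tree => qpred p.1 p.2)
  (fun p => dep p.2).
Proof.
apply: (@comp_linrec _ _ _ _ _ _ _ (fun p : R * tree =>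
  match p.2 with
  | Leaf => inr (None : option elt)
  | Node l e r _ _ =>
      if (e.1.1 <= p.1)%R then inl ((p.1, r), Some e)
      else inl ((p.1, l), None)
  end) (fun=> 0%N)
  (fun (c : option elt) b =>
     match c with
     | None => b
     | Some e => match b with Some y => Some y | None => Some e end
     end) (fun=> 0%N)).
- by c0.
- by c0.
- by move=> [x [|l e r h b]] //=; case: ifP => _ /=; split=> //; lia.
Qed.

Lemma comp_look : computes (R := R) (fun p : (R * nat) * tree => look p.1 p.2)
  (fun p => dep p.2).
Proof.
apply: (@comp_loop _ _ _ _ _ (fun p : (R * nat) * tree =>
  match p.2 with
  | Leaf => inr (None : option X)
  | Node l e r _ _ =>
      if klt p.1 e.1 then inl (p.1, l) else if klt e.1 p.1 then inl (p.1, r)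
      else inr (Some e.2.2)
  end) (fun=> 0%N)).
- by c0.
- move=> [x [|l e r h b]] //=; case: ifP => _ /=; first by split=> //; lia.
  by case: ifP => _ /=; split=> //; lia.
Qed.

(** The recursion branches, so [comp_linrec] does not apply. A list of pending subtrees and entries
    is worked off from right to left, each entry being prepended to the result, which avoids
    concatenations. *)
Lemma comp_inorder : computes (R := R) (@inorder R X)
  (fun t => size (inorder t)).
Proof.
pose items (x : tree + elt) := match x with inl t => inorder t | inr e => [:: e] end.
(* A tree with [n] entries has [n] nodes and [n + 1] leaves, and the entries themselves take [n]
   further iterations. *)
pose cost (x : tree + elt) :=
  match x with inl t => (3 * size (inorder t)).+1 | inr e => 1%N end.
have c : computes (R := R) (fun p : seq (tree + elt) * seq elt =>
    foldl (fun s x => items x ++ s) p.2 p.1) (fun p => sumn (map cost p.1)).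
  apply: (@comp_loop _ _ _ _ _ (fun p : seq (tree + elt) * seq elt =>
    match p.1 with
    | [::] => inr p.2
    | x :: st =>
        match x with
        | inl t => match t with
                   | Leaf => inl (st, p.2)
                   | Node l e r _ _ => inl (inl r :: inr e :: inl l :: st, p.2)
                   end
        | inr e => inl (st, e :: p.2)
        end
    end) (fun=> 0%N)).
  - by c0.
  - move=> [[|[[|l e r h b]|e] st] acc] //=; split; last by rewrite size_cat /=; lia.
    by rewrite -catA cat_cons.
have ct : computes (R := R) (fun t : tree => ([:: inl t : tree + elt], [::] : seq elt))
    (fun=> 0%N) by c0.
have h := c_app c ct.
apply: (comp_le (k := 4)).
  by apply: (comp_ext _ h) => t /=; rewrite cats0.
by move=> t /=; lia.
Qed.

End CompOps.

(** * The algorithm *)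

Section Algorithm.
Variable R : realType.

(* An item is ((start, finish), (identifier, weight)), where the weight is the
   reward rounded to a natural number of units. *)
Local Notation item := ((R * R) * (nat * nat))%type.

Definition ist (i : item) := i.1.1.
Definition ifin (i : item) := i.1.2.
Definition iid (i : item) := i.2.1.
Definition iu (i : item) := i.2.2.

Local Notation Leaf := (@Leaf R _).

(** Sorted by start, with the finish as priority: [qmin] returns, among the jobs that start late
    enough, one that finishes first. *)
Definition jelt (i : item) : (R * nat) * (R * item) :=
  ((ist i, iid i), (ifin i, i)).

Local Notation classes := (seq (nat * tree R item)).

Fixpoint cls_ins (i : item) (cs : classes) : classes :=
  match cs with
  | [::] => [:: (iu i, ins (jelt i) Leaf)]
  | c :: cs' =>
      if c.1 == iu i then (c.1, ins (jelt i) c.2) :: cs' else c :: cls_ins i cs'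
  end.

Fixpoint cls_del (i : item) (cs : classes) : classes :=
  match cs with
  | [::] => [::]
  | c :: cs' =>
      if c.1 == iu i then (c.1, del (ist i, iid i) c.2) :: cs'
      else c :: cls_del i cs'
  end.

Definition cls_dels (cs : classes) (s : seq item) : classes :=
  foldl (fun cs i => cls_del i cs) cs s.

Local Notation entry := (R * seq item)%type.

Definition cand (t : tree R item) (y : entry) : option entry :=
  match qmin y.1 t with
  | Some e => Some (e.2.1, e.2.2 :: y.2)
  | None => None
  end.

(* The dynamic program: entry v is a chain of weight at least v with the
   earliest finish. Extending by an item of weight u needs entry v - u, so each
   weight class keeps the last u entries in a queue made of two lists. *)
Local Notation cqueue := ((nat * tree R item) * (seq entry * seq entry))%type.

Definition qturn (q : cqueue) (s : seq entry) : option entry * cqueue :=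
  match s with
  | y :: cur => (cand q.1.2 y, (q.1, (cur, [::])))
  | [::] => (None, q)
  end.

(** With [x] the entry for [v] and [u] the weight of the class, [x] is enqueued and the entry for
    [v + 1 - u] is dequeued and extended. For [u = 1] both lists are empty and the dequeued entry is
    [x] itself. *)
Definition cstp (x : entry) (q : cqueue) : option entry * cqueue :=
  match q.2.1 with
  | y :: cur => (cand q.1.2 y, (q.1, (cur, x :: q.2.2)))
  | [::] => qturn q (rev (x :: q.2.2))
  end.

Definition emin (a b : option entry) : option entry :=
  match a with
  | Some x =>
      match b with
      | Some y => if (x.1 <= y.1)%R then Some x else Some y
      | None => Some x
      end
  | None => b
  end.

Fixpoint cstps (x : entry) (qs : seq cqueue) : option entry * seq cqueue :=
  match qs with
  | [::] => (None, [::])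
  | q :: qs' =>
      (emin (cstp x q).1 (cstps x qs').1, (cstp x q).2 :: (cstps x qs').2)
  end.

Definition leb (y : R) (b : option R) : bool :=
  match b with Some z => (y <= z)%R | None => true end.

Fixpoint dp (fuel : nat) (b : option R) (x : entry) (qs : seq cqueue) :
    entry * nat :=
  match fuel with
  | 0 => (x, 0)
  | f.+1 =>
      match (cstps x qs).1 with
      | Some y => if leb y.1 b then dp f b y (cstps x qs).2 else (x, f)
      | None => (x, f)
      end
  end.

(** The copies stand for the entries at negative indices: the empty chain weighs at least any
    nonpositive amount. With the entry enqueued by the first step there are [u] of them. *)
Definition initq (x : entry) (cs : classes) : seq cqueue :=
  [seq (c, (nseq (c.1 - 1) x, [::])) | c <- cs].

Definition dp_start (fuel : nat) (a : R) (b : option R) (cs : classes) :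
    entry * nat :=
  dp fuel b (a, [::]) (initq (a, [::]) cs).

Fixpoint greedy (m fuel : nat) (a : R) (b : option R) (cs : classes)
    (acc : seq (item * nat)) : seq (item * nat) :=
  match m with
  | 0 => acc
  | m'.+1 =>
      greedy m' (dp_start fuel a b cs).2 a b
        (cls_dels cs (dp_start fuel a b cs).1.2)
        ([seq (i, m) | i <- (dp_start fuel a b cs).1.2] ++ acc)
  end.

Local Notation region := ((R * option R) * tree R (item * nat))%type.

(** Ordered by finish: [slist] then yields the order in which [cutp] accumulates weight, and a query
    can compute the key from the job. *)
Definition selt (x : item * nat) : (R * nat) * (R * (item * nat)) :=
  ((ifin x.1, iid x.1), (ifin x.1, x)).

Definition build (L : seq (item * nat)) : tree R (item * nat) :=
  foldl (fun t x => ins (selt x) t) Leaf L.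

Definition slist (t : tree R (item * nat)) : seq (item * nat) :=
  [seq e.2.2 | e <- inorder t].

Fixpoint usum (L : seq (item * nat)) : nat :=
  if L is x :: L' then iu x.1 + usum L' else 0.

(* Quantities derived from (M, (w, eps)): the number of machines, the weight
   threshold of a region and the bound on the steps of the dynamic program. *)
Local Notation drv := (nat * (nat * nat))%type.

(** The greedy solution may be lighter than the one at hand. Keeping the heavier one lets the lower
    bound [th] on the weight of a region survive a merge or a cut. *)
Definition better (old new : seq (item * nat)) :=
  if (usum old <= usum new)%N then new else old.

Definition mkreg (D : drv) (cs : classes) (a : R) (b : option R)
    (old : seq (item * nat)) : region :=
  ((a, b), build (better old (greedy D.1 D.2.2 a b cs [::]))).

Fixpoint cutp (k : nat) (L : seq (item * nat)) (d : R) : R :=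
  match L with
  | [::] => d
  | x :: L' => if (k <= iu x.1)%N then ifin x.1 else cutp (k - iu x.1) L' d
  end.

Definition cut2 (D : drv) (cs : classes) (a : R) (b : option R)
    (L : seq (item * nat)) (x : R) : seq region :=
  [:: mkreg D cs a (Some x) [seq y <- L | (ifin y.1 <= x)%R];
      mkreg D cs x b [seq y <- L | (x <= ist y.1)%R]].

Definition settle (D : drv) (cs : classes) (r : region)
    (L : seq (item * nat)) : seq region :=
  if (usum L <= 18 * D.2.1)%N then [:: r]
  else cut2 D cs r.1.1 r.1.2 L (cutp (8 * D.2.1) L r.1.1).

Definition process1 (D : drv) (cs : classes) (r : region) : seq region :=
  settle D cs r (slist r.2).

Definition process (D : drv) (cs : classes) (a : R) (b : option R)
    (old : seq (item * nat)) : seq region :=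
  process1 D cs (mkreg D cs a b old).

Definition relt (r : region) : (R * nat) * (R * region) :=
  ((r.1.1, 0%N), (r.1.1, r)).

Definition putregs (rs : seq region) (t : tree R region) : tree R region :=
  foldl (fun t r => ins (relt r) t) t rs.

(** The region itself has already been removed from [regs]. Searching at its right end thus finds
    the right neighbour, which starts exactly there; the last region has no right end and is merged
    with the region before it. *)
Definition mrg (regs : tree R region) (ab : R * option R)
    (old : seq (item * nat)) :
    ((R * option R) * seq (item * nat)) * tree R region :=
  match qpred (match ab.2 with Some x => x | None => ab.1 end) regs with
  | None => ((ab, old), regs)
  | Some e =>
      (match ab.2 with
       | Some x => ((ab.1, e.2.2.1.2), old ++ slist e.2.2.2)
       | None => ((e.2.2.1.1, None), slist e.2.2.2 ++ old)
       end, del (e.2.2.1.1, 0%N) regs)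
  end.

Definition mrg_small (D : drv) (regs : tree R region) (ab : R * option R)
    (old : seq (item * nat)) :
    ((R * option R) * seq (item * nat)) * tree R region :=
  if (D.2.1 <= usum old)%N then ((ab, old), regs) else mrg regs ab old.

Definition rebuild (D : drv) (cs : classes)
    (m : ((R * option R) * seq (item * nat)) * tree R region) : tree R region :=
  putregs (process D cs m.1.1.1 m.1.1.2 m.1.2) m.2.

Definition touch_reg (D : drv) (cs : classes) (regs : tree R region) (it : item)
    (r : region) : tree R region :=
  rebuild D cs (mrg_small D (del (r.1.1, 0%N) regs) r.1
    [seq x <- slist r.2 | iid x.1 != iid it]).

(** A job that extends beyond the region in which it starts belongs to no region, so no solution
    changes. It is still recorded in the classes, because boundaries move later. *)
Definition touch (D : drv) (cs : classes) (regs : tree R region) (it : item) :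
    tree R region :=
  match qpred (ist it) regs with
  | None => regs
  | Some e =>
      if leb (ifin it) e.2.2.1.2 then touch_reg D cs regs it e.2.2 else regs
  end.

Local Notation global := (classes * tree R region)%type.

Local Notation prm := (nat * (R * R))%type.

Definition cap1 (x : R) : R := if (x <= 1)%R then x else 1%R.

(** The 16 leaves room for [(1 + 1/Q)^3 <= 1 + 7/Q], which must not exceed [1 + eps]. *)
Definition qof (p : prm) : nat := Num.truncn (16%:R / cap1 p.2.2)%R.

Definition umax (p : prm) (q : nat) : nat := Num.truncn (p.2.1 * q.+1%:R)%R.

(** The budget has to cover the optimum of a region about to be solved, at most [44 * th], and one
    failing step for each of the [M <= th] machines. *)
Definition drv_of (M th : nat) : drv := (M, (th, 64 * th)%N).

(** The product is [Q] times [M * umax], the most that the jobs across one boundary can weigh. The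
    parameters are not stored but recomputed at every update, in time [O(th)]. *)
Definition derive (p : prm) : drv :=
  drv_of p.1 (p.1 * ((qof p).+1 * umax p (qof p)))%N.

(** Rounding to a power of [gbase q] leaves few classes; rounding to a multiple of [1 / q.+1] makes
    the weights integers, by which the dynamic program is indexed. *)
Definition unitw (q : nat) (r : R) : nat := Num.truncn (gfloor q r * q.+1%:R)%R.

(* (identifier, (start, (length, reward))) *)
Local Notation rawjob := (nat * (R * (R * R)))%type.

Definition item_of (p : prm) (j : rawjob) : item :=
  ((j.2.1, j.2.1 + j.2.2.1)%R, (j.1, unitw (qof p) j.2.2.2)).

Definition touch_with (D : drv) (it : item) (regs : tree R region)
    (cs : classes) : global := (cs, touch D cs regs it).

Definition insert_item (D : drv) (g : global) (it : item) : global :=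
  touch_with D it g.2 (cls_ins it g.1).

Definition delete_item (D : drv) (g : global) (it : item) : global :=
  touch_with D it g.2 (cls_del it g.1).

Definition run_insert (x : rawjob * (prm * global)) : global :=
  insert_item (derive x.2.1) x.2.2 (item_of x.2.1 x.1).

Definition run_delete (x : rawjob * (prm * global)) : global :=
  delete_item (derive x.2.1) x.2.2 (item_of x.2.1 x.1).

(** The start of a job determines the only region that can contain it, and its finish and identifier
    the key inside; a query is two searches. *)
Definition run_query (x : rawjob * (prm * global)) : nat :=
  match qpred x.1.2.1 x.2.2.2 with
  | None => 0
  | Some e =>
      match look ((x.1.2.1 + x.1.2.2.1)%R, x.1.1) e.2.2.2 with
      | Some y => y.2
      | None => 0
      end
  end.

Definition region0 : region := ((0%R, None), Leaf).

Definition global0 : global := ([::], node Leaf (relt region0) Leaf).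

End Algorithm.

(** * Programs for the algorithm, with costs as recursive expressions *)

Section CompAlg.
Variable R : realType.
Local Notation item := ((R * R) * (nat * nat))%type.
Local Notation classes := (seq (nat * tree R item)).
Local Notation entry := (R * seq item)%type.
Local Notation cqueue := ((nat * tree R item) * (seq entry * seq entry))%type.
Local Notation region := ((R * option R) * tree R (item * nat))%type.
Local Notation drv := (nat * (nat * nat))%type.
Local Notation global := (classes * tree R region)%type.
Local Notation prm := (nat * (R * R))%type.
Local Notation rawjob := (nat * (R * (R * R)))%type.
Local Notation Leaf := (@Leaf R _).

Fixpoint maxdep (cs : classes) : nat :=
  if cs is c :: cs' then maxn (dep c.2) (maxdep cs') else 0.

Lemma comp_cls_ins : computes (R := R)
  (fun p : item * classes => cls_ins p.1 p.2)
  (fun p => size p.2 + maxdep p.2)%N.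
Proof.
apply: (@comp_linrec _ _ _ _ _ _ _ (fun p : item * classes =>
  match p.2 with
  | [::] => inr [:: (iu p.1, ins (jelt p.1) Leaf)]
  | c :: cs' =>
      if c.1 == iu p.1 then inr ((c.1, ins (jelt p.1) c.2) :: cs')
      else inl ((p.1, cs'), c)
  end) (fun p => if p.2 is c :: _ then if c.1 == iu p.1 then dep c.2 else 0
                 else 0)%N (fun c r => c :: r) (fun=> 0%N)).
- rewrite /iu /jelt /ist /iid /ifin; eapply (comp_le (k := 1)).
    by csolve; eapply (c_app2 (@comp_ins R item _)); csolve.
  by move=> [i [|c cs]] //=; case: ifP => _ /=; lia.
- by c0.
- move=> [i [|c cs]] //=; case: ifP => _ /=; split=> //; lia.
Qed.

Lemma comp_cls_del : computes (R := R)
  (fun p : item * classes => cls_del p.1 p.2)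
  (fun p => size p.2 + maxdep p.2)%N.
Proof.
apply: (@comp_linrec _ _ _ _ _ _ _ (fun p : item * classes =>
  match p.2 with
  | [::] => inr [::]
  | c :: cs' =>
      if c.1 == iu p.1 then inr ((c.1, del (ist p.1, iid p.1) c.2) :: cs')
      else inl ((p.1, cs'), c)
  end) (fun p => if p.2 is c :: _ then if c.1 == iu p.1 then dep c.2 else 0
                 else 0)%N (fun c r => c :: r) (fun=> 0%N)).
- rewrite /iu /jelt /ist /iid /ifin; eapply (comp_le (k := 1)).
    by csolve; eapply (c_app2 (@comp_del R item _)); csolve.
  by move=> [i [|c cs]] //=; case: ifP => _ /=; lia.
- by c0.
- move=> [i [|c cs]] //=; case: ifP => _ /=; split=> //; lia.
Qed.

Definition dels_cost (cs : classes) (s : seq item) : nat :=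
  foldl_cost (fun cs (i : item) => size cs + maxdep cs)%N
    (fun cs i => cls_del i cs) cs s.

Lemma comp_cls_dels : computes (R := R)
  (fun p : classes * seq item => cls_dels p.1 p.2)
  (fun p => dels_cost p.1 p.2).
Proof.
have c : computes (R := R) (fun p : unit * (classes * item) => cls_del p.2.2 p.2.1)
    (fun p => size p.2.1 + maxdep p.2.1)%N.
  eapply (comp_le (k := 1)); first by eapply (c_app2 comp_cls_del); csolve.
  by move=> p /=; lia.
have h := @comp_foldl R unit classes item _ _ _ (fun _ cs i => cls_del i cs) _ c.
eapply (comp_le (k := 1)).
  refine (c_app (f := fun p : classes * seq item => (tt, p)) h _).
  by csolve.
by move=> p /=; rewrite /dels_cost; lia.
Qed.

Lemma comp_cand : computes (R := R)
  (fun p : tree R item * entry => cand p.1 p.2) (fun p => dep p.1).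
Proof.
rewrite /cand; eapply (comp_le (k := 1)).
  by csolve; eapply (c_app2 (@comp_qmin R item _)); csolve.
by move=> p /=; case: qmin => [?|] /=; lia.
Qed.

Lemma comp_qturn : computes (R := R)
  (fun p : cqueue * seq entry => qturn p.1 p.2) (fun p => dep p.1.1.2).
Proof.
rewrite /qturn; eapply (comp_le (k := 1)).
  by csolve; eapply (c_app2 comp_cand); csolve.
by move=> [q [|? ?]] /=; lia.
Qed.

Definition cstp_cost (q : cqueue) : nat :=
  dep q.1.2 + (if q.2.1 is [::] then (size q.2.2).+1 else 0).

Lemma comp_cstp : computes (R := R)
  (fun p : entry * cqueue => cstp p.1 p.2) (fun p => cstp_cost p.2).
Proof.
rewrite /cstp; eapply (comp_le (k := 2)).
  csolve; first by eapply (c_app2 comp_cand); csolve.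
  eapply (c_app2 comp_qturn); csolve.
  by eapply (c_app (@comp_rev R entry _)); csolve.
by move=> [x [c [[|y cur] acc]]] /=; rewrite /cstp_cost /=; lia.
Qed.

Lemma comp_emin : computes (R := R)
  (fun p : option entry * option entry => emin p.1 p.2) (fun=> 0%N).
Proof. by rewrite /emin; c0. Qed.

Definition cstps_cost (qs : seq cqueue) : nat :=
  sumn [seq (cstp_cost q).+1 | q <- qs].

Lemma comp_cstps : computes (R := R)
  (fun p : entry * seq cqueue => cstps p.1 p.2) (fun p => cstps_cost p.2).
Proof.
apply: (@comp_linrec _ _ _ _ _ _ _ (fun p : entry * seq cqueue =>
  match p.2 with
  | [::] => inr (None : option entry, [::] : seq cqueue)
  | q :: qs' => inl ((p.1, qs'), cstp p.1 q)
  end) (fun p => if p.2 is q :: _ then cstp_cost q else 0)%N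
  (fun c r => (emin c.1 r.1, c.2 :: r.2)) (fun=> 0%N)).
- eapply (comp_le (k := 1)).
    by csolve; eapply (c_app2 comp_cstp); csolve.
  by move=> [x [|q qs]] /=; lia.
- eapply (comp_le (k := 1)).
    by csolve; eapply (c_app2 comp_emin); csolve.
  by move=> p /=.
- by move=> [x [|q qs]] //=; split=> //; rewrite /cstps_cost /=; lia.
Qed.

Fixpoint dp_cost (fuel : nat) (b : option R) (x : entry) (qs : seq cqueue) : nat :=
  match fuel with
  | 0 => 0
  | f.+1 => (cstps_cost qs).+1 +
      match (cstps x qs).1 with
      | Some y => if leb y.1 b then dp_cost f b y (cstps x qs).2 else 0
      | None => 0
      end
  end.

(** Split off so that [cstps], which occurs twice in [dp], is evaluated once and its result
    shared. *)
Definition dp_next (p : nat * (option R * entry)) (r : option entry * seq cqueue) :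
    nat * (option R * (entry * seq cqueue)) + (entry * nat) :=
  match r.1 with
  | Some y => if leb y.1 p.2.1 then inl (p.1, (p.2.1, (y, r.2)))
              else inr (p.2.2, p.1)
  | None => inr (p.2.2, p.1)
  end.

Lemma comp_dp : computes (R := R)
  (fun p : nat * (option R * (entry * seq cqueue)) => dp p.1 p.2.1 p.2.2.1 p.2.2.2)
  (fun p => dp_cost p.1 p.2.1 p.2.2.1 p.2.2.2).
Proof.
have cn : computes (R := R) (fun p => dp_next p.1 p.2) (fun=> 0%N).
  by rewrite /dp_next /leb; c0.
apply: (@comp_loop _ _ _ _ _ (fun p : nat * (option R * (entry * seq cqueue)) =>
  if p.1 == 0%N then inr (p.2.2.1, 0%N)
  else dp_next (p.1 - 1, (p.2.1, p.2.2.1))%N (cstps p.2.2.1 p.2.2.2))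
  (fun p => if p.1 == 0 then 0 else cstps_cost p.2.2.2)%N).
- eapply (comp_le (k := 1)).
    csolve; eapply (c_app2 cn); csolve.
    by eapply (c_app2 comp_cstps); csolve.
  by move=> [[|f] [b [x qs]]] /=; lia.
- move=> [[|f] [b [x qs]]] //=; rewrite /dp_next subn1 /=.
  case: (cstps x qs).1 => [y|]; last by split=> //; lia.
  by case: ifP => _ /=; split=> //; lia.
Qed.

Lemma comp_initq : computes (R := R)
  (fun p : entry * classes => initq p.1 p.2)
  (fun p => sumn [seq c.1.+1 | c <- p.2]).
Proof.
rewrite /initq.
have c : computes (R := R) (fun p : entry * (nat * tree R item) =>
    (p.2, (nseq (p.2.1 - 1) p.1, [::] : seq entry))) (fun p => p.2.1).
  eapply (comp_le (k := 1)).
    by csolve; eapply (c_app2 (@comp_nseq R entry _)); csolve.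
  by move=> p /=; lia.
exact: (comp_map (g := fun (x : entry) (c : nat * tree R item) =>
  (c, (nseq (c.1 - 1) x, [::] : seq entry))) c).
Qed.

Definition dp_start_cost (fuel : nat) (a : R) (b : option R) (cs : classes) : nat :=
  sumn [seq c.1.+1 | c <- cs] + dp_cost fuel b (a, [::]) (initq (a, [::]) cs).

Lemma comp_dp_start : computes (R := R)
  (fun p : nat * (R * (option R * classes)) => dp_start p.1 p.2.1 p.2.2.1 p.2.2.2)
  (fun p => dp_start_cost p.1 p.2.1 p.2.2.1 p.2.2.2).
Proof.
rewrite /dp_start; eapply (comp_le (k := 1)).
  refine (c_app (f := fun p : nat * (R * (option R * classes)) => (p.1, (p.2.2.1,
    ((p.2.1, [::]), initq (p.2.1, [::]) p.2.2.2)))) comp_dp _).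
  by csolve; eapply (c_app2 comp_initq); csolve.
by move=> p /=; rewrite /dp_start_cost; lia.
Qed.

Fixpoint greedy_cost (m fuel : nat) (a : R) (b : option R) (cs : classes) : nat :=
  match m with
  | 0 => 0
  | m'.+1 =>
      (dp_start_cost fuel a b cs + dels_cost cs (dp_start fuel a b cs).1.2 +
       size (dp_start fuel a b cs).1.2).+1 +
      greedy_cost m' (dp_start fuel a b cs).2 a b
        (cls_dels cs (dp_start fuel a b cs).1.2)
  end.

Local Notation gstate :=
  (nat * (nat * (R * (option R * (classes * seq (item * nat))))))%type.

Definition greedy_next (m : nat) (p : R * (option R * (classes * seq (item * nat))))
    (r : entry * nat) : gstate :=
  (m - 1, (r.2, (p.1, (p.2.1, (cls_dels p.2.2.1 r.1.2,
    [seq (i, m) | i <- r.1.2] ++ p.2.2.2)))))%N.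

Lemma comp_tag : computes (R := R)
  (fun p : nat * seq item => [seq (i, p.1) | i <- p.2]) (fun p => size p.2).
Proof.
have c : computes (R := R) (fun p : nat * item => (p.2, p.1)) (fun=> 0%N) by c0.
have h := comp_map (g := fun (m : nat) (i : item) => (i, m)) c.
apply: (comp_le (k := 1) h) => p /=.
by elim: p.2 => //= x l; lia.
Qed.

Lemma comp_greedy : computes (R := R)
  (fun p : gstate => greedy p.1 p.2.1 p.2.2.1 p.2.2.2.1 p.2.2.2.2.1 p.2.2.2.2.2)
  (fun p => greedy_cost p.1 p.2.1 p.2.2.1 p.2.2.2.1 p.2.2.2.2.1).
Proof.
have cn : computes (R := R)
    (fun p : nat * ((R * (option R * (classes * seq (item * nat)))) * (entry * nat)) =>
       greedy_next p.1 p.2.1 p.2.2)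
    (fun p => dels_cost p.2.1.2.2.1 p.2.2.1.2 + size p.2.2.1.2)%N.
  rewrite /greedy_next; eapply (comp_le (k := 2)).
    csolve; first by eapply (c_app2 comp_cls_dels); csolve.
    eapply (c_app2 (@comp_cat R (item * nat)%type _)); csolve.
    refine (c_app (f := fun p : nat * ((R * (option R *
      (classes * seq (item * nat)))) * (entry * nat)) => (p.1, p.2.2.1.2))
      comp_tag _).
    by csolve.
  by move=> p /=; rewrite size_map; lia.
apply: (@comp_loop _ _ _ _ _ (fun p : gstate =>
  if p.1 == 0%N then inr p.2.2.2.2.2
  else inl (greedy_next p.1 p.2.2
    (dp_start p.2.1 p.2.2.1 p.2.2.2.1 p.2.2.2.2.1)))
  (fun p => if p.1 == 0 then 0 else
     dp_start_cost p.2.1 p.2.2.1 p.2.2.2.1 p.2.2.2.2.1 +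
     dels_cost p.2.2.2.2.1 (dp_start p.2.1 p.2.2.1 p.2.2.2.1 p.2.2.2.2.1).1.2 +
     size (dp_start p.2.1 p.2.2.1 p.2.2.2.1 p.2.2.2.2.1).1.2)%N).
- eapply (comp_le (k := 1)).
    csolve; eapply (c_app3 cn); csolve.
    refine (c_app (f := fun p : gstate =>
      (p.2.1, (p.2.2.1, (p.2.2.2.1, p.2.2.2.2.1)))) comp_dp_start _).
    by csolve.
  by move=> [[|m] [f [a [b [cs acc]]]]] /=; lia.
- by move=> [[|m] [f [a [b [cs acc]]]]] //=; rewrite subn1 /=; split=> //; lia.
Qed.

Local Notation sol := (seq (item * nat)).
Local Notation soltree := (tree R (item * nat)).

Definition build_cost (L : sol) : nat :=
  foldl_cost (fun (t : soltree) _ => dep t) (fun t x => ins (selt x) t) Leaf L.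

Lemma comp_build : computes (R := R) (@build R) build_cost.
Proof.
have c : computes (R := R) (fun p : unit * (soltree * (item * nat)) =>
    ins (selt p.2.2) p.2.1) (fun p => dep p.2.1).
  rewrite /selt /ifin /iid; eapply (comp_le (k := 1)).
    by eapply (c_app2 (@comp_ins R (item * nat)%type _)); csolve.
  by move=> p /=; lia.
have h := @comp_foldl R unit soltree (item * nat)%type _ _ _
  (fun _ t x => ins (selt x) t) _ c.
eapply (comp_le (k := 1)).
  refine (c_app (f := fun L : sol => (tt, (Leaf : soltree, L))) h _).
  by csolve.
by move=> p /=; rewrite /build_cost; lia.
Qed.

Lemma comp_slist : computes (R := R) (@slist R) (fun t => size (inorder t)).
Proof.
have c : computes (R := R) (fun p : unit * ((R * nat) * (R * (item * nat))) =>
  p.2.2.2) (fun=> 0%N) by c0.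
have h := comp_map (g := fun (_ : unit) (e : (R * nat) * (R * (item * nat))) =>
  e.2.2) c.
eapply (comp_le (k := 2)).
  refine (c_app (f := fun t : soltree => (tt, inorder t)) h _); csolve.
  exact: comp_inorder.
by move=> t /=; elim: (inorder t) => //= x l; lia.
Qed.

Lemma comp_usum : computes (R := R) (@usum R) (fun L => size L).
Proof.
apply: (@comp_linrec _ _ _ _ _ _ _ (fun L : sol =>
  match L with [::] => inr 0%N | x :: L' => inl (L', iu x.1) end) (fun=> 0%N)
  (fun u r => u + r)%N (fun=> 0%N)).
- by rewrite /iu; c0.
- by c0.
- by move=> [|x L] /=.
Qed.

Lemma comp_better : computes (R := R) (fun p : sol * sol => better p.1 p.2)
  (fun p => size p.1 + size p.2)%N.
Proof.
rewrite /better; eapply (comp_le (k := 1)).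
  by csolve; eapply (c_app comp_usum); csolve.
by move=> p /=; case: ifP => _; lia.
Qed.

Definition mkreg_cost (D : drv) (cs : classes) (a : R) (b : option R) (old : sol) :
    nat :=
  greedy_cost D.1 D.2.2 a b cs + size old + size (greedy D.1 D.2.2 a b cs [::]) +
  build_cost (better old (greedy D.1 D.2.2 a b cs [::])).

Local Notation mkarg := (drv * (classes * (R * (option R * sol))))%type.

Lemma comp_mkreg : computes (R := R)
  (fun p : mkarg => mkreg p.1 p.2.1 p.2.2.1 p.2.2.2.1 p.2.2.2.2)
  (fun p => mkreg_cost p.1 p.2.1 p.2.2.1 p.2.2.2.1 p.2.2.2.2).
Proof.
rewrite /mkreg; eapply (comp_le (k := 1)).
  csolve; eapply (c_app comp_build).
  eapply (c_app2 comp_better); csolve.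
  refine (c_app (f := fun p : mkarg => (p.1.1, (p.1.2.2, (p.2.2.1, (p.2.2.2.1,
    (p.2.1, [::])))))) comp_greedy _).
  by csolve.
by move=> p /=; rewrite /mkreg_cost; lia.
Qed.

Lemma comp_cutp : computes (R := R)
  (fun p : nat * (sol * R) => cutp p.1 p.2.1 p.2.2) (fun p => size p.2.1).
Proof.
apply: (@comp_loop _ _ _ _ _ (fun p : nat * (sol * R) =>
  match p.2.1 with
  | [::] => inr p.2.2
  | x :: L' => if (p.1 <= iu x.1)%N then inr (ifin x.1)
               else inl (p.1 - iu x.1, (L', p.2.2))%N
  end) (fun=> 0%N)).
- by rewrite /iu /ifin; c0.
- by move=> [k [[|x L] d]] //=; case: ifP.
Qed.

Definition cut2_cost (D : drv) (cs : classes) (a : R) (b : option R) (L : sol)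
    (x : R) : nat :=
  size L + (mkreg_cost D cs a (Some x) [seq y <- L | (ifin y.1 <= x)%R] +
    mkreg_cost D cs x b [seq y <- L | (x <= ist y.1)%R]).

Local Notation cutarg := (drv * (classes * (R * (option R * (sol * R)))))%type.

Lemma comp_cut2 : computes (R := R)
  (fun p : cutarg =>
     cut2 p.1 p.2.1 p.2.2.1 p.2.2.2.1 p.2.2.2.2.1 p.2.2.2.2.2)
  (fun p => cut2_cost p.1 p.2.1 p.2.2.1 p.2.2.2.1 p.2.2.2.2.1 p.2.2.2.2.2).
Proof.
have c1 : computes (R := R) (fun p : R * (item * nat) => (ifin p.2.1 <= p.1)%R)
  (fun=> 0%N) by rewrite /ifin; c0.
have c2 : computes (R := R) (fun p : R * (item * nat) => (p.1 <= ist p.2.1)%R)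
  (fun=> 0%N) by rewrite /ist; c0.
have f1 := comp_filter (g := fun (x : R) (y : item * nat) => (ifin y.1 <= x)%R) c1.
have f2 := comp_filter (g := fun (x : R) (y : item * nat) => (x <= ist y.1)%R) c2.
rewrite /cut2; eapply (comp_le (k := 2)).
  csolve.
    refine (c_app (f := fun p : cutarg => (p.1, (p.2.1, (p.2.2.1,
      (Some p.2.2.2.2.2,
       [seq y <- p.2.2.2.2.1 | (ifin y.1 <= p.2.2.2.2.2)%R]))))) comp_mkreg _).
    csolve.
    refine (c_app (f := fun p : cutarg => (p.2.2.2.2.2, p.2.2.2.2.1)) f1 _).
    by csolve.
  refine (c_app (f := fun p : cutarg => (p.1, (p.2.1, (p.2.2.2.2.2,
    (p.2.2.2.1,
     [seq y <- p.2.2.2.2.1 | (p.2.2.2.2.2 <= ist y.1)%R]))))) comp_mkreg _).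
  csolve.
  refine (c_app (f := fun p : cutarg => (p.2.2.2.2.2, p.2.2.2.2.1)) f2 _).
  by csolve.
by move=> p /=; rewrite /cut2_cost; lia.
Qed.

Definition settle_cost (D : drv) (cs : classes) (r : region) (L : sol) : nat :=
  size L + if (usum L <= 18 * D.2.1)%N then 0
  else cut2_cost D cs r.1.1 r.1.2 L (cutp (8 * D.2.1) L r.1.1).

Local Notation setarg := (drv * (classes * (region * sol)))%type.

Lemma comp_settle : computes (R := R)
  (fun p : setarg => settle p.1 p.2.1 p.2.2.1 p.2.2.2)
  (fun p => settle_cost p.1 p.2.1 p.2.2.1 p.2.2.2).
Proof.
(* The products with 18 and 8 are repeated additions, hence the large factor. *)
rewrite /settle; eapply (comp_le (k := 50)).
  csolve.
  - by eapply (c_app comp_usum); csolve.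
  - by eapply (c_app2 (@comp_muln R)); csolve.
  - refine (c_app (f := fun p : setarg => (p.1, (p.2.1, (p.2.2.1.1.1,
      (p.2.2.1.1.2, (p.2.2.2, cutp (8 * p.1.2.1) p.2.2.2 p.2.2.1.1.1))))))
      comp_cut2 _).
    csolve; eapply (c_app3 comp_cutp); csolve.
    by eapply (c_app2 (@comp_muln R)); csolve.
by move=> p /=; rewrite /settle_cost; case: ifP => _ /=; lia.
Qed.

Definition process1_cost (D : drv) (cs : classes) (r : region) : nat :=
  size (inorder r.2) + settle_cost D cs r (slist r.2).

Lemma comp_process1 : computes (R := R)
  (fun p : drv * (classes * region) => process1 p.1 p.2.1 p.2.2)
  (fun p => process1_cost p.1 p.2.1 p.2.2).
Proof.
rewrite /process1; eapply (comp_le (k := 1)).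
  refine (c_app (f := fun p : drv * (classes * region) =>
    (p.1, (p.2.1, (p.2.2, slist p.2.2.2)))) comp_settle _).
  by csolve; eapply (c_app comp_slist); csolve.
by move=> p /=; rewrite /process1_cost; lia.
Qed.

Definition process_cost (D : drv) (cs : classes) (a : R) (b : option R)
    (old : sol) : nat :=
  mkreg_cost D cs a b old + process1_cost D cs (mkreg D cs a b old).

Lemma comp_process : computes (R := R)
  (fun p : mkarg => process p.1 p.2.1 p.2.2.1 p.2.2.2.1 p.2.2.2.2)
  (fun p => process_cost p.1 p.2.1 p.2.2.1 p.2.2.2.1 p.2.2.2.2).
Proof.
rewrite /process; eapply (comp_le (k := 1)).
  eapply (c_app3 comp_process1); csolve.
  exact: comp_mkreg.
by move=> p /=; rewrite /process_cost; lia.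
Qed.

Definition putregs_cost (rs : seq region) (t : tree R region) : nat :=
  foldl_cost (fun (t : tree R region) _ => dep t)
    (fun t r => ins (relt r) t) t rs.

Lemma comp_putregs : computes (R := R)
  (fun p : seq region * tree R region => putregs p.1 p.2)
  (fun p => putregs_cost p.1 p.2).
Proof.
have c : computes (R := R) (fun p : unit * (tree R region * region) =>
    ins (relt p.2.2) p.2.1) (fun p => dep p.2.1).
  rewrite /relt; eapply (comp_le (k := 1)).
    by eapply (c_app2 (@comp_ins R region _)); csolve.
  by move=> p /=; lia.
have h := @comp_foldl R unit (tree R region) region _ _ _
  (fun _ t x => ins (relt x) t) _ c.
eapply (comp_le (k := 1)).
  refine (c_app (f := fun p : seq region * tree R region =>
    (tt, (p.2, p.1))) h _).
  by csolve.
by move=> p /=; rewrite /putregs_cost; lia.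
Qed.

Local Notation mrgarg := (tree R region * ((R * option R) * sol))%type.

Definition mrg_cost (regs : tree R region) (ab : R * option R) (old : sol) : nat :=
  dep regs + size old +
  match qpred (match ab.2 with Some x => x | None => ab.1 end) regs with
  | None => 0
  | Some e => size (inorder e.2.2.2)
  end.

Lemma comp_mrg : computes (R := R)
  (fun p : mrgarg => mrg p.1 p.2.1 p.2.2)
  (fun p => mrg_cost p.1 p.2.1 p.2.2).
Proof.
rewrite /mrg; eapply (comp_le (k := 3)).
  csolve.
  - by eapply (c_app2 (@comp_qpred R region _)); csolve.
  - eapply (c_app2 (@comp_cat R (item * nat)%type _)); csolve.
    by eapply (c_app comp_slist); csolve.
  - eapply (c_app2 (@comp_cat R (item * nat)%type _)); csolve.
    by eapply (c_app comp_slist); csolve.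
  - by eapply (c_app2 (@comp_del R region _)); csolve.
move=> [regs [[a b] old]]; rewrite /mrg_cost /=.
by case: b => [b|] /=; case: qpred => [e|] /=; rewrite ?size_map; lia.
Qed.

Lemma comp_mrg_small : computes (R := R)
  (fun p : drv * mrgarg => mrg_small p.1 p.2.1 p.2.2.1 p.2.2.2)
  (fun p => mrg_cost p.2.1 p.2.2.1 p.2.2.2).
Proof.
rewrite /mrg_small; eapply (comp_le (k := 2)).
  csolve; first by eapply (c_app comp_usum); csolve.
  by eapply (c_app3 comp_mrg); csolve.
by move=> p /=; case: ifP => _ /=; rewrite /mrg_cost; lia.
Qed.

Definition rebuild_cost (D : drv) (cs : classes)
    (m : ((R * option R) * sol) * tree R region) : nat :=
  process_cost D cs m.1.1.1 m.1.1.2 m.1.2 +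
  putregs_cost (process D cs m.1.1.1 m.1.1.2 m.1.2) m.2.

Local Notation rebarg :=
  (drv * (classes * (((R * option R) * sol) * tree R region)))%type.

Lemma comp_rebuild : computes (R := R)
  (fun p : rebarg => rebuild p.1 p.2.1 p.2.2)
  (fun p => rebuild_cost p.1 p.2.1 p.2.2).
Proof.
rewrite /rebuild; eapply (comp_le (k := 1)).
  eapply (c_app2 comp_putregs); csolve.
  refine (c_app (f := fun p : rebarg => (p.1, (p.2.1, (p.2.2.1.1.1,
    (p.2.2.1.1.2, p.2.2.1.2))))) comp_process _).
  by csolve.
by move=> p /=; rewrite /rebuild_cost; lia.
Qed.

Definition touch_reg_cost (D : drv) (cs : classes) (regs : tree R region)
    (it : item) (r : region) : nat :=
  dep regs + size (inorder r.2) +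
  mrg_cost (del (r.1.1, 0%N) regs) r.1 [seq x <- slist r.2 | iid x.1 != iid it] +
  rebuild_cost D cs (mrg_small D (del (r.1.1, 0%N) regs) r.1
    [seq x <- slist r.2 | iid x.1 != iid it]).

Local Notation targ :=
  (drv * (classes * (tree R region * (item * region))))%type.

Lemma comp_touch_reg : computes (R := R)
  (fun p : targ => touch_reg p.1 p.2.1 p.2.2.1 p.2.2.2.1 p.2.2.2.2)
  (fun p => touch_reg_cost p.1 p.2.1 p.2.2.1 p.2.2.2.1 p.2.2.2.2).
Proof.
have c1 : computes (R := R) (fun p : item * (item * nat) => iid p.2.1 != iid p.1)
  (fun=> 0%N) by rewrite /iid; c0.
have f1 := comp_filter
  (g := fun (i : item) (y : item * nat) => iid y.1 != iid i) c1.
rewrite /touch_reg; eapply (comp_le (k := 2)).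
  eapply (c_app3 comp_rebuild); csolve.
  refine (c_app (f := fun p : targ => (p.1, (del (p.2.2.2.2.1.1, 0%N) p.2.2.1,
    (p.2.2.2.2.1, [seq x <- slist p.2.2.2.2.2 | iid x.1 != iid p.2.2.2.1]))))
    comp_mrg_small _).
  csolve; first by eapply (c_app2 (@comp_del R region _)); csolve.
  refine (c_app (f := fun p : targ => (p.2.2.2.1, slist p.2.2.2.2.2)) f1 _).
  by csolve; eapply (c_app comp_slist); csolve.
by move=> p /=; rewrite /touch_reg_cost size_map; lia.
Qed.

Definition touch_cost (D : drv) (cs : classes) (regs : tree R region)
    (it : item) : nat :=
  dep regs + match qpred (ist it) regs with
  | None => 0
  | Some e =>
      if leb (ifin it) e.2.2.1.2 then touch_reg_cost D cs regs it e.2.2 else 0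
  end.

Local Notation toarg := (drv * (classes * (tree R region * item)))%type.

Lemma comp_touch : computes (R := R)
  (fun p : toarg => touch p.1 p.2.1 p.2.2.1 p.2.2.2)
  (fun p => touch_cost p.1 p.2.1 p.2.2.1 p.2.2.2).
Proof.
have cl : computes (R := R) (fun p : R * option R => leb p.1 p.2) (fun=> 0%N).
  by rewrite /leb; c0.
rewrite /touch /ist /ifin; eapply (comp_le (k := 1)).
  csolve.
  - by eapply (c_app2 (@comp_qpred R region _)); csolve.
  - by eapply (c_app2 cl); csolve.
  - refine (c_app (f := fun p : toarg * ((R * nat) * (R * region)) =>
      (p.1.1, (p.1.2.1, (p.1.2.2.1, (p.1.2.2.2, p.2.2.2))))) comp_touch_reg _).
    by csolve.
by move=> p /=; rewrite /touch_cost /ist /ifin; case: qpred => [e|] /=;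
  [case: ifP => _|]; lia.
Qed.

Lemma comp_cap1 : computes (R := R) (@cap1 R) (fun=> 0%N).
Proof. by rewrite /cap1; c0. Qed.

Lemma comp_qof : computes (R := R) (@qof R) (fun p => qof p).
Proof.
rewrite /qof; eapply (comp_le (k := 1)).
  eapply (c_app (@comp_truncn R)); csolve.
  by eapply (c_app comp_cap1); csolve.
by move=> p /=; lia.
Qed.

Lemma comp_umax : computes (R := R) (fun p : prm * nat => umax p.1 p.2)
  (fun p => umax p.1 p.2).
Proof.
rewrite /umax; eapply (comp_le (k := 1)).
  by eapply (c_app (@comp_truncn R)); csolve.
by move=> p /=; lia.
Qed.

Definition derive_cost (p : prm) : nat := qof p + umax p (qof p) + p.1.

Lemma comp_derive : computes (R := R) (@derive R) derive_cost.
Proof.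
rewrite /derive /drv_of.
have c : computes (R := R)
    (fun p : nat * nat => (p.1, (p.2, 64 * p.2)%N)) (fun=> 0%N).
  eapply (comp_le (k := 65)).
    by csolve; eapply (c_app2 (@comp_muln R)); csolve.
  by move=> p /=; lia.
eapply (comp_le (k := 5)).
  refine (c_app (f := fun p : prm =>
    (p.1, (p.1 * ((qof p).+1 * umax p (qof p)))%N)) c _).
  csolve; eapply (c_app2 (@comp_muln R)); csolve.
  eapply (c_app2 (@comp_muln R)); csolve; first exact: comp_qof.
  by eapply (c_app2 comp_umax); csolve; exact: comp_qof.
by move=> p /=; rewrite /derive_cost; lia.
Qed.

Definition item_cost (p : prm) (j : rawjob) : nat :=
  qof p + glog (gbase R (qof p)) j.2.2.2 + unitw (qof p) j.2.2.2.

Lemma comp_unitw : computes (R := R) (fun p : nat * R => unitw p.1 p.2)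
  (fun p => glog (gbase R p.1) p.2 + unitw p.1 p.2)%N.
Proof.
rewrite /unitw; eapply (comp_le (k := 1)).
  eapply (c_app (@comp_truncn R)); csolve.
  exact: comp_gfloor.
by move=> p /=; lia.
Qed.

Lemma comp_item_of : computes (R := R)
  (fun p : prm * rawjob => item_of p.1 p.2) (fun p => item_cost p.1 p.2).
Proof.
rewrite /item_of; eapply (comp_le (k := 1)).
  csolve; eapply (c_app2 comp_unitw); csolve.
  by eapply (c_app comp_qof); csolve.
by move=> p /=; rewrite /item_cost; lia.
Qed.

Lemma comp_touch_with : computes (R := R)
  (fun p : drv * (item * (tree R region * classes)) =>
     touch_with p.1 p.2.1 p.2.2.1 p.2.2.2)
  (fun p => touch_cost p.1 p.2.2.2 p.2.2.1 p.2.1).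
Proof.
rewrite /touch_with; eapply (comp_le (k := 1)).
  csolve.
  refine (c_app (f := fun p : drv * (item * (tree R region * classes)) =>
    (p.1, (p.2.2.2, (p.2.2.1, p.2.1)))) comp_touch _).
  by csolve.
by move=> p /=; lia.
Qed.

Definition insert_cost (x : rawjob * (prm * global)) : nat :=
  derive_cost x.2.1 + item_cost x.2.1 x.1 + size x.2.2.1 + maxdep x.2.2.1 +
  touch_cost (derive x.2.1) (cls_ins (item_of x.2.1 x.1) x.2.2.1) x.2.2.2
    (item_of x.2.1 x.1).

Definition delete_cost (x : rawjob * (prm * global)) : nat :=
  derive_cost x.2.1 + item_cost x.2.1 x.1 + size x.2.2.1 + maxdep x.2.2.1 +
  touch_cost (derive x.2.1) (cls_del (item_of x.2.1 x.1) x.2.2.1) x.2.2.2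
    (item_of x.2.1 x.1).

Local Notation uarg := (drv * (global * item))%type.

Lemma comp_run_insert : computes (R := R) (@run_insert R) insert_cost.
Proof.
have c : computes (R := R) (fun p : uarg => insert_item p.1 p.2.1 p.2.2)
    (fun p => size p.2.1.1 + maxdep p.2.1.1 +
      touch_cost p.1 (cls_ins p.2.2 p.2.1.1) p.2.1.2 p.2.2)%N.
  rewrite /insert_item; eapply (comp_le (k := 1)).
    refine (c_app (f := fun p : uarg => (p.1, (p.2.2, (p.2.1.2,
      cls_ins p.2.2 p.2.1.1)))) comp_touch_with _).
    by csolve; eapply (c_app2 comp_cls_ins); csolve.
  by move=> p /=; lia.
rewrite /run_insert; eapply (comp_le (k := 1)).
  eapply (c_app3 c); csolve; first by eapply (c_app comp_derive); csolve.
  by eapply (c_app2 comp_item_of); csolve.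
by move=> p /=; rewrite /insert_cost; lia.
Qed.

Lemma comp_run_delete : computes (R := R) (@run_delete R) delete_cost.
Proof.
have c : computes (R := R) (fun p : uarg => delete_item p.1 p.2.1 p.2.2)
    (fun p => size p.2.1.1 + maxdep p.2.1.1 +
      touch_cost p.1 (cls_del p.2.2 p.2.1.1) p.2.1.2 p.2.2)%N.
  rewrite /delete_item; eapply (comp_le (k := 1)).
    refine (c_app (f := fun p : uarg => (p.1, (p.2.2, (p.2.1.2,
      cls_del p.2.2 p.2.1.1)))) comp_touch_with _).
    by csolve; eapply (c_app2 comp_cls_del); csolve.
  by move=> p /=; lia.
rewrite /run_delete; eapply (comp_le (k := 1)).
  eapply (c_app3 c); csolve; first by eapply (c_app comp_derive); csolve.
  by eapply (c_app2 comp_item_of); csolve.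
by move=> p /=; rewrite /delete_cost; lia.
Qed.

Definition query_cost (x : rawjob * (prm * global)) : nat :=
  dep x.2.2.2 +
  match qpred x.1.2.1 x.2.2.2 with None => 0 | Some e => dep e.2.2.2 end.

Lemma comp_run_query : computes (R := R) (@run_query R) query_cost.
Proof.
rewrite /run_query; eapply (comp_le (k := 1)).
  csolve; first by eapply (c_app2 (@comp_qpred R region _)); csolve.
  by eapply (c_app2 (@comp_look R (item * nat)%type _)); csolve.
move=> p /=; rewrite /query_cost; case: qpred => [e|] //=; last by lia.
by case: look => [?|] /=; lia.
Qed.

Lemma comp_global0 : computes (R := R) (fun _ : unit => global0 R) (fun=> 0%N).
Proof. by rewrite /global0 /relt /region0; c0. Qed.

End CompAlg.

(** * Correctness *)

Section Correct.
Variable R : realType.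
Local Notation item := ((R * R) * (nat * nat))%type.
Local Notation classes := (seq (nat * tree R item)).
Local Notation entry := (R * seq item)%type.
Local Notation cqueue := ((nat * tree R item) * (seq entry * seq entry))%type.
Local Notation sol := (seq (item * nat)).
Implicit Types (X Y Z : seq item) (i j : item) (cs : classes).

Definition ovl i j : bool := (ist i < ifin j)%R && (ist j < ifin i)%R.

Definition inR (a : R) (b : option R) i : bool := (a <= ist i)%R && leb (ifin i) b.

Definition validX (um : nat) X :=
  [/\ {in X &, injective (@iid R)}, (forall i, i \in X -> ist i < ifin i)%R &
      forall i, i \in X -> (0 < iu i <= um)%N].

(** Every weight in [X] has a class, but not conversely: a deletion may leave an empty class behind.
    The number of classes stays bounded because all weights come from the fixed list [par_U]. *)
Definition repcls X cs :=
  [/\ uniq (map fst cs), (forall c, c \in cs -> 0 < c.1)%N,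
      (forall c, c \in cs -> [/\ wft c.2, srt c.2 &
         forall e, (e \in inorder c.2) =
           [&& e.2.2 \in X, iu e.2.2 == c.1 & e == jelt e.2.2]]) &
      forall i, i \in X -> iu i \in map fst cs].

Lemma eq_repcls X Y cs : X =i Y -> repcls X cs -> repcls Y cs.
Proof.
move=> e [h1 h0 h2 h3]; split=> //; last by move=> i; rewrite -e; apply: h3.
by move=> c /h2 [? ? h]; split=> // x; rewrite h e.
Qed.

Lemma cls_insE i cs : uniq (map fst cs) ->
  cls_ins i cs = if iu i \in map fst cs
    then [seq (if c.1 == iu i then (c.1, ins (jelt i) c.2) else c) | c <- cs]
    else rcons cs (iu i, ins (jelt i) (Leaf R _)).
Proof.
elim: cs => [|c cs IH] //= /andP[nc un]; rewrite inE eq_sym.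
case: eqP => [e|ne] /=.
  congr cons; rewrite -[LHS]map_id; apply/eq_in_map => d hd.
  case: eqP => // ed; case/negP: nc; rewrite -e -ed; exact: map_f.
by rewrite IH //; case: ifP.
Qed.

Lemma cls_delE i cs : uniq (map fst cs) ->
  cls_del i cs =
  [seq (if c.1 == iu i then (c.1, del (ist i, iid i) c.2) else c) | c <- cs].
Proof.
elim: cs => [|c cs IH] //= /andP[nc un].
case: eqP => [e|ne] /=; last by rewrite IH.
congr cons; rewrite -[LHS]map_id; apply/eq_in_map => d hd.
by case: eqP => // ed; case/negP: nc; rewrite e -ed; exact: map_f.
Qed.

Lemma map_fst_upd (f : tree R item -> tree R item) u cs :
  map fst [seq (if c.1 == u then (c.1, f c.2) else c) | c <- cs] = map fst cs.
Proof. by rewrite -map_comp; apply: eq_map => c /=; case: ifP. Qed.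

Lemma jelt_key i (e : (R * nat) * (R * item)) : e = jelt e.2.2 ->
  (e.1 == (ist i, iid i)) = (ist e.2.2 == ist i) && (iid e.2.2 == iid i).
Proof. by move=> ->. Qed.

Lemma cls_ins_rep X cs i : repcls X cs -> (0 < iu i)%N ->
  (forall j, j \in X -> iid j != iid i) -> repcls (i :: X) (cls_ins i cs).
Proof.
move=> [un pos rp al] ui fr.
have absent (t : tree R item) u : (forall e, (e \in inorder t) =
      [&& e.2.2 \in X, iu e.2.2 == u & e == jelt e.2.2]) ->
    forall x, x \in inorder t -> x.1 != (jelt i).1.
  move=> h x; rewrite h => /and3P[hx _ /eqP ex].
  by rewrite [(jelt i).1]/= (jelt_key i ex) negb_and (fr _ hx) orbT.
rewrite cls_insE //; case: ifP => hi.
  split.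
  - by rewrite map_fst_upd.
  - move=> _ /mapP[c hc ->]; have := pos c hc; by case: ifP.
  - move=> _ /mapP[c hc ->]; have [w s h] := rp c hc.
    case: eqP => [ec|nc] /=.
      have [w' _ _] := ins_wft (jelt i) w; split=> //.
        by apply: srt_ins => //; apply: absent h.
      move=> e; rewrite mem_ins h inE.
      case: (e =P jelt i) => [->|ne] /=; first by rewrite ec !eqxx.
      case: (e.2.2 =P i) => [ei|ni] //=; rewrite ei.
      have /negbTE -> : e != jelt i by apply/eqP.
      by rewrite !andbF.
    split=> // e; rewrite h inE.
    case: (e.2.2 =P i) => [ei|//] /=; rewrite ei.
    have /negbTE -> /= : iu i != c.1 by apply/eqP => x; apply: nc.
    by rewrite andbF.
  - move=> j; rewrite inE map_fst_upd => /orP[/eqP -> //|]; exact: al.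
split.
- by rewrite map_rcons rcons_uniq hi.
- by move=> c; rewrite mem_rcons inE => /orP[/eqP -> //|]; exact: pos.
- move=> c; rewrite mem_rcons inE => /orP[/eqP ->|hc].
    split=> // e; rewrite /= !inE.
    case: (e =P jelt i) => [->|ne] /=; first by rewrite !eqxx.
    case: (e.2.2 =P i) => [ei|ni] //=.
      have /negbTE -> : e != jelt e.2.2 by rewrite ei; apply/eqP.
      by rewrite !andbF.
    apply/esym/negbTE/negP => /and3P[/al h /eqP eu _].
    by rewrite -eu h in hi.
  have [w s h] := rp c hc; split=> // e; rewrite h inE.
  case: (e.2.2 =P i) => [ei|//] /=; rewrite ei.
  have /negbTE -> /= : iu i != c.1.
    by apply/eqP => x; move/negP: (negbT hi); apply; rewrite x map_f.
  by rewrite andbF.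
- move=> j; rewrite map_rcons mem_rcons !inE => /orP[/eqP ->|/al ->].
    by rewrite eqxx.
  by rewrite orbT.
Qed.

Lemma cls_del_rep X cs i : repcls X cs -> {in X &, injective (@iid R)} ->
  i \in X -> repcls [seq j <- X | j != i] (cls_del i cs).
Proof.
move=> [un pos rp al] inj hi; rewrite cls_delE //; split.
- by rewrite map_fst_upd.
- move=> _ /mapP[c hc ->]; have := pos c hc; by case: ifP.
- move=> _ /mapP[c hc ->]; have [w s h] := rp c hc.
  case: eqP => [ec|nc] /=.
    have [w' _ _] := del_wft (ist i, iid i) w; split=> //; first exact: srt_del.
    move=> e; rewrite inorder_del // mem_filter h mem_filter.
    case hx : (e.2.2 \in X) => /=; last by rewrite !andbF.
    case he : (e == jelt e.2.2) => /=; last by rewrite !andbF.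
    rewrite !andbT (jelt_key i (eqP he)).
    congr (~~ _ && _); apply/andP/eqP => [[_ /eqP]|-> //].
    exact: inj.
  split=> // e; rewrite h mem_filter.
  case: (e.2.2 =P i) => [->|//] /=.
  by have /negbTE -> : iu i != c.1; [apply/eqP => x; apply: nc | rewrite andbF].
- by move=> j; rewrite mem_filter map_fst_upd => /andP[_]; exact: al.
Qed.

Lemma cls_dels_rep X cs s : repcls X cs -> {in X &, injective (@iid R)} ->
  uniq s -> {subset s <= X} ->
  repcls [seq j <- X | j \notin s] (cls_dels cs s).
Proof.
rewrite /cls_dels; elim: s X cs => [|i s IH] X cs rp inj /=.
  by move=> _ _; rewrite filter_predT.
case/andP=> ni un sub.
have hi : i \in X by apply: sub; rewrite mem_head.
have := IH _ _ (cls_del_rep rp inj hi); move=> /(_ _ un) h.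
apply: eq_repcls (h _ _).
- by move=> j; rewrite !mem_filter inE negb_or andbCA andbA.
- by move=> x y; rewrite !mem_filter => /andP[_ hx] /andP[_ hy]; exact: inj.
- move=> j hj; rewrite mem_filter sub ?inE ?hj ?orbT // andbT.
  by apply/eqP => e; move: ni; rewrite -e hj.
Qed.

Definition isum Z : nat := \sum_(i <- Z) iu i.

Definition okZ X a b Z :=
  [/\ uniq Z, {subset Z <= X},
      (forall i j, i \in Z -> j \in Z -> i != j -> ~~ ovl i j) &
      forall i, i \in Z -> inR a b i].

Definition endt (a : R) (c : seq item) : R := if c is i :: _ then ifin i else a.

(** Chains are listed backwards, as the dynamic program conses each item onto the chain it
    extends. *)
Fixpoint chn X (a : R) (c : seq item) : Prop :=
  if c is i :: c' then [/\ i \in X, (endt a c' <= ist i)%R & chn X a c'] else True.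

(** * Optimality of the dynamic program *)

Section DP.
Variables (um : nat) (X : seq item) (cs : classes) (a : R) (b : option R).
Hypotheses (vX : validX um X) (rX : repcls X cs).
Implicit Types (x y : entry) (q : cqueue) (qs : seq cqueue) (F : nat -> entry).

Lemma chn_props c : chn X a c ->
  [/\ uniq c, {subset c <= X}, (a <= endt a c)%R,
      (forall i, i \in c -> (a <= ist i)%R /\ (ifin i <= endt a c)%R) &
      forall i j, i \in c -> j \in c -> i != j -> ~~ ovl i j].
Proof.
have [_ pos _] := vX.
elim: c => [|i c IH] //= [hi le /IH [un sub lea bd nv]].
have si := pos i hi.
have early j : j \in c -> (ifin j <= ist i)%R.
  by move=> hj; have [_ h] := bd j hj; apply: le_trans h le.
split.
- rewrite un andbT; apply/negP => h; have := early _ h.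
  by rewrite leNgt si.
- by move=> j; rewrite inE => /orP[/eqP -> //|]; exact: sub.
- by apply: le_trans lea _; apply: le_trans le _; exact: ltW.
- move=> j; rewrite inE => /orP[/eqP ->|hj].
    by split=> //; exact: le_trans lea le.
  have [h1 h2] := bd j hj; split=> //; apply: le_trans h2 _.
  by apply: le_trans le _; exact: ltW.
- move=> j k; rewrite !inE => /orP[/eqP ->|hj] /orP[/eqP ->|hk].
  + by rewrite eqxx.
  + by move=> _; rewrite /ovl negb_and -!leNgt early.
  + by move=> _; rewrite /ovl negb_and -!leNgt early ?orbT.
  + exact: nv.
Qed.

Definition reachable (k : nat) (e : R) Z :=
  [/\ okZ X a (Some e) Z, (k <= isum Z)%N & (a <= e)%R].

(** Minimality is asserted among sets of weight at least [k], not exactly [k]. Not every weight is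
    attained, but in this form an entry exists for every [k] up to the optimum. *)
Definition entry_ok (k : nat) (y : entry) :=
  [/\ y.1 = endt a y.2, chn X a y.2, leb y.1 b, (k <= isum y.2)%N &
      forall e Z, reachable k e Z -> (y.1 <= e)%R].

(** Truncated subtraction sends negative indices to entry 0, the empty chain, in agreement with
    [initq]. *)
Definition window (F : nat -> entry) (v u : nat) : seq entry :=
  [seq F (v.+1 + n - u)%N | n <- iota 0 u].

(** [F] is a ghost variable, the whole table of entries; the program keeps only the windows in its
    queues. The current entry [x] is about to be enqueued. *)
Definition dp_inv (F : nat -> entry) (v : nat) (x : entry) (qs : seq cqueue) :=
  [/\ F v = x, (forall k, (k <= v)%N -> entry_ok k (F k)), map fst qs = cs &
      forall q, q \in qs -> q.2.1 ++ rev (x :: q.2.2) = window F v q.1.1].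

Lemma cstp_spec x (q : cqueue) y w : q.2.1 ++ rev (x :: q.2.2) = y :: w ->
  [/\ (cstp x q).1 = cand q.1.2 y, (cstp x q).2.1 = q.1 &
      (cstp x q).2.2.1 ++ rev (cstp x q).2.2.2 = w].
Proof.
rewrite /cstp; case: q => [c [[|z cur] acc]] /=.
  by move=> ->; split=> //=; rewrite cats0.
by case=> -> <-.
Qed.

Lemma cstps_snd x qs : (cstps x qs).2 = [seq (cstp x q).2 | q <- qs].
Proof. by elim: qs => //= q qs ->. Qed.

Lemma eminP (o1 o2 : option entry) :
  match emin o1 o2 with
  | Some y => (o1 = Some y \/ o2 = Some y) /\
      (forall z, o1 = Some z \/ o2 = Some z -> (y.1 <= z.1)%R)
  | None => o1 = None /\ o2 = None
  end.
Proof.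
case: o1 o2 => [x|] [y|] //=; last 2 first.
- by split; [left | move=> z [[->]|//]].
- by split; [right | move=> z [//|[->]]].
case: leP => h; split.
- by left.
- by move=> z [[<-]|[<-]].
- by right.
- by move=> z [[<-]|[<-]] //; exact: ltW.
Qed.

Lemma cstps_fst x qs :
  match (cstps x qs).1 with
  | Some y => (exists2 q, q \in qs & (cstp x q).1 = Some y) /\
      (forall q z, q \in qs -> (cstp x q).1 = Some z -> (y.1 <= z.1)%R)
  | None => forall q, q \in qs -> (cstp x q).1 = None
  end.
Proof.
elim: qs => [|q qs IH] //=.
have := eminP (cstp x q).1 (cstps x qs).1; case: (emin _ _) => [y|].
  move=> [h1 h2]; split.
    case: h1 => h1; first by exists q; rewrite ?mem_head.
    by move: IH; rewrite h1 => -[[q' hq' eq'] _]; exists q'; rewrite ?inE ?hq' ?orbT.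
  move=> q' z; rewrite inE => /orP[/eqP -> ez|hq' ez]; first by apply: h2; left.
  case e : (cstps x qs).1 IH => [z'|]; last by move=> /(_ q' hq'); rewrite ez.
  move=> [_ /(_ q' z hq' ez)]; apply: le_trans; apply: h2; right; exact: e.
move=> [h1 h2] q'; rewrite inE => /orP[/eqP -> //|].
by move: IH; rewrite h2; apply.
Qed.

Lemma isum_rem j Z : j \in Z -> isum Z = (iu j + isum (rem j Z))%N.
Proof.
by move=> hj; rewrite /isum (perm_big _ (perm_to_rem hj)) big_cons.
Qed.

Lemma latest Z : Z != [::] -> exists2 j, j \in Z &
  forall i, i \in Z -> (ifin i <= ifin j)%R.
Proof.
elim: Z => // i [|k Z] IH _.
  by exists i; rewrite ?mem_head // => j; rewrite inE => /eqP ->.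
have [j hj h] := IH isT; have [ij|ji] := leP (ifin i) (ifin j).
  exists j; first by rewrite in_cons hj orbT.
  by move=> l; rewrite in_cons => /orP[/eqP ->|/h].
exists i; first exact: mem_head.
move=> l; rewrite in_cons => /orP[/eqP -> //|/h hl].
by apply: le_trans hl _; exact: ltW.
Qed.

Lemma window_head F v u : (0 < u)%N ->
  window F v u = F (v.+1 - u)%N :: [seq F (v.+1 + n - u)%N | n <- iota 1 u.-1].
Proof. by case: u => // u _; rewrite /window /= addn0. Qed.

(** Exchange argument: let [j] finish last in [Z]. The rest of [Z] ends before [j] starts and weighs
    at least [v + 1 - u], with [u] the weight of [j], so the entry for [v + 1 - u] finishes before
    [j] starts. Thus [j] is eligible in its class, and the item that [qmin] finds there finishes no
    later. *)
Lemma reach_cand F v x qs Z e : dp_inv F v x qs -> reachable v.+1 e Z ->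
  exists q y, [/\ q \in qs, (cstp x q).1 = Some y & (y.1 <= e)%R].
Proof.
move=> [Fv Fok eqs win] [[un sub nv bd] hk ae].
have [inj pos wt] := vX; have [ucs ucs0 rp al] := rX.
have Zn0 : Z != [::] by apply/eqP => eZ; move: hk; rewrite eZ /isum big_nil.
have [j hj jmax] := latest Zn0.
have jX := sub j hj.
have /mapP[c hc ec] := al j jX.
have /mapP[q hq eq] : c \in map fst qs by rewrite eqs.
have u0 : (0 < q.1.1)%N by rewrite -eq; exact: ucs0.
have hw := win q hq; rewrite (window_head _ _ u0) in hw.
have [e1 e2 e3] := cstp_spec hw.
have /andP[ja je] := bd j hj.
have eu : q.1.1 = iu j by rewrite -eq ec.
set k := (v.+1 - q.1.1)%N in e1.
have kv : (k <= v)%N by rewrite /k; clear -u0; lia.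
have le_j : ((F k).1 <= ist j)%R.
  have [_ _ _ _ opt] := Fok k kv; apply: (opt _ (rem j Z)); split=> //.
    split.
    - exact: rem_uniq.
    - by move=> i /mem_rem; exact: sub.
    - by move=> i l /mem_rem hi /mem_rem hl; exact: nv.
    - move=> i hi; have hi' := mem_rem hi.
      have /andP[ia ie] := bd i hi'; rewrite /inR ia /=.
      have ij : i != j by apply/eqP => eij; move: hi; rewrite eij mem_rem_uniqF.
      have := nv i j hi' hj ij; rewrite /ovl negb_and -!leNgt => /orP[h|//].
      have p1 := pos i (sub i hi'); have p2 := jmax i hi'.
      by have := lt_le_trans p1 (le_trans p2 h); rewrite ltxx.
  by rewrite (isum_rem hj) in hk; rewrite /k eu; clear -hk; lia.
have [w s hm] := rp c hc.
have hjm : jelt j \in inorder c.2 by rewrite hm /= jX -ec !eqxx.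
have := qmin_spec (F k).1 w s; case eqm : (qmin _ _) => [z|].
  move=> [hz1 hz2 hz3]; exists q, (z.2.1, z.2.2 :: (F k).2); split=> //.
    by rewrite e1 /cand -eq eqm.
  by apply: le_trans je; exact: (hz3 (jelt j)).
by move=> /(_ (jelt j) hjm le_j).
Qed.

Lemma cand_ok F v x qs y : dp_inv F v x qs -> (cstps x qs).1 = Some y ->
  leb y.1 b -> entry_ok v.+1 y.
Proof.
move=> hinv ey yb; have [Fv Fok eqs win] := hinv.
have [inj pos wt] := vX; have [ucs ucs0 rp al] := rX.
have := cstps_fst x qs; rewrite ey => -[[q hq eq] ymin].
have hc : q.1 \in cs by rewrite -eqs map_f.
have u0 := ucs0 _ hc.
have hw := win q hq; rewrite (window_head _ _ u0) in hw.
have [e1 e2 e3] := cstp_spec hw.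
set k := (v.+1 - q.1.1)%N in e1.
have kv : (k <= v)%N by rewrite /k; clear -u0; lia.
have [f1 f2 f3 f4 f5] := Fok k kv.
have [w s hm] := rp _ hc.
move: eq; rewrite e1 /cand; have := qmin_spec (F k).1 w s.
case: (qmin _ _) => [z|] // [hz1 hz2 hz3] [ez].
move: hz1; rewrite hm => /and3P[zX /eqP zu /eqP zj].
have ez1 : z.2.1 = ifin z.2.2 by rewrite {1}zj.
have ez2 : z.1.1 = ist z.2.2 by rewrite {1}zj.
split=> //.
- by rewrite -ez /= ez1.
- by rewrite -ez /=; split=> //; rewrite -f1 -ez2.
- rewrite -ez /= /isum big_cons -/(isum _) zu.
  by move: f4; rewrite /k; clear; lia.
- move=> e Z hZ; have [q' [y' [h1 h2 h3]]] := reach_cand hinv hZ.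
  by apply: le_trans h3; apply: ymin h1 h2.
Qed.

Lemma dp_inv_step F v x qs y : dp_inv F v x qs -> (cstps x qs).1 = Some y ->
  leb y.1 b ->
  dp_inv (fun k => if k == v.+1 then y else F k) v.+1 y (cstps x qs).2.
Proof.
move=> hinv ey yb; have yok := cand_ok hinv ey yb.
have [Fv Fok eqs win] := hinv; have [ucs ucs0 rp al] := rX.
have sp q : q \in qs -> [/\ (cstp x q).2.1 = q.1 & (cstp x q).2.2.1 ++
    rev (cstp x q).2.2.2 = [seq F (v.+1 + n - q.1.1)%N | n <- iota 1 q.1.1.-1]].
  move=> hq; have hc : q.1 \in cs by rewrite -eqs map_f.
  have hw := win q hq; rewrite (window_head _ _ (ucs0 _ hc)) in hw.
  by have [] := cstp_spec hw.
split.
- by rewrite eqxx.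
- by move=> k hk; case: eqP => [->//|ne]; apply: Fok; lia.
- rewrite cstps_snd -map_comp -eqs; apply/eq_in_map => q hq /=.
  by have [] := sp q hq.
- move=> q'; rewrite cstps_snd => /mapP[q hq ->].
  have hc : q.1 \in cs by rewrite -eqs map_f.
  have u0 := ucs0 _ hc; have [s1 s2] := sp q hq.
  rewrite s1 rev_cons -rcons_cat s2 /window.
  move: u0; case: (q.1.1) => // u _.
  have -> : iota 0 u.+1 = rcons (iota 0 u) u by rewrite -addn1 iotaD /= cats1.
  rewrite map_rcons succnK; congr rcons.
    rewrite (iotaDl 1 0) -map_comp; apply/eq_in_map => n; rewrite mem_iota => hn /=.
    by rewrite ifF; [congr F; lia | lia].
  by rewrite ifT //; lia.
Qed.

Lemma okZ_chain x : entry_ok 0 x \/ (exists k, entry_ok k x) -> okZ X a b x.2.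
Proof.
move=> h; have [k [e1 ch lb _ _]] : exists k, entry_ok k x.
  by case: h => [h|//]; exists 0%N.
have [un sub ae bd nv] := chn_props ch; split=> //.
move=> i hi; have [h1 h2] := bd i hi; rewrite /inR h1 /=.
by move: lb; rewrite e1 /leb; case: (b) => // z; exact: le_trans h2.
Qed.

(** A set heavier than [v] would, by [reach_cand], yield a candidate that finishes no later than the
    set does, hence inside the region. *)
Lemma dp_stop F v x qs :
  dp_inv F v x qs ->
  (forall y, (cstps x qs).1 = Some y -> leb y.1 b -> False) ->
  forall Z, okZ X a b Z -> (isum Z <= v)%N.
Proof.
move=> hinv hno Z [un sub nv bd]; rewrite leqNgt; apply/negP => hv.
have [_ pos _] := vX.
have Zn0 : Z != [::] by apply/eqP => eZ; move: hv; rewrite eZ /isum big_nil.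
have [j hj jmax] := latest Zn0.
have hr : reachable v.+1 (ifin j) Z.
  split=> //; first split=> //.
    by move=> i hi; have /andP[ia _] := bd i hi; rewrite /inR ia /=; exact: jmax.
  have /andP[ja _] := bd j hj; apply: le_trans ja _.
  by apply: ltW; apply: pos; exact: sub.
have [q [y [h1 h2 h3]]] := reach_cand hinv hr.
have := cstps_fst x qs; case e : (cstps x qs).1 => [z|]; last first.
  by move=> /(_ q h1); rewrite h2.
move=> [_ /(_ q y h1 h2) zy]; apply: (hno z e).
have /andP[_] := bd j hj; rewrite /leb; case: (b) => // t ht.
by apply: le_trans zy _; apply: le_trans h3 ht.
Qed.

(** The last conclusion is the accounting of fuel: each successful step raises the guaranteed weight
    by one, and one more step may fail. Fuel cannot run out first, as the weight would then exceed
    the bound [N] on the optimum. *)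
Lemma dp_spec fuel F v x qs N : dp_inv F v x qs ->
  (forall Z, okZ X a b Z -> (isum Z <= N)%N) -> (N < v + fuel)%N ->
  [/\ okZ X a b (dp fuel b x qs).1.2,
      (forall Z, okZ X a b Z -> (isum Z <= isum (dp fuel b x qs).1.2)%N) &
      (v + fuel <= (dp fuel b x qs).2 + isum (dp fuel b x qs).1.2 + 1)%N].
Proof.
elim: fuel F v x qs => [|f IH] F v x qs hinv hN hf /=.
  have [Fv Fok _ _] := hinv; have hx := Fok v (leqnn v); rewrite Fv in hx.
  have := hN _ (okZ_chain (or_intror (ex_intro _ v hx))).
  by case: hx => _ _ _ ? _; lia.
have [Fv Fok _ _] := hinv; have hx := Fok v (leqnn v); rewrite Fv in hx.
have okx := okZ_chain (or_intror (ex_intro _ v hx)).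
have vx : (v <= isum x.2)%N by case: hx.
case e : (cstps x qs).1 => [y|].
  case: ifP => yb.
    by have := IH _ _ _ _ (dp_inv_step hinv e yb) hN; rewrite addSnnS; apply.
  split=> //=; last by lia.
  move=> Z hZ; apply: leq_trans vx; apply: (dp_stop hinv _ hZ).
  by move=> y'; rewrite e => -[<-]; rewrite yb.
split=> //=; last by lia.
move=> Z hZ; apply: leq_trans vx; apply: (dp_stop hinv _ hZ).
by move=> y'; rewrite e.
Qed.

Lemma dp_inv0 : leb a b -> dp_inv (fun=> (a, [::])) 0 (a, [::]) (initq (a, [::]) cs).
Proof.
move=> ab; have [ucs ucs0 rp al] := rX; split=> //.
- move=> k; rewrite leqn0 => /eqP ->; split=> //.
  by move=> e Z [].
- by rewrite /initq -map_comp map_id.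
- move=> q /mapP[c hc ->] /=; have := ucs0 c hc; case: (c.1) => // u _.
  rewrite subn1 /= /window /rev /= cats1.
  have -> : [seq (a, [::]) | _ <- iota 1 u] = nseq u (a, [::]) :> seq entry.
    by elim: u (1%N) => //= u IHu k; rewrite IHu.
  by elim: u => //= u <-.
Qed.

Lemma dp_start_spec fuel N : leb a b ->
  (forall Z, okZ X a b Z -> (isum Z <= N)%N) -> (N < fuel)%N ->
  [/\ okZ X a b (dp_start fuel a b cs).1.2,
      (forall Z, okZ X a b Z -> (isum Z <= isum (dp_start fuel a b cs).1.2)%N) &
      (fuel <= (dp_start fuel a b cs).2 + isum (dp_start fuel a b cs).1.2 + 1)%N].
Proof. by move=> ab hN hf; apply: (dp_spec (dp_inv0 ab) hN). Qed.

End DP.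

End Correct.

(** * Filling the machines one after the other *)

Section Greedy.
Variable R : realType.
Local Notation item := ((R * R) * (nat * nat))%type.
Local Notation classes := (seq (nat * tree R item)).
Local Notation sol := (seq (item * nat)).
Implicit Types (X Y Z : seq item) (i j : item) (cs : classes) (L : sol)
  (p q : item * nat).

Lemma usumE L : usum L = \sum_(p <- L) iu p.1.
Proof. by elim: L => [|x L /= ->]; rewrite ?big_nil ?big_cons. Qed.

Lemma usum_cat L1 L2 : usum (L1 ++ L2) = (usum L1 + usum L2)%N.
Proof. by rewrite !usumE big_cat. Qed.

Lemma usum_perm L1 L2 : perm_eq L1 L2 -> usum L1 = usum L2.
Proof. by move=> h; rewrite !usumE (perm_big _ h). Qed.

Lemma usum_filterC (P : pred (item * nat)) L :
  usum L = (usum (filter P L) + usum (filter (predC P) L))%N.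
Proof. by rewrite !usumE !big_filter [LHS](bigID P). Qed.

Lemma usum_tag m Z : usum [seq (i, m) | i <- Z] = isum Z.
Proof. by rewrite usumE big_map. Qed.

Lemma usum_subset L1 L2 : uniq L1 -> {subset L1 <= L2} -> (usum L1 <= usum L2)%N.
Proof.
elim: L1 L2 => [|p L1 IH] L2 //= /andP[np un] sub.
have hp : p \in L2 by apply: sub; rewrite mem_head.
rewrite (usum_perm (perm_to_rem hp)) /= leq_add2l; apply: IH => // q hq.
have : q \in p :: rem p L2 by rewrite -(perm_mem (perm_to_rem hp)) sub ?inE ?hq ?orbT.
by rewrite inE => /orP[/eqP e|//]; move: np; rewrite -e hq.
Qed.

Definition okL X (a : R) (b : option R) (M : nat) L :=
  [/\ uniq (map fst L),
      (forall p, p \in L -> [/\ p.1 \in X, inR a b p.1 & (0 < p.2 <= M)%N]) &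
      forall p q, p \in L -> q \in L -> p.2 = q.2 -> p.1 != q.1 ->
        ~~ ovl p.1 q.1].

Lemma okL_filter X a b M L (P : pred (item * nat)) X' a' b' :
  okL X a b M L ->
  (forall p, p \in L -> P p -> p.1 \in X -> inR a b p.1 ->
     p.1 \in X' /\ inR a' b' p.1) ->
  okL X' a' b' M (filter P L).
Proof.
move=> [un mem nv] h; split.
- by apply: subseq_uniq un; apply: map_subseq; apply: filter_subseq.
- move=> p; rewrite mem_filter => /andP[Pp hp]; have [h1 h2 h3] := mem p hp.
  by have [? ?] := h p hp Pp h1 h2.
- by move=> p q; rewrite !mem_filter => /andP[_ hp] /andP[_ hq]; exact: nv.
Qed.

Lemma okL_sub X a b M L X' a' b' : okL X a b M L ->
  (forall p, p \in L -> p.1 \in X -> inR a b p.1 ->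
     p.1 \in X' /\ inR a' b' p.1) ->
  okL X' a' b' M L.
Proof.
move=> h h'; rewrite -(filter_predT L); apply: okL_filter h _.
by move=> p hp _; exact: h'.
Qed.

Lemma okL_perm X a b M L1 L2 : perm_eq L1 L2 -> okL X a b M L1 -> okL X a b M L2.
Proof.
move=> e [un mem nv]; split.
- by rewrite -(perm_uniq (perm_map fst e)).
- by move=> p; rewrite -(perm_mem e); exact: mem.
- by move=> p q; rewrite -!(perm_mem e); exact: nv.
Qed.

Lemma okL_cat X a b M L1 L2 : okL X a b M L1 -> okL X a b M L2 ->
  (forall p q, p \in L1 -> q \in L2 -> p.1 != q.1 /\ (p.2 = q.2 -> ~~ ovl p.1 q.1)) ->
  okL X a b M (L1 ++ L2).
Proof.
move=> [u1 m1 n1] [u2 m2 n2] h; split.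
- rewrite map_cat cat_uniq u1 u2 andbT /=; apply/hasP => -[i /mapP[q hq ->]].
  by move=> /mapP[p hp e]; have [/eqP ne _] := h p q hp hq; apply: ne.
- by move=> p; rewrite mem_cat => /orP[]; [exact: m1 | exact: m2].
- have sym i j : ovl i j = ovl j i by rewrite /ovl andbC.
  move=> p q; rewrite !mem_cat => /orP[hp|hp] /orP[hq|hq] e ne.
  + exact: n1.
  + by have [_] := h p q hp hq; apply.
  + by rewrite sym; have [_] := h q p hq hp; apply.
  + exact: n2.
Qed.

Lemma okL_uniq X a b M L : okL X a b M L -> uniq L.
Proof. by case=> /map_uniq. Qed.

Definition optle X a b M N := forall L, okL X a b M L -> (usum L <= N)%N.

Lemma usum_le_size um L : (forall p, p \in L -> iu p.1 <= um)%N ->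
  (usum L <= size L * um)%N.
Proof.
elim: L => //= p L IH h; rewrite mulSn; apply: leq_add.
  by apply: h; rewrite mem_head.
by apply: IH => q hq; apply: h; rewrite inE hq orbT.
Qed.

Lemma size_le_usum L : (forall p, p \in L -> 0 < iu p.1)%N ->
  (size L <= usum L)%N.
Proof.
elim: L => //= p L IH h; rewrite -add1n; apply: leq_add.
  by apply: h; rewrite mem_head.
by apply: IH => q hq; apply: h; rewrite inE hq orbT.
Qed.

(** Any two of these jobs overlap just before [x], so no machine runs more than one of them. *)
Lemma cross_le um X a b M L (x : R) : validX um X -> okL X a b M L ->
  (forall p, p \in L -> (ist p.1 < x <= ifin p.1)%R) -> (usum L <= M * um)%N.
Proof.
move=> [_ _ wt] [un mem nv] cr.
have uL : uniq L by exact: map_uniq un.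
have us : uniq (map snd L).
  rewrite map_inj_in_uniq // => p q hp hq e.
  have [e1|ne] := eqVneq p.1 q.1.
    by case: p q e1 e {hp hq} => [? ?] [? ?] /= -> ->.
  have := nv p q hp hq e ne; rewrite /ovl.
  have /andP[p1 p2] := cr p hp; have /andP[q1 q2] := cr q hq.
  by rewrite (lt_le_trans p1 q2) (lt_le_trans q1 p2).
have sz : (size L <= M)%N.
  rewrite -(size_map snd) -[leqRHS](size_iota 1 M); apply: uniq_leq_size us _.
  move=> k /mapP[p hp ->]; have [_ _] := mem p hp.
  by rewrite mem_iota; lia.
apply: leq_trans (leq_mul sz (leqnn um)); apply: usum_le_size => p hp.
by have [h _ _] := mem p hp; have /andP[] := wt _ h.
Qed.

Lemma usum_machines M L : (forall p, p \in L -> 0 < p.2 <= M)%N ->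
  usum L = \sum_(k < M) usum [seq p <- L | p.2 == k.+1].
Proof.
move=> h; rewrite usumE.
rewrite [RHS](eq_bigr (fun k : 'I_M => \sum_(p <- L | p.2 == k.+1) iu p.1)); last first.
  by move=> k _; rewrite usumE big_filter.
rewrite (exchange_big_dep xpredT) //=; apply: eq_big_seq => p hp.
have /andP[h1 h2] := h p hp.
have hk : (p.2.-1 < M)%N by rewrite prednK.
rewrite (big_pred1 (Ordinal hk)) // => k /=.
by apply/eqP/eqP => [e|->] /=; [apply: val_inj; rewrite /= e | rewrite prednK].
Qed.

Lemma validX_sub um X Y : validX um X -> {subset Y <= X} -> validX um Y.
Proof.
move=> [h1 h2 h3] s; split.
- by move=> i j hi hj; apply: h1; exact: s.
- by move=> i /s; exact: h2.
- by move=> i /s; exact: h3.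
Qed.

(** The gap between any solution [O] and the current one shrinks by the factor [(M - 1) / M] with
    every machine. What [O] has beyond [acc] is spread over [M] machines, each carrying a chain of
    leftover jobs, so it weighs at most [M] times the chain just found. Truncated subtraction keeps
    the claim true once the gap is closed. *)
Lemma greedy_spec um X a b M N : validX um X -> leb a b -> optle X a b M N ->
  forall m fuel cs acc Y, repcls Y cs ->
  Y =i [seq i <- X | i \notin map fst acc] ->
  okL X a b M acc -> (forall p, p \in acc -> m < p.2)%N -> (m <= M)%N ->
  (N + m <= fuel + usum acc)%N ->
  okL X a b M (greedy m fuel a b cs acc) /\
  forall O, okL X a b M O ->
    (M ^ m * (usum O - usum (greedy m fuel a b cs acc)) <=
     M.-1 ^ m * (usum O - usum acc))%N.
Proof.
move=> vX ab hN; elim=> [|m IH] fuel cs acc Y rY eY oka hm mM hf /=.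
  by split=> // O _; rewrite !expn0.
have sYX : {subset Y <= X} by move=> i; rewrite eY mem_filter => /andP[].
have vY := validX_sub vX sYX.
have naN := hN _ oka.
have okZacc Z : okZ Y a b Z -> okL X a b M ([seq (i, m.+1) | i <- Z] ++ acc).
  move=> [uZ sZ nZ bZ]; apply: okL_cat => //.
    split.
    - by rewrite -map_comp map_id.
    - by move=> _ /mapP[i hi ->]; split=> //=; [exact: sYX (sZ _ hi) | exact: bZ].
    - by move=> _ _ /mapP[i hi ->] /mapP[j hj ->] _ /=; exact: nZ.
  move=> _ q /mapP[i hi ->] hq /=; split; last by move: (hm q hq) => + e; lia.
  have := sZ _ hi; rewrite eY mem_filter => /andP[h _].
  by apply/eqP => e; case/negP: h; rewrite e map_f.
have hZ Z : okZ Y a b Z -> (isum Z <= N - usum acc)%N.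
  by move=> /okZacc /hN; rewrite usum_cat usum_tag; lia.
have [oc bc fc] := dp_start_spec vY rY (fuel := fuel) ab hZ ltac:(lia).
move: oc bc fc; set c := (dp_start _ _ _ _).1.2; set f' := (dp_start _ _ _ _).2.
move=> oc bc fc; have [uc sc nc inc] := oc.
have [||||||ok' le'] := IH f' (cls_dels cs c) ([seq (i, m.+1) | i <- c] ++ acc)
  [seq j <- Y | j \notin c].
- by apply: cls_dels_rep => //; case: vY.
- move=> i; rewrite !mem_filter eY mem_filter map_cat mem_cat negb_or.
  by rewrite -map_comp map_id andbA.
- exact: okZacc.
- move=> p; rewrite mem_cat => /orP[/mapP[i _ ->] //|/hm]; exact: ltnW.
- exact: ltnW.
- by rewrite usum_cat usum_tag; lia.
split=> // O okO; have {le'} := le' O okO.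
rewrite usum_cat usum_tag; set G := usum (greedy _ _ _ _ _ _) => le'.
have key : (usum O - usum acc <= M * isum c)%N.
  have uO0 : uniq (map fst O) by case: okO.
  rewrite (usum_filterC (fun p => p.1 \notin map fst acc) O).
  have h1 : (usum [seq p <- O | predC (fun p => p.1 \notin map fst acc) p]
              <= usum acc)%N.
    (* Machine numbers are erased, since [O] may run a job of [acc] on another machine. *)
    have -> : usum acc = usum [seq (i, 0%N) | i <- map fst acc].
      by rewrite usum_tag /isum usumE big_map.
    rewrite (_ : usum _ = usum [seq (i, 0%N) | i <-
      map fst [seq p <- O | predC (fun p => p.1 \notin map fst acc) p]]); last first.
      by rewrite usum_tag /isum usumE !big_map.
    apply: usum_subset.
      rewrite map_inj_uniq; last by move=> x y [].
      apply: subseq_uniq uO0; apply: map_subseq; exact: filter_subseq.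
    move=> _ /mapP[i /mapP[p hp ->] ->]; apply: map_f.
    by move: hp; rewrite mem_filter /= negbK => /andP[].
  set O' := [seq p <- O | p.1 \notin map fst acc].
  have hO' : (usum O' <= M * isum c)%N.
    rewrite (@usum_machines M); last first.
      by move=> p; rewrite mem_filter => /andP[_ hp]; case: okO => _ /(_ p hp) [].
    rewrite -[M in leqRHS]card_ord -sum_nat_const; apply: leq_sum => k _.
    set Ok := [seq p <- O' | _].
    have -> : usum Ok = isum (map fst Ok) by rewrite usumE /isum big_map.
    apply: bc; case: okO => uO mO nO.
    have mk p : p \in Ok -> [/\ p \in O, p.1 \notin map fst acc & p.2 = k.+1].
      by rewrite !mem_filter => /and3P[/eqP ? ? ?].
    split.
    - apply: subseq_uniq uO; apply: map_subseq.
      by apply: subseq_trans (filter_subseq _ _) (filter_subseq _ _).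
    - move=> _ /mapP[p /mk [h2 h3 _] ->].
      by rewrite eY mem_filter h3; have [] := mO p h2.
    - move=> _ _ /mapP[p /mk [h2 _ e2] ->] /mapP[q /mk [h3 _ e3] ->].
      by apply: nO => //; rewrite e2 e3.
    - by move=> _ /mapP[p /mk [h2 _ _] ->]; have [] := mO p h2.
  by apply: leq_trans (leq_sub2r _ (leq_add hO' h1)) _; rewrite addnK.
(* By [key], removing the new chain from the gap removes at least its [M]-th part. *)
have fin : (M * (usum O - (isum c + usum acc)) <= M.-1 * (usum O - usum acc))%N.
  move: key mM; clear; move: (usum O) (usum acc) (isum c) => o s v key mM.
  have -> : (o - (v + s) = (o - s) - v)%N by lia.
  move: (o - s)%N key => x key; case: M mM key => // M' _ key /=.
  by rewrite mulnBr mulSn; lia.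
rewrite expnS -mulnA; apply: leq_trans (leq_mul (leqnn M) le') _.
by rewrite mulnCA expnSr -mulnA leq_mul2l fin orbT.
Qed.

End Greedy.

Lemma bernoulli_expn m n : (m ^ n.+1 + n.+1 * m ^ n <= m.+1 ^ n.+1)%N.
Proof.
elim: n => [|n IH]; first by rewrite !expn1 expn0; lia.
rewrite [X in (_ <= X)%N]expnS; apply: leq_trans (leq_mul (leqnn _) IH).
by rewrite [(m ^ n.+2)%N]expnS [(m ^ n.+1)%N]expnS; nia.
Qed.

(** Bernoulli's inequality gives [(1 - 1/M)^M <= 1/2], a weak form of the bound [1/e]. It makes the
    solution of a region a 2-approximation, whatever [M] is. *)
Lemma double_pred_expn M : (0 < M)%N -> (2 * M.-1 ^ M <= M ^ M)%N.
Proof.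
case: M => // m _ /=; apply: leq_trans (bernoulli_expn m m).
by rewrite expnS; lia.
Qed.

(** * Solving and cutting one region *)

Section Regions.
Variable R : realType.
Local Notation item := ((R * R) * (nat * nat))%type.
Local Notation classes := (seq (nat * tree R item)).
Local Notation sol := (seq (item * nat)).
Local Notation soltree := (tree R (item * nat)).
Local Notation region := ((R * option R) * tree R (item * nat))%type.
Implicit Types (X Y Z : seq item) (i j : item) (cs : classes) (L : sol)
  (p q : item * nat) (t : soltree) (r : region).

Definition soltree_ok t :=
  [/\ wft t, srt t & forall e, e \in inorder t -> e = selt e.2.2].

Lemma build_from t L : soltree_ok t ->
  uniq (map (fun p => iid p.1) (slist t ++ L)) ->
  let t' := foldl (fun t x => ins (selt x) t) t L in
  soltree_ok t' /\ perm_eq (slist t') (slist t ++ L).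
Proof.
elim: L t => [|x L IH] t ok /=; first by rewrite cats0.
rewrite map_cat cat_uniq /= => /and3P[u1 /norP[nx hn] /andP[u3 u4]].
have [w s f] := ok.
have pi := perm_ins (selt x) t.
have ps : perm_eq (slist (ins (selt x) t)) (x :: slist t).
  by rewrite /slist; have := perm_map (fun e => e.2.2) pi.
have ok' : soltree_ok (ins (selt x) t).
  split.
  - by have [] := ins_wft (selt x) w.
  - apply: srt_ins => // e he; rewrite (f e he) /=.
    apply/eqP => -[_ ei]; case/negP: nx; apply/mapP; exists e.2.2 => //.
    exact: map_f.
  - by move=> e; rewrite mem_ins => /orP[/eqP -> //|]; exact: f.
have [|ok2 p2] := IH _ ok' _; last first.
  split=> //; apply: perm_trans p2 _.
  by rewrite -[x :: L]cat1s catA perm_cat2r perm_sym cats1 perm_rcons perm_sym.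
rewrite map_cat cat_uniq u4 (perm_uniq (perm_map _ ps)) /= u1 nx /=.
rewrite andbT; apply/hasPn => k hk; rewrite (perm_mem (perm_map _ ps)) /= inE negb_or.
apply/andP; split; first by apply/eqP => e; move: u3; rewrite -e hk.
by move/hasPn: hn => /(_ k hk).
Qed.

Lemma build_ok um X a b M L : validX um X -> okL X a b M L ->
  soltree_ok (build L) /\ perm_eq (slist (build L)) L.
Proof.
move=> [inj _ _] [un mem _]; apply: (@build_from (Leaf R _)) => //=.
rewrite (map_comp (@iid R) fst) map_inj_in_uniq //.
by move=> i j /mapP[p /mem [hp _ _] ->] /mapP[q /mem [hq _ _] ->]; exact: inj.
Qed.

Lemma slist_sorted t : soltree_ok t ->
  pairwise (fun p q => (ifin p.1 <= ifin q.1)%R) (slist t).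
Proof.
move=> [_ s f]; rewrite /slist pairwise_map.
apply: (sub_in_pairwise (P := mem (inorder t)) _ _ s); last exact/allP.
move=> x y hx hy; rewrite /elt_lt /=.
by rewrite (f x hx) (f y hy) => /klt_le.
Qed.

Definition region_ratio X a b M (G : nat) := forall O, okL X a b M O ->
  ((M ^ M - M.-1 ^ M) * usum O <= M ^ M * G)%N.

Lemma ratio_double X a b M G : (0 < M)%N -> region_ratio X a b M G ->
  optle X a b M (2 * G).
Proof.
move=> M0 h O /h; have := double_pred_expn M0; have : (0 < M ^ M)%N by rewrite expn_gt0 M0.
move: (M ^ M)%N (M.-1 ^ M)%N (usum O) => A B o A0 h2 h1.
have : (A * o <= A * (2 * G))%N by rewrite mulnBl in h1; nia.
by rewrite leq_mul2l => /orP[/eqP e|//]; lia.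
Qed.

Lemma mkreg_spec um X M th N cs a b old : (0 < M)%N -> validX um X ->
  repcls X cs -> leb a b -> okL X a b M old -> optle X a b M N ->
  (N + M <= 64 * th)%N ->
  let r := mkreg (drv_of M th) cs a b old in
  [/\ r.1 = (a, b), soltree_ok r.2, okL X a b M (slist r.2),
      region_ratio X a b M (usum (slist r.2)) & (usum old <= usum (slist r.2))%N].
Proof.
move=> M0 vX rX ab oko hN hf; rewrite /mkreg /drv_of /=.
have [|||||okg rg] := greedy_spec vX ab hN (m := M) (fuel := 64 * th) rX (acc := [::]).
- by move=> i; rewrite mem_filter.
- by split.
- by [].
- by [].
- by rewrite addn0.
set g := greedy _ _ _ _ _ _ in okg rg *.
have okb : okL X a b M (better old g) by rewrite /better; case: ifP.
have [st pm] := build_ok vX okb; have eu := usum_perm pm.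
have gb : (usum g <= usum (better old g))%N.
  by rewrite /better; case: (leqP (usum old) (usum g)) => // /ltnW.
have ob : (usum old <= usum (better old g))%N.
  by rewrite /better; case: (leqP (usum old) (usum g)).
split=> //; rewrite ?eu //.
- by apply: okL_perm okb; rewrite perm_sym.
- move=> O /rg; rewrite subn0; move: gb; clear.
  move: (M ^ M)%N (M.-1 ^ M)%N (usum O) (usum g) (usum (better _ _)) => A B o G H.
  by move=> GH h; rewrite mulnBl leq_subLR; rewrite mulnBr in h; nia.
Qed.

Lemma cutp_spec k L d : (0 < k <= usum L)%N -> exists L1 y L2,
  [/\ L = L1 ++ y :: L2, cutp k L d = ifin y.1, (usum L1 < k)%N &
      (k <= usum L1 + iu y.1)%N].
Proof.
elim: L k => [|x L IH] k /=; first by lia.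
move=> hk; case: leqP => h.
  by exists [::], x, L; split=> //=; lia.
have [|L1 [y [L2 [e1 e2 e3 e4]]]] := IH (k - iu x.1)%N; first by lia.
by exists (x :: L1), y, L2; split=> //=; [rewrite e1 | lia | lia].
Qed.

Definition good X M th r :=
  [/\ soltree_ok r.2, okL X r.1.1 r.1.2 M (slist r.2),
      optle X r.1.1 r.1.2 M (36 * th) &
      region_ratio X r.1.1 r.1.2 M (usum (slist r.2))].

Lemma ovl_sep i j (x : R) : (ifin i <= x)%R -> (x <= ist j)%R -> ~~ ovl i j.
Proof. by move=> h1 h2; rewrite /ovl negb_and -!leNgt (le_trans h1 h2) orbT. Qed.

(** Origin of the constants: a solution of weight at most [18 * th] bounds the optimum by [36 * th],
    by [ratio_double]. Otherwise each side of the cut retains [8 * th] of the solution found. A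
    solution of one side combines with what is retained on the other to a solution of the whole, so
    each side has an optimum of at most [44 * th - 8 * th]. *)
Lemma process_spec um X M th cs a b old : (0 < M)%N -> validX um X ->
  (M * um <= th)%N -> (M <= th)%N ->
  repcls X cs -> leb a b -> okL X a b M old -> optle X a b M (44 * th) ->
  (exists r, [/\ process (drv_of M th) cs a b old = [:: r], r.1 = (a, b),
     good X M th r & (usum old <= usum (slist r.2))%N]) \/
  (exists r1 r2 x,
    [/\ process (drv_of M th) cs a b old = [:: r1; r2], r1.1 = (a, Some x),
     r2.1 = (x, b), (a < x)%R & (if b is Some y then x < y else true)%R] /\
    [/\ good X M th r1, good X M th r2, (th <= usum (slist r1.2))%N &
        (th <= usum (slist r2.2))%N]).
Proof.
move=> M0 vX mum mth rX ab oko hN.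
rewrite /process /process1 /settle.
have := mkreg_spec M0 vX rX ab oko hN (th := th) ltac:(lia).
move: (mkreg (drv_of M th) cs a b old) => r [r1 sr okr ra ole].
have two := ratio_double M0 ra.
rewrite r1 /drv_of /=; case: leqP => h18.
  left; exists r; split=> //; split; rewrite ?r1 //=.
  by move=> O /two; lia.
right; set L := slist r.2 in okr ra ole two h18 *.
have [|L1 [y [L2 [eL ex h1 h2]]]] := @cutp_spec (8 * th) L a; first by clear -h18 mth M0; lia.
rewrite ex; set x := ifin y.1.
have [uL mL nL] := okr; have [inj pos wt] := vX.
have yL : y \in L by rewrite eL mem_cat mem_head orbT.
have [yX /andP[ya yb] ym] := mL y yL.
have yy := pos _ yX.
have ax : (a < x)%R by apply: le_lt_trans ya _.
have srtL := slist_sorted sr; rewrite -/L eL pairwise_cat in srtL.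
have /and3P[/allrelP s1 _ s2] := srtL.
set Ll := [seq p <- L | (ifin p.1 <= x)%R]; set Lr := [seq p <- L | (x <= ist p.1)%R].
have leftw : (8 * th <= usum Ll)%N.
  apply: leq_trans h2 _; rewrite /Ll eL filter_cat usum_cat /= /x lexx /=.
  have /all_filterP -> : all (fun p => ifin p.1 <= ifin y.1)%R L1.
    by apply/allP => p hp; apply: s1 => //; rewrite mem_head.
  by rewrite leq_add2l leq_addr.
(* From [y] on there is a weight of more than [10 * th]. Jobs of this part that start before [x]
   finish at or after [x], as the list is sorted by finish; they weigh at most [M * um <= th]. *)
have rightw : (8 * th <= usum Lr)%N.
  have e1 : usum L = (usum L1 + usum (y :: L2))%N by rewrite eL usum_cat.
  have e2 := usum_filterC (fun p => (x <= ist p.1)%R) (y :: L2).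
  have h3 : (usum [seq p <- y :: L2 | (x <= ist p.1)%R] <= usum Lr)%N.
    by rewrite /Lr eL filter_cat usum_cat leq_addl.
  have h4 : (usum [seq p <- y :: L2 | predC (fun p => (x <= ist p.1)%R) p]
              <= M * um)%N.
    have ok2 : okL X a b M (filter (fun p => p \in y :: L2) L).
      by apply: okL_filter okr _.
    have ok3 : okL X a b M [seq p <- [seq p <- L | p \in y :: L2] |
       predC (fun p => (x <= ist p.1)%R) p] by apply: okL_filter ok2 _.
    apply: leq_trans (cross_le (x := x) vX ok3 _).
      apply: usum_subset.
        apply: filter_uniq; have := okL_uniq okr; rewrite eL cat_uniq.
        by case/and3P.
      move=> p; rewrite !mem_filter => /andP[-> hp] /=; rewrite hp /= eL mem_cat hp.
      by rewrite orbT.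
    move=> p; rewrite !mem_filter /= -ltNge => /and3P[-> hp _] /=.
    move: hp; rewrite inE => /orP[/eqP -> //|hp].
    by move/andP: s2 => [/allP /(_ p hp)].
  move: h3 h4 e1; rewrite e2; move: (usum (filter _ _)) => A.
  move: (usum (filter _ _)) => B; clear -h1 h18 mum; lia.
have Lrn : Lr != [::].
  by apply/eqP => e; move: rightw; rewrite e /=; clear -M0 mth; lia.
have [pr hpr] : exists p, p \in Lr by case: (Lr) Lrn => // p ? _; exists p; rewrite mem_head.
have xb : (if b is Some z then x < z else true)%R.
  move: hpr; rewrite mem_filter => /andP[xp /mL [pX /andP[_ pb] _]].
  move: pb; rewrite /leb; case: (b) => // z pz.
  by apply: le_lt_trans xp _; apply: lt_le_trans (pos _ pX) pz.
have lbx z : (z <= x)%R -> leb z b.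
  by move=> zx; move: xb; rewrite /leb; case: (b) => // u /ltW; exact: le_trans.
have okl : okL X a (Some x) M Ll.
  by apply: okL_filter okr _ => p hp px pX /andP[pa _]; rewrite /inR pa.
have okr' : okL X x b M Lr.
  by apply: okL_filter okr _ => p hp px pX /andP[_ pb]; rewrite /inR px.
have wl O : okL X a (Some x) M O -> okL X a b M O.
  by move=> h; apply: okL_sub h _ => p hp pX /andP[pa px]; rewrite /inR pa lbx.
have wr O : okL X x b M O -> okL X a b M O.
  move=> h; apply: okL_sub h _ => p hp pX /andP[pa px]; rewrite /inR px andbT.
  by split=> //; apply: le_trans pa; exact: ltW.
have sep O1 O2 : okL X a (Some x) M O1 -> okL X x b M O2 -> okL X a b M (O1 ++ O2).
  move=> o1 o2; apply: okL_cat (wl _ o1) (wr _ o2) _ => p q hp hq.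
  have [_ m1 _] := o1; have [_ m2 _] := o2.
  have [pX /andP[_ p1] _] := m1 p hp; have [qX /andP[q1 _] _] := m2 q hq.
  split; last by move=> _; exact: ovl_sep p1 q1.
  by apply/eqP => e; have := pos _ pX; rewrite ltNge {2}e (le_trans p1 q1).
have optl : optle X a (Some x) M (36 * th).
  move=> O oO; have := hN _ (sep _ _ oO okr'); rewrite usum_cat.
  by move: rightw; clear; lia.
have optr : optle X x b M (36 * th).
  move=> O oO; have := hN _ (sep _ _ okl oO); rewrite usum_cat.
  by move: leftw; clear; lia.
have [g1 g2 g3 g4 g5] := mkreg_spec M0 vX rX (ltW ax : leb a (Some x)) okl optl
  (th := th) ltac:(clear -mth; lia).
have [k1 k2 k3 k4 k5] := mkreg_spec M0 vX rX (lbx x (lexx x)) okr' optr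
  (th := th) ltac:(clear -mth; lia).
exists (mkreg (drv_of M th) cs a (Some x) Ll), (mkreg (drv_of M th) cs x b Lr), x.
split; split=> //.
- by move: xb; case: (b).
- by apply: leq_trans g5; apply: leq_trans leftw; clear; lia.
- by apply: leq_trans k5; apply: leq_trans rightw; clear; lia.
Qed.

End Regions.

(** * The partition of the time line under an update *)

Section Touch.
Variable R : realType.
Local Notation item := ((R * R) * (nat * nat))%type.
Local Notation classes := (seq (nat * tree R item)).
Local Notation sol := (seq (item * nat)).
Local Notation region := ((R * option R) * tree R (item * nat))%type.
Implicit Types (X Y Z : seq item) (i j : item) (cs : classes) (L : sol)
  (p q : item * nat) (r n : region) (rs : seq region) (t : tree R region)
  (a x : R) (b : option R).

Definition ltb (x : R) b : bool := if b is Some y then (x < y)%R else true.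

Lemma ltb_leb x b : ltb x b -> leb x b.
Proof. by case: b => //= y; exact: ltW. Qed.

(* The intervals of rs are consecutive and cover [a, b). *)
Fixpoint seg a rs b : Prop :=
  if rs is r :: rs' then
    [/\ r.1.1 = a, ltb a r.1.2 &
        if r.1.2 is Some x then seg x rs' b else rs' = [::] /\ b = None]
  else b = Some a.

Definition tailseg b rs : Prop :=
  if b is Some x then seg x rs None else rs = [::].

Lemma seg_cat a rs1 rs2 b : seg a (rs1 ++ rs2) b -> rs2 != [::] ->
  exists2 c, seg a rs1 (Some c) & seg c rs2 b.
Proof.
elim: rs1 a => [|r rs1 IH] a /=; first by move=> h _; exists a.
move=> [h1 h2 h3] ne; case: (r.1.2) h2 h3 => [x|] h2.
  by move=> /IH -/(_ ne) [c h4 h5]; exists c.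
by case=> /eqP; rewrite -size_eq0 size_cat addn_eq0 !size_eq0 => /andP[_] /(negP ne).
Qed.

Lemma cat_seg a rs1 c rs2 b : seg a rs1 (Some c) -> seg c rs2 b ->
  seg a (rs1 ++ rs2) b.
Proof.
elim: rs1 a => [|r rs1 IH] a /=; first by case=> ->.
move=> [h1 h2 h3] hs; split=> //; case: (r.1.2) h3 => [x h3|[]] //.
exact: IH.
Qed.

Lemma seg_bounds a rs b : seg a rs b -> forall r, r \in rs ->
  [/\ (a <= r.1.1)%R, ltb r.1.1 r.1.2 &
      if b is Some c then if r.1.2 is Some y then (y <= c)%R else false else true].
Proof.
have le_end a' rs' c : seg a' rs' (Some c) -> (a' <= c)%R.
  elim: rs' a' => [|r rs' IH] a' /=; first by case=> ->.
  case=> _; case: (r.1.2) => [x /= ax /IH|_ []] //.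
  by apply: le_trans; exact: ltW.
elim: rs a => [|r rs IH] a //= [h1 h2 h3] r'; rewrite inE => /orP[/eqP ->|hr'].
  rewrite h1 lexx h2; split=> //; case: b h3 {IH} => [c|//].
  by case: (r.1.2) => [y /le_end //|[]].
case: (r.1.2) h2 h3 => [x /= ax /IH /(_ r' hr') [k1 k2 k3]|_ [e _]].
  by split=> //; apply: le_trans k1; exact: ltW.
by move: hr'; rewrite e.
Qed.

Lemma seg_sorted a rs b : seg a rs b ->
  pairwise (fun r r' => (r.1.1 < r'.1.1)%R) rs.
Proof.
elim: rs a => [|r rs IH] a //= [h1 h2 h3]; apply/andP.
case: (r.1.2) h2 h3 => [x /= ax hx|_ [-> _]] //; split; last exact: IH hx.
apply/allP => r' /(seg_bounds hx) [xr _ _].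
by rewrite h1; apply: lt_le_trans xr.
Qed.

Lemma relt_sorted a rs b : seg a rs b -> pairwise (@elt_lt R _) (map (@relt R) rs).
Proof.
move=> h; rewrite pairwise_map; apply: sub_pairwise (seg_sorted h) => r r' /=.
by rewrite /elt_lt /klt /= => ->.
Qed.

Lemma putregs_from news t : wft t -> srt t ->
  uniq (map (fun r => r.1.1) news) ->
  (forall r e, r \in news -> e \in inorder t -> e.1 != (r.1.1, 0%N)) ->
  [/\ wft (putregs news t), srt (putregs news t) &
      inorder (putregs news t) =i map (@relt R) news ++ inorder t].
Proof.
rewrite /putregs; elim: news t => [|r news IH] t w s //= /andP[nr un] fr.
have [w' _ _] := ins_wft (relt r) w.
have s' : srt (ins (relt r) t).
  by apply: srt_ins => // e he; apply: fr => //; rewrite mem_head.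
have [|k1 k2 k3] := IH _ w' s' un.
  move=> r' e hr'; rewrite mem_ins => /orP[/eqP ->|he].
    rewrite /relt /=; apply/eqP => -[e1]; case/negP: nr; rewrite e1.
    exact: (map_f (fun r : region => r.1.1)).
  by apply: fr; rewrite ?inE ?hr' ?orbT.
split=> // e; rewrite k3 mem_cat mem_ins inE mem_cat; exact: orbCA.
Qed.

Lemma putregs_ok t rs1 news rs2 : wft t -> srt t ->
  inorder t = map (@relt R) (rs1 ++ rs2) -> seg 0%R (rs1 ++ news ++ rs2) None ->
  [/\ wft (putregs news t), srt (putregs news t) &
      inorder (putregs news t) = map (@relt R) (rs1 ++ news ++ rs2)].
Proof.
move=> w s ei sg; have ss := seg_sorted sg.
have key_in r r' : r \in news -> r' \in rs1 ++ rs2 -> r.1.1 != r'.1.1.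
  move: ss; rewrite !pairwise_cat allrel_catr => /and3P[/andP[/allrelP h1 _] _].
  case/and3P=> /allrelP h2 _ _ hr; rewrite mem_cat => /orP[hr'|hr'].
    by rewrite eq_sym lt_eqF // h1.
  by rewrite lt_eqF // h2.
have un : uniq (map (fun r => r.1.1) news).
  move: ss; rewrite !pairwise_cat => /and3P[_ _ /and3P[_ + _]].
  elim: (news) => //= r l IH /andP[/allP h /IH ->]; rewrite andbT.
  by apply/mapP => -[r' /h lt e]; move: lt; rewrite e ltxx.
have [|k1 k2 k3] := @putregs_from news t w s un.
  move=> r e hr; rewrite ei => /mapP[r' hr' ->] /=.
  by apply/eqP => -[e']; have := key_in _ _ hr hr'; rewrite e' eqxx.
(* Both lists are strictly sorted, so it is enough that they have the same members. *)
split=> //; apply: (irr_sorted_eq (leT := @elt_lt R _)).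
- by move=> y x z; exact: klt_trans.
- by move=> x; exact: klt_irr.
- by rewrite sorted_pairwise // => y x z; exact: klt_trans.
- rewrite sorted_pairwise; first exact: relt_sorted sg.
  by move=> y x z; exact: klt_trans.
- by move=> e; rewrite k3 ei !map_cat !mem_cat orbCA.
Qed.

(** A single region may be arbitrarily light, as the initial one is. With several regions each
    weighs at least [th], which pays for the boundaries. *)
Definition regs_inv X M th t := exists rs,
  [/\ wft t, srt t, inorder t = map (@relt R) rs & seg 0%R rs None] /\
  ((forall r, r \in rs -> good X M th r) /\
   ((1 < size rs)%N -> forall r, r \in rs -> (th <= usum (slist r.2))%N)).

(* The state in which the interval [a, b) has been taken out of the partition
   and is about to be solved again, [old] being a feasible solution of it. *)
Definition mergeok X M th
    (m : ((R * option R) * sol) * tree R region) := exists rs1 rs2,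
  [/\ wft m.2, srt m.2, inorder m.2 = map (@relt R) (rs1 ++ rs2),
      seg 0%R rs1 (Some m.1.1.1) & ltb m.1.1.1 m.1.1.2 /\ tailseg m.1.1.2 rs2] /\
  [/\ (forall r, r \in rs1 ++ rs2 -> good X M th r),
      okL X m.1.1.1 m.1.1.2 M m.1.2, optle X m.1.1.1 m.1.1.2 M (44 * th) &
      (0 < size (rs1 ++ rs2))%N -> (th <= usum m.1.2)%N /\
        forall r, r \in rs1 ++ rs2 -> (th <= usum (slist r.2))%N].

Lemma mk_mergeok X M th t rs1 rs2 a b old :
  wft t -> srt t -> inorder t = map (@relt R) (rs1 ++ rs2) ->
  seg 0%R rs1 (Some a) -> ltb a b -> tailseg b rs2 ->
  (forall r, r \in rs1 ++ rs2 -> good X M th r) ->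
  okL X a b M old -> optle X a b M (44 * th) ->
  ((0 < size (rs1 ++ rs2))%N -> (th <= usum old)%N /\
     forall r, r \in rs1 ++ rs2 -> (th <= usum (slist r.2))%N) ->
  mergeok X M th (((a, b), old), t).
Proof. by move=> *; exists rs1, rs2; split; split. Qed.

Lemma rebuild_inv um X M th cs m : (0 < M)%N -> validX um X ->
  (M * um <= th)%N -> (M <= th)%N -> repcls X cs -> mergeok X M th m ->
  regs_inv X M th (rebuild (drv_of M th) cs m).
Proof.
case: m => [[[a b] old] t] M0 vX mum mth rX.
move=> [rs1 [rs2 [[w s ei s1 [ab s2]] [gd oko hN big]]]].
rewrite /rebuild /=; rewrite /= in w s ei s1 ab s2 oko hN big.
have mid news r : r \in rs1 ++ news ++ rs2 -> r \in news \/ r \in rs1 ++ rs2.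
  by rewrite !mem_cat => /or3P[] ->; rewrite ?orbT; auto.
have [[r [-> er gr our]]|] := process_spec M0 vX mum mth rX (ltb_leb ab) oko hN.
  have sg : seg 0%R (rs1 ++ [:: r] ++ rs2) None.
    apply: cat_seg s1 _; rewrite /= er; split=> //.
    by move: s2; rewrite /tailseg; case: (b).
  have [k1 k2 k3] := putregs_ok w s ei sg.
  exists (rs1 ++ [:: r] ++ rs2); split=> //; split.
    by move=> r' /(mid [:: r]) [|/gd //]; rewrite inE => /eqP ->.
  rewrite size_cat /= addnS ltnS -size_cat => /big [ho hr] r' /(mid [:: r]) [|/hr //].
  by rewrite inE => /eqP ->; exact: leq_trans our.
move=> [r1 [r2 [x [[-> e1 e2 ax xb] [g1 g2 u1 u2]]]]].
have sg : seg 0%R (rs1 ++ [:: r1; r2] ++ rs2) None.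
  apply: cat_seg s1 _; rewrite /= e1 e2 /=; split=> //; split=> //.
    by move: xb; rewrite /ltb; case: (b).
  by move: s2; rewrite /tailseg; case: (b).
have [k1 k2 k3] := putregs_ok w s ei sg.
exists (rs1 ++ [:: r1; r2] ++ rs2); split=> //; split.
  by move=> r' /(mid [:: r1; r2]) [|/gd //]; rewrite !inE => /orP[] /eqP ->.
move=> _ r' /(mid [:: r1; r2]) [|hr']; first by rewrite !inE => /orP[] /eqP ->.
have [|_ h] := big; last exact: h.
by case: (rs1 ++ rs2) hr'.
Qed.

(** A solution splits at [x] into a left part, a right part and the jobs across [x], at most one for
    each machine. *)
Lemma optle_merge um X M N1 N2 a x b : validX um X ->
  optle X a (Some x) M N1 -> optle X x b M N2 ->
  optle X a b M (N1 + N2 + M * um).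
Proof.
move=> vX h1 h2 O okO.
rewrite (usum_filterC (fun p => (ifin p.1 <= x)%R) O).
rewrite (usum_filterC (fun p => (x <= ist p.1)%R) (filter (predC _) _)) addnA.
apply: leq_add; first apply: leq_add.
- by apply: h1; apply: okL_filter okO _ => p _ px pX /andP[pa _]; rewrite /inR pa.
- apply: h2; rewrite -filter_predI; apply: okL_filter okO _.
  by move=> p _ /andP[px _] pX /andP[_ pb]; rewrite /inR px.
- rewrite -filter_predI; apply: (cross_le (x := x) vX (a := a) (b := b)).
    by apply: okL_filter okO _.
  move=> p; rewrite mem_filter /= -!ltNge => /andP[/andP[-> /ltW ->]] //.
Qed.

Lemma good_change X X' M th r it :
  (forall i, i != it -> (i \in X') = (i \in X)) -> ~~ inR r.1.1 r.1.2 it ->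
  good X M th r -> good X' M th r.
Proof.
move=> e nit [g1 g2 g3 g4].
have ne p : inR r.1.1 r.1.2 p.1 -> p.1 != it.
  by move=> hp; apply/eqP => h; move: nit; rewrite -h hp.
have back O : okL X' r.1.1 r.1.2 M O -> okL X r.1.1 r.1.2 M O.
  by move=> h; apply: okL_sub h _ => p _ pX pr; rewrite -e //; exact: ne.
split=> //.
- by apply: okL_sub g2 _ => p _ pX pr; rewrite e //; exact: ne.
- by move=> O /back; exact: g3.
- by move=> O /back; exact: g4.
Qed.

Lemma optle_change um X X' M N a b it : validX um X' ->
  (forall i, i != it -> (i \in X') = (i \in X)) ->
  optle X a b M N -> optle X' a b M (N + um).
Proof.
move=> [_ _ wt] e h O okO; have [uO mO _] := okO.
rewrite (usum_filterC (fun p => p.1 != it) O); apply: leq_add.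
  by apply: h; apply: okL_filter okO _ => p _ pi pX pr; rewrite -e.
set O' := filter _ O.
have sz : (size O' <= 1)%N.
  rewrite -(size_map fst); apply: (@leq_trans (size [:: it])) => //.
  apply: uniq_leq_size.
    by apply: subseq_uniq uO; apply: map_subseq; exact: filter_subseq.
  by move=> i /mapP[p]; rewrite mem_filter /= negbK inE => /andP[/eqP <- _] ->.
apply: leq_trans (usum_le_size (um := um) _) _; last first.
  by case: (size O') sz => [|[|k]] //=; rewrite ?mul0n ?mul1n.
by move=> p; rewrite mem_filter => /andP[_ /mO [/wt /andP[]]].
Qed.

(** Insertion and deletion are treated at once: [X] and [X'] differ at most in [it]. Only the region
    that contains the start of [it] can contain [it]; the others stay good by [good_change].
    Removing [it] from the old solution makes it feasible for either set. *)
Lemma touch_cases um X X' M th t it : (0 < M)%N -> validX um X ->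
  validX um X' -> (M * um <= th)%N -> (M <= th)%N -> (um <= th)%N ->
  (forall i, i != it -> (i \in X') = (i \in X)) ->
  (forall i, i \in X -> iid i = iid it -> i = it) ->
  (0 <= ist it < ifin it)%R ->
  regs_inv X M th t ->
  exists2 r, qpred (ist it) t = Some (relt r) /\ good X M th r &
  if leb (ifin it) r.1.2 then
    mergeok X' M th (mrg_small (drv_of M th) (del (r.1.1, 0%N) t) r.1
      [seq x <- slist r.2 | iid x.1 != iid it])
  else regs_inv X' M th t.
Proof.
move=> M0 vX vX' mum mth uth eX idX /andP[it0 itf].
move=> [rs [[w s ei sg] [gd big]]].
have := qpred_spec (ist it) s; case: (qpred _ t) => [e|]; last first.
  case: rs sg ei {gd big} => // r rs [r0 _ _] ei /(_ (relt r)).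
  by rewrite ei mem_head /= r0 => /(_ isT it0).
rewrite ei => -[/mapP[r hr ->] /= rit rmax].
exists r; first by split=> //; exact: gd.
have [rs1 [rs2 ers]] : exists rs1 rs2, rs = rs1 ++ r :: rs2.
  by case/splitPr: hr => p1 p2; exists p1, p2.
have sg0 : seg 0%R (rs1 ++ r :: rs2) None by rewrite -ers.
have [c sg1 sg2] := seg_cat sg0 isT; clear sg0.
have [ec ltr tl] := sg2; rewrite -{}ec in sg1 sg2 ltr.
have out r' : r' \in rs1 ++ rs2 -> ~~ inR r'.1.1 r'.1.2 it.
  rewrite mem_cat /inR => /orP[h'|h']; apply/negP => /andP[h1 h2].
    have [_ _] := seg_bounds sg1 h'; move: h2; rewrite /leb.
    case: (r'.1.2) => // y h2 h3.
    by have := lt_le_trans itf (le_trans h2 (le_trans h3 rit)); rewrite ltxx.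
  have ss := seg_sorted sg2; move: ss => /= /andP[/allP /(_ r' h') lt _].
  have := rmax (relt r'); rewrite ers map_f ?mem_cat ?inE ?h' ?orbT //= => /(_ isT h1).
  by rewrite leNgt lt.
have gd' r' : r' \in rs1 ++ rs2 -> good X' M th r'.
  move=> h'; apply: good_change eX (out r' h') (gd r' _); rewrite ers.
  by move: h'; rewrite !mem_cat inE => /orP[] ->; rewrite ?orbT.
have big' : (0 < size (rs1 ++ rs2))%N -> forall r', r' \in rs1 ++ rs2 ->
    (th <= usum (slist r'.2))%N.
  move=> h r' h'; apply: big.
    by move: h; rewrite ers !size_cat /=; lia.
  by move: h'; rewrite ers !mem_cat inE => /orP[] ->; rewrite ?orbT.
have [g1 g2 g3 g4] := gd r hr.
case: ifP => itb; last first.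
  exists rs; split=> //; split=> // r'; rewrite ers mem_cat inE.
  case/or3P=> [h|/eqP ->|h].
  - by apply: gd'; rewrite mem_cat h.
  - by apply: good_change eX _ (gd r hr); rewrite /inR itb andbF.
  - by apply: gd'; rewrite mem_cat h orbT.
set old := filter _ _.
have okold : okL X' r.1.1 r.1.2 M old.
  apply: okL_filter g2 _ => p _ pid pX pr; rewrite eX //.
  by apply/eqP => h; move: pid; rewrite h eqxx.
have opt' := optle_change vX' eX g3.
have w1 := (del_wft (r.1.1, 0%N) w); have {w1} [w1 _ _] := w1.
have s1 := srt_del (r.1.1, 0%N) w s.
have ss := seg_sorted sg.
have ei1 : inorder (del (r.1.1, 0%N) t) = map (@relt R) (rs1 ++ rs2).
  rewrite inorder_del // ei ers map_cat filter_cat /= eqxx /= map_cat.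
  move: ss; rewrite ers pairwise_cat /= => /and3P[/allrelP h1 _ /andP[/allP h2 _]].
  congr (_ ++ _); apply/all_filterP/allP => _ /mapP[r' h' ->] /=;
    apply/eqP => -[e1].
    by have := h1 r' r h' (mem_head _ _); rewrite e1 ltxx.
  by have := h2 r' h'; rewrite e1 ltxx.
have tl' : tailseg r.1.2 rs2.
  by rewrite /tailseg; move: tl; case: (r.1.2) => [x //|[]].
have rebuild_r : ((0 < size (rs1 ++ rs2))%N -> (th <= usum old)%N) ->
    mergeok X' M th ((r.1, old), del (r.1.1, 0%N) t).
  move=> ho; have -> : r.1 = (r.1.1, r.1.2) by case: (r.1).
  apply: (mk_mergeok (rs1 := rs1) (rs2 := rs2)) => //=.
  - by move=> O /opt'; clear -uth; lia.
  - by move=> h; split; [exact: ho | exact: big'].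
rewrite /mrg_small /=; case: leqP => small; first exact: rebuild_r.
(* The solution weighed less than [th + um] before the update, so the optimum was below [4 * th],
   and [it] adds at most [um]. A merge then gives at most [5 * th + 36 * th + M * um], within the
   [44 * th] that [process_spec] allows. *)
have opt5 : optle X' r.1.1 r.1.2 M (5 * th).
  have u2 : (usum (slist r.2) <= usum old + um)%N.
    have [uL mL _] := g2.
    rewrite (usum_filterC (fun p => iid p.1 != iid it) (slist r.2)) leq_add2l.
    set O' := filter _ _.
    have sz : (size O' <= 1)%N.
      rewrite -(size_map fst); apply: (@leq_trans (size [:: it])) => //.
      apply: uniq_leq_size.
        by apply: subseq_uniq uL; apply: map_subseq; exact: filter_subseq.
      move=> i /mapP[p]; rewrite mem_filter /= negbK inE => /andP[/eqP h /mL [pX _ _]] ->.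
      by rewrite (idX _ pX h).
    apply: leq_trans (usum_le_size (um := um) _) _; last first.
      by case: (size O') sz => [|[|k]] //=; rewrite ?mul0n ?mul1n.
    move=> p; rewrite mem_filter => /andP[_ /mL [pX _ _]].
    by case: vX => _ _ /(_ _ pX) /andP[].
  have := optle_change vX' eX (ratio_double M0 g4) => h O /h.
  move: u2 small uth; move: (usum O) (usum old) (usum (slist r.2)) => A B C.
  by clear; lia.
(* A bounded region is followed by another one, which starts at [x]. *)
rewrite /mrg; case eb : r.1.2 => [x|].
  move: tl' ltr okold opt5; rewrite eb => tl' ltr okold opt5.
  case: rs2 ers sg2 tl gd' big' ei1 tl' out rebuild_r => [|n rs2] ers sg2 tl gd' big' ei1 tl' out rebuild_r.
    by [].
  have [en ltn' tln] := tl'.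
  have nin : n \in rs1 ++ n :: rs2 by rewrite mem_cat mem_head orbT.
  have := qpred_spec x s1; case eq : (qpred x _) => [ee|]; last first.
    by move=> /(_ (relt n)); rewrite ei1 map_f //= en lexx => /(_ isT isT).
  move=> [he ex emax].
  have {ex emax}-> : ee = relt n.
    apply: (srt_key_inj s1) => //; first by rewrite ei1 map_f.
    have k1 := emax (relt n); rewrite ei1 map_f //= en lexx in k1.
    move: he ex (k1 isT isT); rewrite ei1 => /mapP[r' _ ->] /= h1 h2.
    by congr pair; apply/eqP; rewrite eq_le en h1 h2.
  rewrite [(relt n).2.2]/=.
  have [w2 _ _] := del_wft (n.1.1, 0%N) w1.
  have s2 := srt_del (n.1.1, 0%N) w1 s1.
  have ei2 : inorder (del (n.1.1, 0%N) (del (r.1.1, 0%N) t)) =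
      map (@relt R) (rs1 ++ rs2).
    rewrite inorder_del // ei1 map_cat filter_cat /= eqxx /= map_cat.
    move: ss; rewrite ers pairwise_cat /= => /and3P[/allrelP h1 _ /and3P[_ /allP h2 _]].
    congr (_ ++ _); apply/all_filterP/allP => _ /mapP[r' h' ->] /=;
      apply/eqP => -[e1].
      by have := h1 r' n h'; rewrite !inE eqxx orbT e1 ltxx => /(_ isT).
    by have := h2 r' h'; rewrite e1 ltxx.
  have sub r' : r' \in rs1 ++ rs2 -> r' \in rs1 ++ n :: rs2.
    by rewrite !mem_cat inE => /orP[] ->; rewrite ?orbT.
  have [n1 n2 n3 n4] := gd' n nin.
  have ltx : ltb r.1.1 n.1.2.
    move: ltr ltn'; rewrite /ltb; case: (n.1.2) => // y /= h1 h2.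
    exact: lt_trans h1 h2.
  have wide z : (z <= x)%R -> leb z n.1.2.
    by move=> zx; move: ltn'; rewrite /leb /ltb; case: (n.1.2) => // y /ltW; exact: le_trans.
  apply: (mk_mergeok (rs1 := rs1) (rs2 := rs2)) => //.
  - by move: tln; rewrite /tailseg; case: (n.1.2) => // -[].
  - by move=> r' /sub; exact: gd'.
  - apply: okL_cat.
    + apply: okL_sub okold _ => p _ pX /andP[pa pb]; rewrite /inR pa /=.
      by split=> //; exact: wide.
    + apply: okL_sub n2 _ => p _ pX /andP[pa pb]; rewrite /inR pb andbT en in pa *.
      by split=> //; apply: le_trans pa; exact: ltW.
    + move=> p q hp hq; have [_ /(_ p hp) [pX /andP[_ p1] _] _] := okold.
      have [_ /(_ q hq) [qX /andP[q1 _] _] _] := n2; rewrite en in q1.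
      split; last by move=> _; exact: ovl_sep p1 q1.
      have [_ pos _] := vX'; apply/eqP => e0; have := pos _ pX.
      by rewrite ltNge {2}e0 (le_trans p1 q1).
  - rewrite en in n3; move=> O /(optle_merge vX' opt5 n3).
    by move: mum; clear; lia.
  - move=> _; split; last by move=> r' /sub h'; apply: big' => //; rewrite size_cat addnS.
    by rewrite usum_cat; apply: leq_trans (leq_addl _ _); apply: big'; rewrite ?size_cat ?addnS.
move: tl' ltr okold opt5; rewrite eb => /= e2 _ okold opt5; subst rs2.
rewrite cats0 in ei1 gd' big' out rebuild_r.
have eqr : r.1 = (r.1.1, None) by rewrite -eb; case: (r.1).
have := qpred_spec r.1.1 s1; case eq : (qpred r.1.1 _) => [ee|]; last first.
  (* Nothing to merge with: [r] was the only region, and that one may be light. *)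
  move=> hno; apply: rebuild_r; case: (rs1) sg1 ei1 hno => // n rs1' sg1 -> /(_ (relt n)).
  have [nr _ _] : [/\ True, True & True] by [].
  have [_ ltn' hn] := seg_bounds sg1 (mem_head _ _).
  rewrite mem_head /= => /(_ isT) [] //.
  move: ltn' hn; rewrite /ltb; case: (n.1.2) => // y h1 h2.
  by apply: le_trans h2; exact: ltW.
move=> [he ex emax].
(* The last region of the time line is merged to the left, with the last region of [rs1]. *)
case/lastP: rs1 => [|rs1 n] in ers sg1 ei1 gd' big' out rebuild_r *.
  by move: he; rewrite ei1.
have sg1' : seg 0%R (rs1 ++ [:: n]) (Some r.1.1) by rewrite cats1.
have [d sg3 sg4] := seg_cat sg1' isT.
have [en ltn' tln] := sg4.
have ben : n.1.2 = Some r.1.1.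
  by move: tln; case: (n.1.2) => [y /= [->]|[]] //.
have nin : n \in rcons rs1 n by rewrite mem_rcons mem_head.
have {ex emax}-> : ee = relt n.
  apply: (srt_key_inj s1) => //; first by rewrite ei1 map_f.
  have nr : (n.1.1 <= r.1.1)%R by move: ltn'; rewrite ben /ltb en => /ltW.
  have k1 := emax (relt n); rewrite ei1 map_f //= nr in k1.
  move: he (k1 isT isT); rewrite ei1 => /mapP[r' hr' ->] /= h1.
  congr pair; apply/eqP; rewrite eq_le h1 andbT.
  move: hr'; rewrite mem_rcons inE => /orP[/eqP -> //|hr'].
  have := seg_sorted sg1; rewrite -cats1 pairwise_cat => /and3P[/allrelP h2 _ _].
  by apply: ltW; apply: h2; rewrite ?mem_head.
rewrite [(relt n).2.2]/=.
have [w2 _ _] := del_wft (n.1.1, 0%N) w1.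
have s2 := srt_del (n.1.1, 0%N) w1 s1.
have ei2 : inorder (del (n.1.1, 0%N) (del (r.1.1, 0%N) t)) =
    map (@relt R) (rs1 ++ [::]).
  rewrite inorder_del // ei1 cats0 -cats1 map_cat filter_cat /= eqxx cats0.
  have := seg_sorted sg1; rewrite -cats1 pairwise_cat => /and3P[/allrelP h2 _ _].
  apply/all_filterP/allP => _ /mapP[r' h' ->] /=; apply/eqP => -[e1].
  by have := h2 r' n h' (mem_head _ _); rewrite e1 ltxx.
have sub r' : r' \in rs1 ++ [::] -> r' \in rcons rs1 n.
  by rewrite cats0 mem_rcons inE => ->; rewrite orbT.
have [n1 n2 n3 n4] := gd' n nin.
have lnr : (n.1.1 < r.1.1)%R by move: ltn'; rewrite ben /ltb en.
apply: (mk_mergeok (rs1 := rs1) (rs2 := [::])) => //.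
- by rewrite en.
- by move=> r' /sub; exact: gd'.
- apply: okL_cat.
  + apply: okL_sub n2 _ => p _ pX /andP[pa pb]; rewrite /inR pa /=.
    by [].
  + apply: okL_sub okold _ => p _ pX /andP[pa pb]; rewrite /inR andbT.
    by split=> //; apply: le_trans pa; exact: ltW.
  + move=> p q hp hq; have [_ /(_ q hq) [qX /andP[q1 _] _] _] := okold.
    have [_ /(_ p hp) [pX /andP[_ p1] _] _] := n2; rewrite ben /= in p1.
    split; last by move=> _; exact: ovl_sep p1 q1.
    have [_ pos _] := vX'; apply/eqP => e0; have := pos _ pX.
    by rewrite ltNge {2}e0 (le_trans p1 q1).
- rewrite ben in n3; move=> O /(optle_merge vX' n3 opt5).
  by move: mum; clear; lia.
- move=> _; split; last by move=> r' /sub h'; apply: big' => //; rewrite size_rcons.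
  by rewrite usum_cat; apply: leq_trans (leq_addr _ _); apply: big'; rewrite ?size_rcons.
Qed.

Lemma touch_inv um X X' M th cs t it : (0 < M)%N -> validX um X ->
  validX um X' -> (M * um <= th)%N -> (M <= th)%N -> (um <= th)%N ->
  repcls X' cs -> (forall i, i != it -> (i \in X') = (i \in X)) ->
  (forall i, i \in X -> iid i = iid it -> i = it) ->
  (0 <= ist it < ifin it)%R ->
  regs_inv X M th t -> regs_inv X' M th (touch (drv_of M th) cs t it).
Proof.
move=> M0 vX vX' mum mth uth rX' eX idX hit hI; rewrite /touch.
have [r [-> _]] := touch_cases M0 vX vX' mum mth uth eX idX hit hI.
rewrite /=; case: (leb (ifin it) r.1.2) => // hm.
exact: rebuild_inv M0 vX' mum mth rX' hm.
Qed.

End Touch.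

(** * Running time *)

Section Costs.
Variable R : realType.
Local Notation item := ((R * R) * (nat * nat))%type.
Local Notation classes := (seq (nat * tree R item)).
Local Notation entry := (R * seq item)%type.
Local Notation cqueue := ((nat * tree R item) * (seq entry * seq entry))%type.
Local Notation sol := (seq (item * nat)).
Local Notation region := ((R * option R) * tree R (item * nat))%type.
Implicit Types (X Y Z : seq item) (i j : item) (cs : classes) (L : sol)
  (x : entry) (q : cqueue) (qs : seq cqueue) (b : option R).

Definition cs_ok (K um n : nat) cs :=
  (size cs <= K)%N /\ forall c, c \in cs ->
    [/\ wft c.2, srt c.2, (size (inorder c.2) <= n)%N & (c.1 <= um)%N].

Lemma cs_ok_del K um n i cs : cs_ok K um n cs -> cs_ok K um n (cls_del i cs).
Proof.
elim: cs K => [|c cs IH] K //= [sz h]; case: ifP => _.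
  split=> // d; rewrite inE => /orP[/eqP ->|hd]; last by apply: h; rewrite inE hd orbT.
  have [w s le u] := h c (mem_head _ _); split=> //=.
  - by have [] := del_wft (ist i, iid i) w.
  - exact: srt_del.
  - exact: leq_trans (size_del _ w s) le.
case: K sz => // K sz.
have [|sz' h'] := IH K; first by split=> // d hd; apply: h; rewrite inE hd orbT.
split=> // d; rewrite inE => /orP[/eqP ->|/h' //].
by apply: h; rewrite mem_head.
Qed.

Lemma maxdep_le K um n cs : cs_ok K um n cs -> (maxdep cs <= dlog n)%N.
Proof.
move=> [_]; elim: cs => //= c cs IH h; rewrite geq_max; apply/andP; split.
  have [w _ le _] := h c (mem_head _ _).
  by apply: leq_trans (dep_dlog w) (leq_dlog le).
by apply: IH => d hd; apply: h; rewrite inE hd orbT.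
Qed.

Lemma dels_cost_le K um n cs s : cs_ok K um n cs ->
  cs_ok K um n (cls_dels cs s) /\ (dels_cost cs s <= (K + dlog n).+1 * size s)%N.
Proof.
rewrite /cls_dels /dels_cost => ok; split.
  by elim: s cs ok => //= i s IH cs ok; apply: IH; exact: cs_ok_del.
apply: (foldl_cost_le (P := cs_ok K um n) (Q := fun=> True)) => // c i okc _.
by split; [exact: cs_ok_del | apply: leq_add; [case: okc | exact: maxdep_le okc]].
Qed.

(** The potential of the two-list queues. A step lengthens each back list by at most one, and a
    reversal costs about the length of the list that it empties. *)
Definition pot qs : nat := sumn [seq size q.2.2 | q <- qs].

Lemma cstp_fst x q : (cstp x q).2.1 = q.1.
Proof.
rewrite /cstp; case: (q.2.1) => [|y cur] //=; rewrite /qturn.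
by case: (rev _).
Qed.

Lemma cstp_pot x q : (cstp_cost q + size (cstp x q).2.2.2 <=
  dep q.1.2 + (size q.2.2).+1)%N.
Proof.
rewrite /cstp_cost /cstp; case: q => [c [[|y cur] acc]] /=; last by lia.
by rewrite /qturn rev_cons; case: (rev acc) => [|z l] /=; lia.
Qed.

Lemma cstps_pot d x qs : (forall q, q \in qs -> dep q.1.2 <= d)%N ->
  (cstps_cost qs + pot (cstps x qs).2 <= size qs * d.+2 + pot qs)%N.
Proof.
rewrite /cstps_cost /pot; elim: qs => //= q qs IH h.
have h1 := h q (mem_head _ _).
have {IH} := IH (fun q' hq' => h q' ltac:(by rewrite inE hq' orbT)).
have := cstp_pot x q.
by rewrite mulSn; lia.
Qed.

Lemma dp_cost_le d K fuel b x qs : (size qs <= K)%N ->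
  (forall q, q \in qs -> dep q.1.2 <= d)%N ->
  ((dp fuel b x qs).2 <= fuel)%N /\
  (dp_cost fuel b x qs + (dp fuel b x qs).2 * (K * d.+2).+1 <=
   fuel * (K * d.+2).+1 + pot qs)%N.
Proof.
elim: fuel x qs => [|f IH] x qs sz h /=; first by split; lia.
have h1 := cstps_pot x h.
have h2 : (size qs * d.+2 <= K * d.+2)%N by rewrite leq_mul2r sz orbT.
have sz' : (size (cstps x qs).2 <= K)%N by rewrite cstps_snd size_map.
have hd' q : q \in (cstps x qs).2 -> (dep q.1.2 <= d)%N.
  by rewrite cstps_snd => /mapP[q' hq' ->]; rewrite cstp_fst; exact: h.
move: h1 h2 hd' sz' IH; clear => h1 h2 hd' sz' IH.
case: (cstps x qs).1 => [y|] /=; last by split; lia.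
case: ifP => _ /=; last by split; lia.
have [k1 k2] := IH y _ sz' hd'.
by split; lia.
Qed.

Lemma sumn_le_size (T : eqType) (f : T -> nat) (s : seq T) k :
  (forall y : T, y \in s -> f y <= k)%N -> (sumn (map f s) <= size s * k)%N.
Proof.
elim: s => //= x s IH h; rewrite mulSn; apply: leq_add.
  by apply: h; rewrite mem_head.
by apply: IH => y hy; apply: h; rewrite inE hy orbT.
Qed.

Lemma dp_start_cost_le K um n fuel a b cs : cs_ok K um n cs ->
  ((dp_start fuel a b cs).2 <= fuel)%N /\
  (dp_start_cost fuel a b cs + (dp_start fuel a b cs).2 * (K * (dlog n).+2).+1 <=
   K * um.+1 + fuel * (K * (dlog n).+2).+1)%N.
Proof.
move=> [sz h]; rewrite /dp_start_cost /dp_start.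
have [||k1 k2] := @dp_cost_le (dlog n) K fuel b (a, [::]) (initq (a, [::]) cs).
- by rewrite size_map.
- move=> q /mapP[c hc ->] /=; have [w _ le _] := h c hc.
  exact: leq_trans (dep_dlog w) (leq_dlog le).
split=> //; rewrite -addnA; apply: leq_add.
  apply: leq_trans (sumn_le_size (k := um.+1) _) _.
    by move=> c hc; have [_ _ _] := h c hc.
  by rewrite leq_mul2r sz orbT.
apply: leq_trans k2 _; suff -> : pot (initq (a, [::]) cs) = 0%N by rewrite addn0.
by rewrite /pot /initq -map_comp; elim: (cs).
Qed.

(** Three accounts: setting up the queues is paid once per machine, the steps from the shared fuel,
    and the deletions by the chosen items; those in [acc] have been paid for already. *)
Lemma greedy_cost_le K um n a b m : forall fuel cs acc, cs_ok K um n cs ->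
  (greedy_cost m fuel a b cs + size acc * (K + dlog n).+2 <=
   m * (K * um.+1).+1 + fuel * (K * (dlog n).+2).+1 +
   size (greedy m fuel a b cs acc) * (K + dlog n).+2)%N.
Proof.
elim: m => [|m IH] fuel cs acc ok /=; first by lia.
have [k1 k2] := dp_start_cost_le fuel a b ok.
set c := (dp_start _ _ _ _).1.2; set f' := (dp_start _ _ _ _).2 in k1 k2 *.
have [ok' k3] := dels_cost_le c ok.
have := IH f' _ ([seq (i, m.+1) | i <- c] ++ acc) ok'.
rewrite size_cat size_map.
move: (size (greedy _ _ _ _ _ _)) (greedy_cost m _ _ _ _) => G C.
move: k1 k2 k3; move: (dp_start_cost _ _ _ _) (dels_cost _ _) (size c) (size acc).
clear => A B s t k1 k2 k3 k4.
move: (K * um.+1)%N (f' * _)%N (fuel * _)%N k2 k4 => u v w k2 k4.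
by nia.
Qed.

Lemma build_cost_le L : (build_cost L <= (dlog (size L)).+1 * size L)%N.
Proof.
rewrite /build_cost.
suff h (t : tree R (item * nat)) : wft t ->
    (foldl_cost (fun (t : tree R (item * nat)) _ => dep t)
       (fun t z => ins (selt z) t) t L <=
     (dlog (size (inorder t) + size L)).+1 * size L)%N.
  exact: (h (Leaf R _) I).
elim: L t => [|p L IH] t w //=.
have [w' _ _] := ins_wft (selt p) w.
have := IH _ w'; rewrite (perm_size (perm_ins (selt p) t)) /= addSnnS => h.
rewrite mulnS; apply: leq_add h.
by rewrite ltnS; apply: leq_trans (dep_dlog w) (leq_dlog _); rewrite leq_addr.
Qed.

Lemma okL_size um X a b M L : validX um X -> okL X a b M L ->
  (size L <= usum L)%N /\ (size L <= size X)%N.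
Proof.
move=> [_ _ wt] [un mem _]; split.
  by apply: size_le_usum => p /mem [/wt /andP[]].
rewrite -(size_map fst); apply: uniq_leq_size un _.
by move=> i /mapP[p /mem [hp _ _] ->].
Qed.

(** * Cost of one update *)

Section Bounds.
Variables (K um n M th : nat) (X : seq item) (cs : classes).
Hypotheses (M0 : (0 < M)%N) (u0 : (0 < um)%N) (K0 : (0 < K)%N) (vX : validX um X)
  (mum : (M * um <= th)%N) (rX : repcls X cs)
  (okcs : cs_ok K um n cs) (szX : (size X <= n)%N).

Local Notation W := (th * (K * dlog n))%N.

Lemma dlog_gt0 k : (0 < dlog k)%N. Proof. by []. Qed.

Lemma mth : (M <= th)%N.
Proof. by apply: leq_trans mum; rewrite leq_pmulr. Qed.

Lemma th_le_W : (th <= W)%N.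
Proof. by rewrite leq_pmulr // muln_gt0 K0 dlog_gt0. Qed.

Lemma mkreg_cost_le a b old : leb a b -> okL X a b M old ->
  optle X a b M (44 * th) ->
  (mkreg_cost (drv_of M th) cs a b old <= 1000 * W)%N.
Proof.
move=> ab oko hN; rewrite /mkreg_cost /drv_of /=.
have mt := mth.
have [|||||okg _] := greedy_spec vX ab hN (m := M) (fuel := 64 * th) rX (acc := [::]).
- by move=> i; rewrite mem_filter.
- by split.
- by [].
- by [].
- by rewrite addn0; lia.
have := @greedy_cost_le K um n a b M (64 * th) cs [::] okcs.
set g := greedy _ _ _ _ _ _ in okg *; set gc := greedy_cost _ _ _ _ _.
have [o1 o2] := okL_size vX oko; have [g1 g2] := okL_size vX okg.
have uo := hN _ oko; have ug := hN _ okg.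
have bs : (size (better old g) <= 44 * th)%N.
  by rewrite /better; case: ifP => _; [apply: leq_trans ug | apply: leq_trans uo].
have bn : (size (better old g) <= n)%N.
  by rewrite /better; case: ifP => _; [apply: leq_trans szX | apply: leq_trans szX].
have bc : (build_cost (better old g) <= (dlog n).+1 * (44 * th))%N.
  apply: leq_trans (build_cost_le _) _; apply: leq_mul => //.
  by rewrite ltnS leq_dlog.
have so := leq_trans o1 uo; have sg := leq_trans g1 ug.
have := dlog_gt0 n; move: (dlog n) bc => d bc d0.
rewrite mul0n addn0.
(* Filling the queues costs about [K * um] for each machine; it is affordable because
   [M * um <= th]. *)
have mK : (M * (K * um.+1).+1 <= 3 * (th * (K * d)))%N.
  have e1 : (M * (K * um.+1) <= K * (2 * th))%N.
    by rewrite mulnCA leq_mul2l; apply/orP; right; rewrite mulnS; lia.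
  have e2 : (K * (2 * th) <= 2 * (th * (K * d)))%N.
    rewrite mulnCA leq_mul2l /= mulnC [(K * d)%N]mulnC mulnA leq_mul2r.
    by rewrite leq_pmulr ?orbT.
  have e3 : (th <= th * (K * d))%N by rewrite leq_pmulr // muln_gt0 K0.
  by rewrite mulnS; lia.
have e3 : (th <= th * (K * d))%N by rewrite leq_pmulr // muln_gt0 K0.
have e4 : (K * d.+2 <= 3 * (K * d))%N by rewrite mulnCA leq_mul2l; lia.
have e5 : ((K * d.+2).+1 <= 4 * (K * d))%N.
  by have : (0 < K * d)%N; [rewrite muln_gt0 K0 | lia].
have e6 : ((K + d).+2 <= 4 * (K * d))%N by nia.
have e7 : (d.+1 <= 2 * (K * d))%N by nia.
move: (K * d)%N e3 e5 e6 e7 mK => V e3 e5 e6 e7 mK hg.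
have f1 : (64 * th * (K * d.+2).+1 <= 256 * (th * V))%N.
  by apply: leq_trans (leq_mul (leqnn _) e5) _; rewrite -mulnA mulnCA; lia.
have f2 : (size g * (K + d).+2 <= 176 * (th * V))%N.
  by apply: leq_trans (leq_mul sg e6) _; rewrite -mulnA mulnCA; lia.
have f3 : (d.+1 * (44 * th) <= 88 * (th * V))%N.
  by apply: leq_trans (leq_mul e7 (leqnn _)) _; rewrite mulnACA [(V * th)%N]mulnC; lia.
by lia.
Qed.

Lemma cutp_bounds k L d a b : leb a b -> (forall p, p \in L -> p.1 \in X) ->
  (a <= d)%R -> leb d b ->
  (forall p, p \in L -> inR a b p.1) -> (a <= cutp k L d)%R /\ leb (cutp k L d) b.
Proof.
move=> ab; have [_ pos _] := vX.
elim: L k => [|p L IH] k hX ad db hL //=; case: ifP => _.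
  have /andP[pa pb] := hL p (mem_head _ _); split=> //.
  by apply: le_trans pa _; apply: ltW; apply: pos; apply: hX; rewrite mem_head.
by apply: IH => // q hq; [apply: hX | apply: hL]; rewrite inE hq orbT.
Qed.

Lemma size_inorder_slist (t : tree R (item * nat)) : size (inorder t) = size (slist t).
Proof. by rewrite size_map. Qed.

(** At most three regions are solved, the whole and the two sides of a cut, each in [1000 * W]; the
    rest is traversing lists of length [O(th)]. *)
Lemma process_cost_le a b old : leb a b -> okL X a b M old ->
  optle X a b M (44 * th) ->
  (process_cost (drv_of M th) cs a b old <= 4000 * W)%N.
Proof.
move=> ab oko hN; rewrite /process_cost /process1_cost /settle_cost.
have c1 := mkreg_cost_le ab oko hN; have mt := mth; have tW := th_le_W.
have := mkreg_spec M0 vX rX ab oko hN (th := th) ltac:(clear -mt; lia).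
move: (mkreg (drv_of M th) cs a b old) => r [r1 _ okr _ _].
have [s1 _] := okL_size vX okr; have us := hN _ okr.
rewrite size_inorder_slist r1 [(a, b).1]/= [(a, b).2]/=.
case: ifP => _; first by clear -c1 s1 us tW; lia.
set L := slist r.2 in okr s1 us *; set x := cutp _ _ _.
have [_ mL _] := okr.
have [ax xb] : (a <= x)%R /\ leb x b.
  by apply: cutp_bounds => // p /mL [].
rewrite /cut2_cost.
have wl O : okL X a (Some x) M O -> okL X a b M O.
  move=> h; apply: okL_sub h _ => p hp pX /andP[pa px]; rewrite /inR pa; split=> //.
  by move: xb px; rewrite /leb; case: (b) => // y h1 h2; exact: le_trans h2 h1.
have wr O : okL X x b M O -> okL X a b M O.
  move=> h; apply: okL_sub h _ => p hp pX /andP[pa px]; rewrite /inR px andbT.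
  by split=> //; exact: le_trans pa.
have okl : okL X a (Some x) M [seq y <- L | (ifin y.1 <= x)%R].
  by apply: okL_filter okr _ => p hp px pX /andP[pa _]; rewrite /inR pa.
have okr' : okL X x b M [seq y <- L | (x <= ist y.1)%R].
  by apply: okL_filter okr _ => p hp px pX /andP[_ pb]; rewrite /inR px.
have c2 := mkreg_cost_le (ax : leb a (Some x)) okl (fun O hO => hN O (wl O hO)).
have c3 := mkreg_cost_le xb okr' (fun O hO => hN O (wr O hO)).
by clear -c1 c2 c3 s1 us tW; lia.
Qed.

Lemma size_process a b old :
  (size (process (drv_of M th) cs a b old) <= 2)%N.
Proof. by rewrite /process /process1 /settle; case: ifP. Qed.

Lemma putregs_cost_le (rs : seq region) (t : tree R region) k : wft t ->
  (size (inorder t) + size rs <= k)%N ->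
  (putregs_cost rs t <= (dlog k).+1 * size rs)%N.
Proof.
rewrite /putregs_cost; elim: rs t => [|r rs IH] t w hk //=.
have [w' _ _] := ins_wft (relt r) w.
have h := IH _ w'; rewrite mulnS; apply: leq_add.
  by rewrite ltnS; apply: leq_trans (dep_dlog w) (leq_dlog _); move: hk => /=; clear; lia.
by apply: h; rewrite (perm_size (perm_ins (relt r) t)) /=; move: hk => /=; clear; lia.
Qed.

(** If there are several regions, each schedules a job, as its weight is positive, and these jobs
    are distinct because they lie in disjoint intervals. The successor accounts for the single empty
    region. *)
Lemma regs_size Y t : validX um Y -> (size Y <= n)%N -> (0 < th)%N ->
  regs_inv Y M th t -> (size (inorder t) <= n.+1)%N.
Proof.
move=> vY sY th0 [rs [[w s ei sg] [gd big]]]; rewrite ei size_map.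
case: (leqP (size rs) 1) => h; first by clear -h; lia.
have {}big := big h.
suff hh : forall a (rs' : seq region), seg a rs' None -> {subset rs' <= rs} ->
    exists Z, [/\ uniq Z, {subset Z <= Y}, size Z = size rs' &
      forall i, i \in Z -> (a <= ist i)%R].
  have [Z [uZ sZ <- _]] := hh _ rs sg (fun _ h => h).
  by apply: leq_trans (uniq_leq_size uZ sZ) _; exact: leqW.
have [_ pos _] := vY.
move=> a rs'; elim: rs' a => [|r rs' IH] a.
  by move=> _ _; exists [::].
move=> [ra ltr tl] sub; have hr : r \in rs by apply: sub; rewrite mem_head.
have [_ [_ mr _] _ _] := gd r hr.
have [p hp] : exists p, p \in slist r.2.
  have := big r hr; case: (slist r.2) => [|p l] /=; first by clear -th0; lia.
  by exists p; rewrite mem_head.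
have [pY /andP[pa pb] _] := mr p hp; rewrite ra in pa.
case er : r.1.2 tl pb ltr => [y|] tl pb ltr; last first.
  exists [:: p.1]; case: tl => -> _; split=> // i; rewrite inE => /eqP -> //.
have [Z [uZ sZ eZ hZ]] := IH y tl (fun z hz => sub z ltac:(by rewrite inE hz orbT)).
exists (p.1 :: Z); split.
- rewrite /= uZ andbT; apply/negP => /hZ yp.
  by have := pos _ pY; rewrite ltNge (le_trans pb yp).
- by move=> i; rewrite inE => /orP[/eqP -> //|/sZ].
- by rewrite /= eZ.
- move=> i; rewrite inE => /orP[/eqP -> //|/hZ]; apply: le_trans; exact: ltW.
Qed.

Lemma touch_cost_le Y t it : validX um Y -> (size Y <= n)%N ->
  (um <= th)%N ->
  (forall i, i != it -> (i \in X) = (i \in Y)) ->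
  (forall i, i \in Y -> iid i = iid it -> i = it) ->
  (0 <= ist it < ifin it)%R ->
  regs_inv Y M th t ->
  (touch_cost (drv_of M th) cs t it <= 4900 * (th * (K * dlog n.+4)))%N.
Proof.
move=> vY sY uth eX idX hit hI; rewrite /touch_cost.
have th0 : (0 < th)%N by apply: leq_trans mth.
have st := regs_size vY sY th0 hI.
have hI' := hI; move: hI' => [rs [[w s ei sg] [gd _]]].
have gdin e : e \in inorder t -> (size (inorder e.2.2.2) <= 36 * th)%N.
  rewrite ei => /mapP[r hr ->]; have [_ okr opr _] := gd r hr.
  rewrite size_inorder_slist; have [h _] := okL_size vY okr.
  exact: leq_trans h (opr _ okr).
have dW : (W <= th * (K * dlog n.+4))%N.
  by rewrite leq_mul2l leq_mul2l leq_dlog ?orbT //; clear; lia.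
set V := (th * (K * dlog n.+4))%N in dW *.
have dV : (dlog n.+4 <= V)%N.
  by rewrite /V mulnA leq_pmull // muln_gt0 th0 K0.
have tV := leq_trans th_le_W dW.
clearbody V.
have dt (t' : tree R region) : wft t' -> (size (inorder t') <= n.+4)%N ->
    (dep t' <= V)%N.
  by move=> w' s'; apply: leq_trans (dep_dlog w') (leq_trans (leq_dlog s') dV).
have st4 : (size (inorder t) <= n.+4)%N by apply: leq_trans st _; clear; lia.
have dt0 : (dep t <= V)%N by exact: dt.
have [r [-> gr] hm] := touch_cases M0 vY vX mum mth uth eX idX hit hI.
rewrite [(relt r).2.2]/=; case: (leb _ _) hm => hm; last first.
  by rewrite addn0; apply: leq_trans dt0 _; rewrite leq_pmull.
rewrite /touch_reg_cost.
have [_ okr opr _] := gr.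
have [szr _] := okL_size vY okr; have {}szr := leq_trans szr (opr _ okr).
set old := filter _ _ in hm *.
have so : (size old <= 36 * th)%N by apply: leq_trans szr; rewrite size_filter count_size.
have [w1 _ _] := del_wft (r.1.1, 0%N) w.
have s1 := srt_del (r.1.1, 0%N) w s.
have z1 := size_del (r.1.1, 0%N) w s.
have mc : (mrg_cost (del (r.1.1, 0%N) t) r.1 old <= 80 * V)%N.
  have d1 : (dep (del (r.1.1, 0%N) t) <= V)%N by apply: dt => //; exact: leq_trans z1 st4.
  rewrite /mrg_cost; set y := (match r.1.2 with Some z => z | None => r.1.1 end).
  have := qpred_spec y s1; case: (qpred y _) => [e|] => [[he _ _]|_]; last first.
    by rewrite addn0; apply: leq_trans (leq_add d1 so) _; move: tV; clear; lia.
  have : e \in inorder t by move: he; rewrite inorder_del // mem_filter => /andP[].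
  move/gdin => h; apply: leq_trans (leq_add (leq_add d1 so) h) _.
  by move: tV; clear; lia.
set m := mrg_small _ _ _ _ in hm *.
have zm : (size (inorder m.2) <= size (inorder t))%N.
  rewrite /m /mrg_small /mrg; case: ifP => _ //; case: (qpred _ _) => [e|] //=.
  exact: leq_trans (size_del _ w1 s1) z1.
have [rs1 [rs2 [[wm _ _ _ [abm _]] [_ okm opm _]]]] := hm.
have pc := process_cost_le (ltb_leb abm) okm opm.
have uc : (putregs_cost (process (drv_of M th) cs m.1.1.1 m.1.1.2 m.1.2) m.2
            <= 4 * V)%N.
  have z2 := size_process m.1.1.1 m.1.1.2 m.1.2.
  (* At most [n.+1] regions remain and at most two are put back. *)
  apply: leq_trans (putregs_cost_le (k := n.+4) wm _) _.
    by apply: leq_trans (leq_add (leq_trans zm st) z2) _; clear; lia.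
  apply: leq_trans (leq_mul (leqnn _) z2) _.
  by move: dV (dlog_gt0 n.+4); clear; lia.
rewrite /rebuild_cost size_inorder_slist.
apply: leq_trans (leq_add dt0 (leq_add (leq_add (leq_add dt0 szr) mc)
  (leq_add pc uc))) _.
by move: dW tV; move: (th * (K * dlog n))%N; clear; lia.
Qed.

End Bounds.

End Costs.

(** * From the regions to the whole time line *)

Section Global.
Variable R : realType.
Local Notation item := ((R * R) * (nat * nat))%type.
Local Notation sol := (seq (item * nat)).
Local Notation region := ((R * option R) * tree R (item * nat))%type.
Implicit Types (X : seq item) (L O : sol) (r : region) (rs : seq region)
  (a x : R) (b : option R).

Definition allsol rs : sol := flatten [seq slist r.2 | r <- rs].

Lemma isum_subset (Z1 Z2 : seq item) : uniq Z1 -> {subset Z1 <= Z2} ->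
  (isum Z1 <= isum Z2)%N.
Proof.
move=> un sub; rewrite -(usum_tag 0 Z1) -(usum_tag 0 Z2); apply: usum_subset.
  by rewrite map_inj_uniq // => u v [].
by move=> _ /mapP[i hi ->]; apply: map_f; exact: sub.
Qed.

Lemma seg_okL um X M a rs : validX um X -> seg a rs None ->
  (forall r, r \in rs -> okL X r.1.1 r.1.2 M (slist r.2)) ->
  okL X a None M (allsol rs).
Proof.
move=> [_ pos _]; rewrite /allsol; elim: rs a => [|r rs IH] a //= [ra ltr tl] h.
have okr := h r (mem_head _ _); rewrite ra in okr.
have wide : okL X a None M (slist r.2).
  by apply: okL_sub okr _ => p _ pX /andP[pa _]; rewrite /inR pa.
case er : r.1.2 tl okr ltr => [x|] tl okr ltr; last first.
  by case: tl => -> _; rewrite cats0.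
have tok := IH x tl (fun r' hr' => h r' ltac:(by rewrite inE hr' orbT)).
apply: okL_cat wide _ _.
  apply: okL_sub tok _ => p _ pX /andP[pa _]; rewrite /inR andbT; split=> //.
  by apply: le_trans pa; exact: ltW.
move=> p q hp hq; have [_ /(_ p hp) [pX /andP[_ p1] _] _] := okr.
have [_ /(_ q hq) [qX /andP[q1 _] _] _] := tok.
split; last by move=> _; exact: ovl_sep p1 q1.
by apply/eqP => e0; have := pos _ pX; rewrite ltNge {2}e0 (le_trans p1 q1).
Qed.

Lemma usum_allsol rs : usum (allsol rs) = (\sum_(r <- rs) usum (slist r.2))%N.
Proof.
rewrite /allsol; elim: rs => [|r rs IH]; first by rewrite big_nil.
by rewrite /= usum_cat IH big_cons.
Qed.

(** Apart from the jobs across the [(size rs).-1] inner boundaries, [O] decomposes into solutions of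
    the regions, each of which is covered by its [region_ratio]. *)
Lemma seg_opt um X M a rs O : validX um X -> seg a rs None ->
  (forall r, r \in rs -> region_ratio X r.1.1 r.1.2 M (usum (slist r.2))) ->
  okL X a None M O ->
  ((M ^ M - M.-1 ^ M) * usum O <=
   M ^ M * usum (allsol rs) + (M ^ M - M.-1 ^ M) * ((size rs).-1 * (M * um)))%N.
Proof.
move=> vX; rewrite usum_allsol.
elim: rs a O => [|r rs IH] a O //= [ra ltr tl] h okO.
have hr := h r (mem_head _ _); rewrite ra in hr.
rewrite big_cons.
case er : r.1.2 tl hr ltr => [x|] tl hr ltr; last first.
  case: tl => -> _; rewrite big_nil addn0 mul0n muln0 addn0; exact: hr.
have rs0 : (0 < size rs)%N by case: (rs) tl.
have hrs := IH x _ tl (fun r' hr' => h r' ltac:(by rewrite inE hr' orbT)).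
rewrite (usum_filterC (fun p => (ifin p.1 <= x)%R) O).
rewrite (usum_filterC (fun p => (x <= ist p.1)%R) (filter (predC _) _)) addnA.
have o1 : okL X a (Some x) M [seq p <- O | (ifin p.1 <= x)%R].
  by apply: okL_filter okO _ => p _ px pX /andP[pa _]; rewrite /inR pa.
set O2 := [seq p <- [seq p <- O | _] | (x <= ist p.1)%R].
have o2 : okL X x None M O2.
  rewrite /O2 -filter_predI; apply: okL_filter okO _.
  by move=> p _ /andP[px _] pX /andP[_ pb]; rewrite /inR px.
set O3 := [seq p <- [seq p <- O | _] | predC _ p].
have o3 : (usum O3 <= M * um)%N.
  rewrite /O3 -filter_predI; apply: (cross_le (x := x) vX (a := a) (b := None)).
    by apply: okL_filter okO _.
  by move=> p; rewrite mem_filter /= -!ltNge => /andP[/andP[-> /ltW ->]].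
have h1 := hr _ o1; have h2 := hrs _ o2.
rewrite !mulnDr.
move: h1 h2; move: (M ^ M)%N (M ^ M - _)%N (usum O2) (usum (filter _ O)) => B A u2 u1.
move: (\sum_(_ <- _) _)%N (usum (slist r.2)) => S s h1 h2.
have h3 : (A * usum O3 <= A * (M * um))%N by rewrite leq_mul2l o3 orbT.
case: (size rs) rs0 h2 => // k _ /=; rewrite [(k.+1 * _)%N]mulSn mulnDr.
by move: h1 h3; clear; lia.
Qed.

(** The loss at the boundaries is at most a [Q]-th of the solution found, which turns the additive
    error of [seg_opt] into the factor [(Q + 1) / Q]. *)
Lemma global_ratio um X M th Q t O : (0 < M)%N -> validX um X ->
  th = (M * (Q * um))%N -> regs_inv X M th t -> okL X 0%R None M O ->
  exists rs, [/\ inorder t = map (@relt R) rs, seg 0%R rs None,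
    (forall r, r \in rs -> good X M th r), okL X 0%R None M (allsol rs) &
    ((M ^ M - M.-1 ^ M) * usum O * Q <= M ^ M * usum (allsol rs) * Q.+1)%N].
Proof.
move=> M0 vX eth [rs [[w s ei sg] [gd big]]] okO; exists rs; split=> //.
  by apply: seg_okL vX sg _ => r /gd [].
have := seg_opt vX sg (fun r hr => let: And4 _ _ _ h := gd r hr in h) okO.
have Ale : (M ^ M - M.-1 ^ M <= M ^ M)%N by rewrite leq_subr.
(* [Q] times the loss at one boundary is exactly [th], and there are fewer boundaries than regions;
   a single region has no inner boundary. *)
have few : ((size rs).-1 * (M * um) * Q <= usum (allsol rs))%N.
  case: (leqP (size rs) 1) => h; first by case: (size rs) h => [|[]].
  have {}big := big h; rewrite usum_allsol.
  apply: (@leq_trans (size rs * th)%N).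
    by rewrite eth -mulnA; apply: leq_mul; [exact: leq_pred | rewrite -mulnA mulnC; lia].
  clear -big; elim: rs big => [|r rs IH] big; first by rewrite big_nil.
  rewrite big_cons /= mulSn; apply: leq_add; first by apply: big; rewrite mem_head.
  by apply: IH => r' hr'; apply: big; rewrite inE hr' orbT.
move: (M ^ M)%N (M ^ M - _)%N (usum O) (usum (allsol rs)) Ale few => B A o G AB few h.
have h1 := leq_mul h (leqnn Q); rewrite mulnDl in h1; apply: leq_trans h1 _.
rewrite mulnS addnC; apply: leq_add => //.
by rewrite -mulnA; apply: leq_mul.
Qed.

(** A region whose solution contains [i] contains the start of [i]. As regions are disjoint, it is
    the one that the search by start returns, so looking into one tree decides whether [i] is
    scheduled. *)
Lemma query_answer um X M th t rs (p : nat * (R * R)) cs (j : nat * (R * (R * R))) i :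
  validX um X -> wft t -> srt t -> inorder t = map (@relt R) rs ->
  seg 0%R rs None -> (forall r, r \in rs -> good X M th r) ->
  i \in X -> ist i = j.2.1 -> ifin i = (j.2.1 + j.2.2.1)%R -> iid i = j.1 ->
  (0 <= ist i)%R ->
  (forall m, (i, m) \in allsol rs -> run_query (j, (p, (cs, t))) = m) /\
  (run_query (j, (p, (cs, t))) != 0%N ->
   (i, run_query (j, (p, (cs, t)))) \in allsol rs).
Proof.
move=> vX w s ei sg gd iX e1 e2 e3 i0; rewrite /run_query /= -e1.
have [inj pos _] := vX.
have := qpred_spec (ist i) s; case: (qpred _ t) => [e|]; last first.
  case: rs sg ei {gd} => // r rs [r0 _ _] ei /(_ (relt r)).
  by rewrite ei mem_head /= r0 => /(_ isT i0).
rewrite ei => -[/mapP[r hr ->] /= rit rmax].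
have [[wr sr fr] okr _ _] := gd r hr.
have lk m : (i, m) \in slist r.2 -> look ((j.2.1 + j.2.2.1)%R, j.1) r.2 = Some (i, m).
  move=> /mapP[z hz ez]; have := look_mem sr hz.
  by rewrite (fr z hz) -ez /= e2 e3.
rewrite e1; split.
  move=> m /flattenP[l /mapP[r' hr' ->] him].
  have [[_ _ _] okr' _ _] := gd r' hr'.
  have [_ /(_ _ him) [_ /andP[r1 r2] _] _] := okr'.
  suff er : r' = r by rewrite er in him; rewrite (lk m him).
  have le1 := rmax (relt r'); rewrite map_f //= in le1.
  have {}le1 := le1 isT r1.
  apply/eqP; apply/negPn/negP => ne.
  have [rs1 [rs2 ers]] : exists rs1 rs2, rs = rs1 ++ r :: rs2.
    by case/splitPr: hr => p1 p2; exists p1, p2.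
  have sg0 : seg 0%R (rs1 ++ r :: rs2) None by rewrite -ers.
  have [c sg1 sg2] := seg_cat sg0 isT; have [ec _ _] := sg2.
  move: hr'; rewrite ers mem_cat inE (negbTE ne) /= => /orP[h1|h1].
    have [_ _] := seg_bounds sg1 h1; move: r2; rewrite /leb.
    case: (r'.1.2) => // y r2 yc; rewrite -ec in yc.
    have := lt_le_trans (pos _ iX) (le_trans r2 (le_trans yc rit)).
    by rewrite ltxx.
  have := seg_sorted sg2 => /= /andP[/allP /(_ r' h1) lt _].
  by rewrite leNgt lt in le1.
case el : (look _ r.2) => [y|] //= _.
apply/flattenP; exists (slist r.2); first exact: (map_f (fun r : region => slist r.2)).
have [hin|hno] := pselect (exists m, (i, m) \in slist r.2).
  by case: hin => m hm; move: (lk m hm); rewrite el => -[->].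
move: el; rewrite look_none // => z hz; rewrite (fr z hz) /=.
apply/eqP => -[z1 z2]; apply: hno.
have hz' : z.2.2 \in slist r.2 by apply: (map_f (fun e => e.2.2)).
have [_ /(_ _ hz') [zX _ _] _] := okr.
have ez : z.2.2.1 = i by apply: inj => //; rewrite z2 e3.
by exists z.2.2.2; rewrite -ez -surjective_pairing.
Qed.

End Global.

(** * The derived parameters in terms of [w], [eps] and [n] *)

Section Params.
Variables (R : realType) (M : nat) (w eps : R).
Hypotheses (M0 : (0 < M)%N) (w1 : (1 <= w)%R) (eps0 : (0 < eps)%R).

Definition par_q : nat := qof (R := R) (M, (w, eps)).
Local Notation Q := par_q.+1.
Definition par_um : nat := umax (R := R) (M, (w, eps)) par_q.
Definition par_th : nat := (M * (Q * par_um))%N.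
Definition par_K : nat := (glog (gbase R par_q) w).+1.
(** All weights to which rewards between 1 and [w] are rounded. Its length [par_K] bounds the number
    of classes. *)
Definition par_U : seq nat :=
  [seq Num.truncn (gbase R par_q ^+ k * Q%:R)%R | k <- iota 0 par_K].

Lemma cap1E : cap1 eps = Num.min eps 1%R.
Proof. by rewrite /cap1 /Num.min; case: (ltgtP eps 1%R) => // ->. Qed.

Lemma cap1_itv : (0 < cap1 eps <= 1)%R.
Proof.
have e0 := eps0.
by rewrite /cap1; case: (leP eps 1%R) => h; apply/andP; split; lra.
Qed.

Lemma Q_gt : (16%:R / cap1 eps < Q%:R :> R)%R.
Proof. exact: truncnS_gt. Qed.

(** [cap1 eps <= 1] absorbs the 1 that is added after truncation. *)
Lemma Q_le : (Q%:R <= 17%:R / cap1 eps :> R)%R.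
Proof.
have /andP[c0 c1] := cap1_itv.
have h0 : (0 <= 16%:R / cap1 eps :> R)%R by rewrite divr_ge0 // ltW.
have /andP[h _] := truncn_itv h0; rewrite -natr1 /par_q /qof /=.
have h2 : (1 <= 1 / cap1 eps)%R by rewrite ler_pdivlMr // mul1r.
have -> : (17%:R / cap1 eps = 16%:R / cap1 eps + 1 / cap1 eps :> R)%R.
  by rewrite -mulrDl natr1.
by apply: lerD.
Qed.

Lemma invQ_le : ((Q%:R)^-1 <= cap1 eps / 16%:R :> R)%R.
Proof.
have /andP[c0 c1] := cap1_itv; rewrite -[leLHS]mul1r ler_pdivrMr ?ltr0n //.
by have := Q_gt; rewrite ltr_pdivrMr // => /ltW h; lra.
Qed.

Lemma um_le : (par_um%:R <= w * Q%:R :> R)%R.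
Proof. by have h := w1; rewrite /par_um /umax /= truncn_le mulr_ge0 ?ler0n //; lra. Qed.

Lemma Q_le_um : (Q <= par_um)%N.
Proof.
have h := w1; rewrite /par_um /umax /= truncn_ge_nat; last by rewrite mulr_ge0 ?ler0n //; lra.
by rewrite ler_peMl ?ler0n.
Qed.

(** Each rounding loses a factor [1 + 1/Q]: the first by the choice of the base, the second because
    the weight is at least [Q], so that one unit is at most its [Q]-th part. *)
Lemma unitw_spec (r : R) : (1 <= r <= w)%R ->
  [/\ (Q <= unitw par_q r <= par_um)%N, unitw par_q r \in par_U,
      ((unitw par_q r)%:R / Q%:R <= r)%R &
      (r <= (unitw par_q r)%:R / Q%:R * (1 + Q%:R^-1) ^+ 2)%R].
Proof.
have hw := w1; move=> /andP[r1 rw]; have [g1 [gr rg]] := gfloor_itv par_q r1.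
set g := gfloor par_q r in g1 gr rg *.
have Q0 : (0 < Q%:R :> R)%R by rewrite ltr0n.
have gQ : (0 <= g * Q%:R)%R by rewrite mulr_ge0 ?ler0n //; lra.
have /andP[u1 u2] := truncn_itv gQ; rewrite -/(unitw par_q r) in u1 u2.
have uQ : (Q <= unitw par_q r)%N.
  by rewrite /unitw truncn_ge_nat // ler_peMl ?ler0n.
split.
- by rewrite uQ /=; apply: le_truncn; rewrite ler_pM2r //; exact: le_trans gr rw.
- apply/mapP; exists (glog (gbase R par_q) r) => //.
  rewrite mem_iota /= add0n /par_K ltnS; apply: le_truncn.
  rewrite ler_pM2r ?invr_gt0 ?ln_gt0 ?gbase_gt1 // ler_ln ?posrE //; lra.
- by apply: le_trans gr; rewrite ler_pdivrMr.
- apply: (@le_trans _ _ ((unitw par_q r).+1%:R / Q%:R * (1 + Q%:R^-1))%R).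
    apply: ltW; apply: lt_le_trans rg _; apply: ler_wpM2r.
      by rewrite addr_ge0 // invr_ge0 ler0n.
    by rewrite ler_pdivlMr // ltW.
  rewrite expr2 mulrA; apply: ler_wpM2r.
    by rewrite addr_ge0 // invr_ge0 ler0n.
  rewrite mulrAC; apply: ler_wpM2r; first by rewrite invr_ge0 ler0n.
  rewrite mulrDr mulr1 -natr1 lerD2l ler_pdivlMr // mul1r ler_nat.
  exact: uQ.
Qed.

Lemma size_par_U : size par_U = par_K.
Proof. by rewrite size_map size_iota. Qed.

Lemma par_U_le u : u \in par_U -> (u <= par_um)%N.
Proof.
move=> /mapP[k]; rewrite mem_iota /= add0n /par_K ltnS => hk ->.
apply: le_truncn; rewrite ler_pM2r ?ltr0n //.
have [_ [h _]] := gfloor_itv par_q w1; apply: le_trans h; rewrite /gfloor.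
by apply: ler_weXn2l => //; apply: ltW; exact: gbase_gt1.
Qed.

Lemma um_gt0 : (0 < par_um)%N.
Proof. by apply: leq_trans Q_le_um. Qed.

Lemma mum_th : (M * par_um <= par_th)%N.
Proof. by rewrite /par_th leq_mul2l leq_pmull ?orbT. Qed.

Lemma um_th : (par_um <= par_th)%N.
Proof. by apply: leq_trans mum_th; rewrite leq_pmull. Qed.

Lemma M_th : (M <= par_th)%N.
Proof. by apply: leq_trans mum_th; rewrite leq_pmulr // um_gt0. Qed.

Lemma ln2_ge : (1 / 2 <= ln 2 :> R)%R.
Proof.
have h : (ln (1 + - (1 / 2)) <= - (1 / 2) :> R)%R by apply: le_ln1Dx; lra.
have e : (1 + - (1 / 2) = 2^-1 :> R)%R by lra.
rewrite e lnV ?posrE // in h; lra.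
Qed.

(** There are about [ln w / ln (1 + 1/Q)] powers, and [ln (1 + 1/Q) >= 1 / (Q + 1) >= 1 / (2 Q)];
    this follows from [ln (1 + x) <= x] applied to the inverse of the base. *)
Lemma par_K_le : (par_K%:R <= 4%:R * Q%:R * ln (w + 1) :> R)%R.
Proof.
have hw := w1; have lw : (ln 2 <= ln (w + 1) :> R)%R by rewrite ler_ln ?posrE //; lra.
have l2 := ln2_ge.
have Q1 : (1 <= Q%:R :> R)%R by rewrite ler1n.
have g1 := gbase_gt1 R par_q; have lg : (0 < ln (gbase R par_q))%R by apply: ln_gt0.
have lww : (ln w <= ln (w + 1))%R by rewrite ler_ln ?posrE //; lra.
have h0 : (0 <= ln w / ln (gbase R par_q))%R by rewrite divr_ge0 ?ln_ge0 // ltW.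
have /andP[h _] := truncn_itv h0.
rewrite /par_K -natr1 /glog.
have lgQ : ((2%:R * Q%:R)^-1 <= ln (gbase R par_q))%R.
  have gi : (0 < (gbase R par_q)^-1)%R by rewrite invr_gt0; lra.
  have : (ln (1 + ((gbase R par_q)^-1 - 1)) <= (gbase R par_q)^-1 - 1)%R.
    by apply: le_ln1Dx; lra.
  rewrite addrCA subrr addr0 lnV ?posrE; last by lra.
  have e : (((gbase R par_q)^-1 - 1) = - (Q%:R + 1)^-1)%R.
    rewrite /gbase; field; lra.
  rewrite e lerN2; apply: le_trans; rewrite lef_pV2 ?posrE; lra.
apply: (@le_trans _ _ (2%:R * Q%:R * ln (w + 1) + 2%:R * ln (w + 1))%R).
  apply: lerD; last by lra.
  apply: le_trans h _; rewrite ler_pdivrMr //.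
  apply: (@le_trans _ _ (ln (w + 1))); first exact: lww.
  rewrite mulrAC -[leLHS]mul1r; apply: ler_wpM2r; first by lra.
  have Q2 : (0 < 2%:R * Q%:R :> R)%R by lra.
  by have := ler_wpM2l (ltW Q2) lgQ; rewrite divff // gt_eqF.
have : (2%:R * ln (w + 1) <= 2%:R * Q%:R * ln (w + 1) :> R)%R.
  by apply: ler_wpM2r; lra.
lra.
Qed.

(** By [n + 6 <= (n + 2)^3] and [ln 2 >= 1/2], the doubled binary logarithm contributes 12 and the
    added 1 contributes 2. *)
Lemma dlog_le n : ((dlog (n + 5))%:R <= 14%:R * ln (n%:R + 2) :> R)%R.
Proof.
clear M0 w1 eps0.
have l2 := ln2_ge.
have n0 : (0 <= n%:R :> R)%R by rewrite ler0n.
have ln2n : (ln 2 <= ln (n%:R + 2) :> R)%R by rewrite ler_ln ?posrE //; lra.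
rewrite /dlog -natr1 -muln2 natrM.
set k := trunc_log 2 _.
have hk : (2 ^ k <= n + 6)%N.
  by apply: leq_trans (trunc_logP (p := 2) isT _) _ => //; lia.
have h1 : (k%:R * ln 2 <= 3%:R * ln (n%:R + 2) :> R)%R.
  have -> : (k%:R * ln 2 = ln (2 ^+ k) :> R)%R by rewrite lnXn // mulr_natl.
  have -> : (3%:R * ln (n%:R + 2) = ln ((n%:R + 2) ^+ 3) :> R)%R.
    by rewrite lnXn ?mulr_natl //; lra.
  rewrite ler_ln ?posrE ?exprn_gt0 //; last by lra.
  apply: (@le_trans _ _ (n%:R + 6%:R)%R).
    by rewrite -natrX -natrD ler_nat.
  rewrite exprS expr2; nra.
have k0 : (0 <= k%:R :> R)%R by rewrite ler0n.
nra.
Qed.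

End Params.

(** * From functions to programs *)

Section Programs.
Variable R : realType.
Implicit Types s : state R.
Local Notation item := ((R * R) * (nat * nat))%type.
Local Notation classes := (seq (nat * tree R item)).
Local Notation region := ((R * option R) * tree R (item * nat))%type.
Local Notation global := (classes * tree R region)%type.
Local Notation prm := (nat * (R * R))%type.
Local Notation rawjob := (nat * (R * (R * R)))%type.

(** For the steps that overwrite input cells or cell 3, which [keeps] excludes. *)
Lemma rep_mono s s' p v : (zmem s 2 <= zmem s' 2)%N ->
  (forall p, (15 < p < zmem s 2)%N ->
     zmem s' p = zmem s p /\ rmem s' p = rmem s p) ->
  rep s p v -> rep s' p v.
Proof.
move=> H1 H2; elim: v p => [n|r|a IHa b IHb] p /= [[h1 h2] h3];
  have [e1 e2] := H2 p ltac:(lia); (split; first by split; lia).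
- by rewrite e1.
- by rewrite e2.
- have [e3 _] := H2 p.+1 ltac:(lia).
  by rewrite e1 e3; case: h3 => ? ?; split; [exact: IHa | exact: IHb].
Qed.

Definition join_saved : cmd :=
  Seq (block (ZConst 8 0) [:: ZOp ZAdd 6 4 8; ZOp ZAdd 7 10 8]) cons_cell.

Lemma join_savedP s u v : rep s (zmem s 4) u -> rep s (zmem s 10) v ->
  exists s', [/\ exec join_saved s s' 11, extends s s' &
    rep s' (zmem s' 4) (VP u v)].
Proof.
move=> hu hv; have hs := rep_heap hu.
set s1 := foldl (fun s i => eval_instr i s) s
  [:: ZConst 8 0; ZOp ZAdd 6 4 8; ZOp ZAdd 7 10 8].
have k1 : extends s s1 by split; [keeps_solve | upds].
have [||s2 [x1 x2 x3]] := @cons_rep R s1 u v ltac:(by []).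
- by apply: (rep_extends k1); upds; rewrite addn0.
- by apply: (rep_extends k1); upds; rewrite addn0.
exists s2; split=> //; last exact: extends_trans k1 x2.
by apply: (ExecSeq (t1 := 3) (t2 := 8) _ x1); exact: exec_block.
Qed.

Definition load_nat (a : nat) : cmd :=
  Seq (block (ZConst 8 0) [:: ZOp ZAdd 10 4 8; ZOp ZAdd 6 a 8])
    (Seq alloc_nat join_saved).

Lemma load_natP a s v : (a < 2)%N -> rep s (zmem s 4) v ->
  exists s', [/\ exec (load_nat a) s s' 19, extends s s' &
    rep s' (zmem s' 4) (VP (VN R (zmem s a)) v)].
Proof.
move=> ha hv; have hs := rep_heap hv.
set s1 := foldl (fun s i => eval_instr i s) s
  [:: ZConst 8 0; ZOp ZAdd 10 4 8; ZOp ZAdd 6 a 8].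
have k1 : extends s s1 by split; [keeps_solve | upds].
have e6 : zmem s1 6 = zmem s a by upds; rewrite addn0.
have e10 : zmem s1 10 = zmem s 4 by upds; rewrite addn0.
have hs1 : (15 < zmem s1 2)%N by [].
(* [alloc_natP] says nothing about cell 10, which holds the saved pointer. The final state is
   written out and identified with the one provided there by determinism. *)
set s2 := foldl (fun s i => eval_instr i s) s1
  [:: ZStore 2 6; ZConst 8 0; ZOp ZAdd 4 2 8; ZConst 8 2; ZOp ZAdd 2 2 8].
have x1 : exec alloc_nat s1 s2 5 by exact: exec_block.
have [s2' [x1' x2 x3]] := alloc_natP hs1.
have [e _] := exec_det x1' x1; subst s2'.
have e10' : zmem s2 10 = zmem s1 10 by move: hs1; clearbody s1 => hs1; rewrite /s2; upds.
have [||s3 [y1 y2 y3]] := @join_savedP s2 (VN R (zmem s1 6)) v.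
- exact: x3.
- by rewrite e10' e10; apply: (rep_extends x2); apply: (rep_extends k1).
exists s3; split.
- apply: (ExecSeq (t1 := 3) (t2 := 16)); first exact: exec_block.
  exact: (ExecSeq (t1 := 5) (t2 := 11) x1 y1).
- exact: extends_trans k1 (extends_trans x2 y2).
- by rewrite -e6.
Qed.

(** The value is moved by adding 0, as no instruction copies one fixed real cell to another
    directly. *)
Definition load_real (a : nat) : cmd :=
  Seq (block (ZConst 8 0) [:: ZOp ZAdd 10 4 8; ROfNat 6 8; ROp RAdd 5 a 6])
    (Seq alloc_real join_saved).

Lemma load_realP a s v : (a < 5)%N -> rep s (zmem s 4) v ->
  exists s', [/\ exec (load_real a) s s' 20, extends s s' &
    rep s' (zmem s' 4) (VP (VR (rmem s a)) v)].
Proof.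
move=> ha hv; have hs := rep_heap hv.
set s1 := foldl (fun s i => eval_instr i s) s
  [:: ZConst 8 0; ZOp ZAdd 10 4 8; ROfNat 6 8; ROp RAdd 5 a 6].
have k1 : extends s s1 by split; [keeps_solve | upds].
have e6 : rmem s1 5 = rmem s a by upds; rewrite addr0.
have e10 : zmem s1 10 = zmem s 4 by upds; rewrite addn0.
have hs1 : (15 < zmem s1 2)%N by [].
set s2 := foldl (fun s i => eval_instr i s) s1
  [:: RStore 2 5; ZConst 8 0; ZOp ZAdd 4 2 8; ZConst 8 2; ZOp ZAdd 2 2 8].
have x1 : exec alloc_real s1 s2 5 by exact: exec_block.
have [s2' [x1' x2 x3]] := alloc_realP hs1.
have [e _] := exec_det x1' x1; subst s2'.
have e10' : zmem s2 10 = zmem s1 10 by [].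
have [||s3 [y1 y2 y3]] := @join_savedP s2 (VR (rmem s1 5)) v.
- exact: x3.
- by rewrite e10' e10; apply: (rep_extends x2); apply: (rep_extends k1).
exists s3; split.
- apply: (ExecSeq (t1 := 4) (t2 := 16)); first exact: exec_block.
  exact: (ExecSeq (t1 := 5) (t2 := 11) x1 y1).
- exact: extends_trans k1 (extends_trans x2 y2).
- by rewrite -e6.
Qed.

Local Notation flat :=
  (nat * (R * (R * (R * (nat * (R * (R * global)))))))%type.

Definition flat_of s (g : global) : flat :=
  (zmem s 0, (rmem s 0, (rmem s 1, (rmem s 2,
    (zmem s 1, (rmem s 3, (rmem s 4, g))))))).

(** Loading conses one cell at a time and yields a right-nested tuple, which is regrouped here into
    job, parameters and structure. *)
Definition unflat (f : flat) : rawjob * (prm * global) :=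
  ((f.1, (f.2.1, (f.2.2.1, f.2.2.2.1))),
   ((f.2.2.2.2.1, (f.2.2.2.2.2.1, f.2.2.2.2.2.2.1)), f.2.2.2.2.2.2.2)).

Definition load_all : cmd :=
  Seq (block (ZConst 8 0) [:: ZOp ZAdd 4 3 8])
  (Seq (load_real 4) (Seq (load_real 3) (Seq (load_nat 1) (Seq (load_real 2)
  (Seq (load_real 1) (Seq (load_real 0) (load_nat 0))))))).

Lemma load_allP s g : rep s (zmem s 3) (enc g) ->
  exists s', [/\ exec load_all s s' 140, extends s s' &
    rep s' (zmem s' 4) (enc (flat_of s g))].
Proof.
move=> hg; have hs := rep_heap hg.
set s0 := foldl (fun s i => eval_instr i s) s [:: ZConst 8 0; ZOp ZAdd 4 3 8].
have k0 : extends s s0 by split; [keeps_solve | upds].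
have r0 : rep s0 (zmem s0 4) (enc g).
  by apply: (rep_extends k0); upds; rewrite addn0.
have [s1 [e1 k1 r1]] := load_realP (a := 4) isT r0.
have [s2 [e2 k2 r2]] := load_realP (a := 3) isT r1.
have [s3 [e3 k3 r3]] := load_natP (a := 1) isT r2.
have [s4 [e4 k4 r4]] := load_realP (a := 2) isT r3.
have [s5 [e5 k5 r5]] := load_realP (a := 1) isT r4.
have [s6 [e6 k6 r6]] := load_realP (a := 0) isT r5.
have [s7 [e7 k7 r7]] := load_natP (a := 0) isT r6.
have K1 := extends_trans k0 k1; have K2 := extends_trans K1 k2.
have K3 := extends_trans K2 k3; have K4 := extends_trans K3 k4.
have K5 := extends_trans K4 k5; have K6 := extends_trans K5 k6.
exists s7; split.
- apply: (ExecSeq (t1 := 2) (t2 := 138)); first exact: exec_block.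
  apply: (ExecSeq (t1 := 20) (t2 := 118) e1).
  apply: (ExecSeq (t1 := 20) (t2 := 98) e2).
  apply: (ExecSeq (t1 := 19) (t2 := 79) e3).
  apply: (ExecSeq (t1 := 20) (t2 := 59) e4).
  apply: (ExecSeq (t1 := 20) (t2 := 39) e5).
  exact: (ExecSeq (t1 := 20) (t2 := 19) e6 e7).
- exact: extends_trans K6 k7.
- have rz t a : extends s t -> (a < 5)%N -> rmem t a = rmem s a.
    by case=> -[_ _ _ h] _; exact: h.
  have z0 t : extends s t -> zmem t 0 = zmem s 0 by case=> -[_ _ []].
  have z1 t : extends s t -> zmem t 1 = zmem s 1 by case=> -[_ _ []].
  move: r7; rewrite (z0 _ K6) (rz _ 0%N K5) // (rz _ 1%N K4) // (rz _ 2 K3) //.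
  by rewrite (z1 _ K2) (rz _ 3 K1) // (rz _ 4 k0).
Qed.

Definition keep_result : cmd := block (ZConst 8 0) [:: ZOp ZAdd 3 4 8].

Lemma keep_resultP s v : rep s (zmem s 4) v ->
  exists s', [/\ exec keep_result s s' 2, rep s' (zmem s' 3) v,
    zmem s' 0 = zmem s 0, zmem s' 1 = zmem s 1 & rmem s' = rmem s].
Proof.
move=> h; have hs := rep_heap h.
exists (foldl (fun s i => eval_instr i s) s [:: ZConst 8 0; ZOp ZAdd 3 4 8]).
split=> //; first exact: exec_block.
set s' := foldl _ _ _.
have -> : zmem s' 3 = zmem s 4 by rewrite /s'; upds; rewrite addn0.
by apply: rep_mono h => // p hp; rewrite /s'; upds.
Qed.

(** A free pointer of 0 marks the memory before the first update; afterwards the pointer is at least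
    16. The number allocated first is the argument of type [unit] for [c0]. *)
Definition boot (c0 : cmd) : cmd :=
  Seq (Instr (ZConst 6 0))
    (If (ZLe 2 6)
       (Seq (Instr (ZConst 2 16)) (Seq alloc_nat (Seq c0 keep_result)))
       (Instr (ZConst 6 0))).

Definition update_prog (c0 c : cmd) : cmd :=
  Seq (boot c0) (Seq load_all (Seq c keep_result)).

(** There is no [boot]: a query concerns a current job, so an insertion has run before. *)
Definition query_prog (c : cmd) : cmd :=
  Seq load_all (Seq c (Instr (ZLoad 0 4))).

Definition live (p : prm) s (g : global) :=
  [/\ rep s (zmem s 3) (enc g), zmem s 1 = p.1, rmem s 3 = p.2.1 & rmem s 4 = p.2.2].

Definition fresh (p : prm) s :=
  [/\ zmem s 2 = 0%N, zmem s 1 = p.1, rmem s 3 = p.2.1 & rmem s 4 = p.2.2].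

Definition args s (j : rawjob) :=
  [/\ zmem s 0 = j.1, rmem s 0 = j.2.1, rmem s 1 = j.2.2.1 & rmem s 2 = j.2.2.2].

Lemma unflat_of s p g j : args s j -> live p s g ->
  unflat (flat_of s g) = (j, (p, g)).
Proof.
rewrite /unflat /flat_of => -[/= -> -> -> ->] [_ -> -> ->].
by case: j => [? [? [? ?]]]; case: p => [? [? ?]].
Qed.

Lemma boot_exists : exists c0 K0, forall s p j, args s j ->
  (forall g, live p s g -> exists s', [/\ exec (boot c0) s s' 3, args s' j &
     live p s' g]) /\
  (fresh p s -> exists s' t, [/\ exec (boot c0) s s' t, (t <= K0)%N, args s' j &
     live p s' (global0 R)]).
Proof.
have [c0 [K0 h0]] := comp_global0 R.
exists c0, (K0 + 10)%N => s p j ha; split.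
  move=> g [rg h1 h3 h4]; have hs := rep_heap rg.
  set s1 := eval_instr (ZConst 6 0) s.
  exists (eval_instr (ZConst 6 0) s1); split.
  - apply: (ExecSeq (t1 := 1) (t2 := 2)); first exact: ExecInstr.
    apply: ExecIfFalse; last exact: ExecInstr.
    by rewrite /= /upd /=; lia.
  - exact: ha.
  - split=> //; apply: rep_mono rg => //.
    by move=> q hq; upds.
move=> [h2 h1 h3 h4].
set s1 := eval_instr (ZConst 6 0) s; set s2 := eval_instr (ZConst 2 16) s1.
have [s3 [e3 k3 r3]] := @alloc_natP R s2 isT.
have r3' : rep s3 (zmem s3 4) (enc tt) by exact: r3.
have [s4 [t4 [e4 l4 k4 r4]]] := h0 s3 tt r3'.
have [s5 [e5 r5 z0 z1 rr]] := keep_resultP r4.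
have [[_ _ [y0 y1 _] yr] _] := extends_trans k3 k4.
exists s5, (1 + (1 + (5 + (t4 + 2))).+1)%N; split.
- apply: ExecSeq; first exact: ExecInstr.
  apply: ExecIfTrue; first by rewrite /= /upd /= h2.
  apply: ExecSeq; first exact: ExecInstr.
  by apply: ExecSeq e3 _; apply: ExecSeq e4 e5.
- by lia.
- have [a0 a1 a2 a3] := ha.
  by split; rewrite ?z0 ?rr ?y0 ?yr.
- by split=> //; rewrite ?z1 ?rr ?y1 ?yr.
Qed.

Lemma update_exists (F : rawjob * (prm * global) -> global) T :
  computes (R := R) F T -> forall c0 K0,
  (forall s p j, args s j ->
    (forall g, live p s g -> exists s', [/\ exec (boot c0) s s' 3, args s' j &
       live p s' g]) /\
    (fresh p s -> exists s' t, [/\ exec (boot c0) s s' t, (t <= K0)%N, args s' j &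
       live p s' (global0 R)])) ->
  exists c K, forall s p j g, args s j ->
    live p s g \/ (fresh p s /\ g = global0 R) ->
    exists s' t, [/\ exec (update_prog c0 c) s s' t,
      (t <= K * (T (j, (p, g))).+1)%N & live p s' (F (j, (p, g)))].
Proof.
move=> cF c0 K0 hboot.
have cu : computes (R := R) unflat (fun=> 0%N) by rewrite /unflat; c0.
have [c [K hc]] := comp_comp cF cu.
exists c, (K + K0 + 150)%N => s p j g ha hl.
have [s1 [t1 [e1 l1 a1 v1]]] : exists s' t, [/\ exec (boot c0) s s' t,
    (t <= K0 + 3)%N, args s' j & live p s' g].
  have [b1 b2] := hboot s p j ha; case: hl => [hl|[hf ->]].
    by have [s' [x1 x2 x3]] := b1 _ hl; exists s', 3%N; split=> //; lia.
  by have [s' [t [x1 x2 x3 x4]]] := b2 hf; exists s', t; split=> //; lia.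
have [rg h1 h3 h4] := v1.
have [s2 [e2 k2 r2]] := load_allP rg.
have [s3 [t3 [e3 l3 k3 r3]]] := hc s2 _ r2.
rewrite (unflat_of a1 v1) in r3 l3.
have [s4 [e4 r4 z0 z1 rr]] := keep_resultP r3.
have [[_ _ [y0 y1 _] yr] _] := extends_trans k2 k3.
exists s4, (t1 + (140 + (t3 + 2)))%N; split.
- by apply: ExecSeq e1 _; apply: ExecSeq e2 _; apply: ExecSeq e3 e4.
- by rewrite add0n in l3; nia.
- by split=> //; rewrite ?z1 ?rr ?y1 ?yr.
Qed.

Lemma query_exists (F : rawjob * (prm * global) -> nat) T :
  computes (R := R) F T ->
  exists c K, forall s p j g, args s j -> live p s g ->
    exists s' t, [/\ exec (query_prog c) s s' t,
      (t <= K * (T (j, (p, g))).+1)%N, live p s' g &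
      zmem s' 0 = F (j, (p, g))].
Proof.
move=> cF.
have cu : computes (R := R) unflat (fun=> 0%N) by rewrite /unflat; c0.
have [c [K hc]] := comp_comp cF cu.
exists c, (K + 150)%N => s p j g a1 v1.
have [rg h1 h3 h4] := v1.
have [s2 [e2 k2 r2]] := load_allP rg.
have [s3 [t3 [e3 l3 k3 r3]]] := hc s2 _ r2.
rewrite (unflat_of a1 v1) in r3 l3.
have k23 := extends_trans k2 k3.
have [[_ _ [y0 y1 y3] yr] _] := k23.
have hs3 := rep_heap r3.
exists (eval_instr (ZLoad 0 4) s3), (140 + (t3 + 1))%N; split.
- by apply: ExecSeq e2 _; apply: ExecSeq e3 _; exact: ExecInstr.
- by rewrite add0n in l3; nia.
- split.
  + rewrite (_ : zmem _ 3 = zmem s 3); last by upds.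
    have := rep_extends k23 rg; apply: rep_mono => // q hq.
    by upds.
  + by rewrite -h1 -y1; upds.
  + by rewrite -h3 -(yr 3).
  + by rewrite -h4 -(yr 4).
- by case: r3 => _; upds.
Qed.

Lemma live_input p s g (j : job R) : live p s g ->
  live p (with_input j s) g /\
  args (with_input j s) (jid j, (start j, (len j, reward j))).
Proof.
move=> [rg h1 h3 h4]; split; last by split.
have hs := rep_heap rg.
by split=> //; apply: rep_mono rg => // q hq; upds.
Qed.

Lemma fresh_input p s (j : job R) : fresh p s ->
  fresh p (with_input j s) /\
  args (with_input j s) (jid j, (start j, (len j, reward j))).
Proof. by move=> [h1 h2 h3 h4]; split. Qed.

End Programs.

(** * The invariant on sets of jobs and the cost of the operations *)

Section Invariant.
Variables (R : realType) (M : nat) (w eps : R).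
Hypotheses (M0 : (0 < M)%N) (w1 : (1 <= w)%R) (eps0 : (0 < eps)%R).
Local Open Scope fset_scope.
Local Notation item := ((R * R) * (nat * nat))%type.
Local Notation classes := (seq (nat * tree R item)).
Local Notation region := ((R * option R) * tree R (item * nat))%type.
Local Notation global := (classes * tree R region)%type.
Local Notation um := (par_um M w eps).
Local Notation th := (par_th M w eps).
Local Notation K := (par_K M w eps).
Local Notation Q := (par_q M w eps).+1.
Local Notation prms := (M, (w, eps)).
Implicit Types (J : {fset job R}) (j : job R) (g : global) (X : seq item).

Definition raw j : nat * (R * (R * R)) := (jid j, (start j, (len j, reward j))).

Definition itm j : item := item_of prms (raw j).

Definition items J : seq item := [seq itm j | j <- enum_fset J].

Definition jobs_ok J :=
  (forall j, j \in J -> valid_job w j) /\ {in J &, injective (@jid R)}.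

Definition ginv J g :=
  [/\ repcls (items J) g.1, {subset map fst g.1 <= par_U M w eps} &
      regs_inv (items J) M th g.2].

Lemma itm_unit j : valid_job w j ->
  [/\ (Q <= iu (itm j) <= um)%N, iu (itm j) \in par_U M w eps,
      ((iu (itm j))%:R / Q%:R <= reward j)%R &
      (reward j <= (iu (itm j))%:R / Q%:R * (1 + Q%:R^-1) ^+ 2)%R].
Proof. by move=> /and3P[_ _ r]; exact: (@unitw_spec R M w eps w1 _ r). Qed.

Lemma itm_itv j : valid_job w j -> (0 <= ist (itm j) < ifin (itm j))%R.
Proof.
move=> /and3P[h l _]; rewrite /ist /ifin /itm /item_of /=.
by apply/andP; split=> //; lra.
Qed.

Lemma items_valid J : jobs_ok J -> validX um (items J).
Proof.
move=> [vl inj]; split.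
- by move=> _ _ /mapP[j hj ->] /mapP[k hk ->] e; rewrite (inj j k hj hk e).
- by move=> _ /mapP[j /vl /itm_itv /andP[_ h] ->].
- move=> _ /mapP[j /vl /itm_unit [/andP[h1 h2] _ _ _] ->].
  by rewrite h2 andbT; exact: leq_trans h1.
Qed.

Lemma size_items J : size (items J) = #|` J|.
Proof. by rewrite size_map. Qed.

Lemma jobs_ok0 : jobs_ok fset0.
Proof. by split=> [j|j k]; rewrite in_fset0. Qed.

Lemma okL_nil (a : R) b L : okL [::] a b M L -> L = [::].
Proof. by case: L => // p L [_ /(_ p (mem_head _ _)) []]. Qed.

Lemma ginv0 : ginv fset0 (global0 R).
Proof.
have e : items fset0 = [::] by apply: size0nil; rewrite size_items cardfs0.
rewrite /ginv e; split=> //; exists [:: region0 R]; split=> //.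
split=> // r; rewrite inE => /eqP ->; split=> //.
- by move=> L /okL_nil ->.
- by move=> L /okL_nil ->; rewrite muln0.
Qed.

Lemma insertP J j : jobs_ok J -> insertable w J j ->
  [/\ jobs_ok (j |` J), items (j |` J) =i itm j :: items J &
      forall i, i \in items J -> iid i != iid (itm j)].
Proof.
move=> [vl inj] /andP[vj /forallP fr].
have {}fr i : i \in J -> jid i != jid j by move=> hi; exact: (fr [` hi]).
split.
- split=> [k|k l]; rewrite !in_fset1U; first by move=> /orP[/eqP -> //|/vl].
  move=> /orP[/eqP ->|hk] /orP[/eqP ->|hl] // e.
  + by have := fr l hl; rewrite e eqxx.
  + by have := fr k hk; rewrite e eqxx.
  + exact: inj.
- move=> i; rewrite inE; apply/mapP/orP.
    move=> [k hk ->]; move: (hk : k \in j |` J); rewrite in_fset1U.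
    by move=> /orP[/eqP ->|h]; [left | right; apply: map_f].
  move=> [/eqP ->|/mapP[k hk ->]].
    by exists j => //; exact: (fset1U1 j J).
  by exists k => //; have : k \in j |` J by rewrite in_fset1U hk orbT.
- by move=> _ /mapP[k hk ->]; exact: fr.
Qed.

Lemma deleteP J j : jobs_ok J -> j \in J ->
  jobs_ok (J `\ j) /\ items (J `\ j) =i [seq i <- items J | i != itm j].
Proof.
move=> [vl inj] hj; split.
  split=> [k|k l]; rewrite !in_fsetD1; first by move=> /andP[_ /vl].
  by move=> /andP[_ hk] /andP[_ hl]; exact: inj.
move=> i; rewrite mem_filter; apply/mapP/andP.
  move=> [k hk ->]; move: (hk : k \in J `\ j); rewrite in_fsetD1 => /andP[kj hk'].
  split; last exact: map_f.
  by apply: contra kj => /eqP e; apply/eqP/inj => //; have := congr1 (@iid R) e.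
move=> [ne /mapP[k hk e]]; exists k => //.
have : k \in J `\ j; last by [].
by rewrite in_fsetD1 hk andbT; apply: contra ne => /eqP <-; rewrite e.
Qed.

Lemma ginv_insert J j g : jobs_ok J -> insertable w J j -> ginv J g ->
  ginv (j |` J) (run_insert (raw j, (prms, g))).
Proof.
move=> ok hins [rp sub hI]; have [ok' eX fr] := insertP ok hins.
have /andP[vj _] := hins; have [/andP[u1 _] uU _ _] := itm_unit vj.
have rp' : repcls (items (j |` J)) (cls_ins (itm j) g.1).
  apply: eq_repcls (cls_ins_rep rp _ fr); first by move=> i; rewrite eX.
  exact: leq_trans u1.
split=> //=.
  have [un _ _ _] := rp; rewrite -/(itm j) cls_insE //.
  case: ifP => _; first by rewrite map_fst_upd.
  by move=> u; rewrite map_rcons mem_rcons inE => /orP[/eqP ->|/sub].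
apply: (@touch_inv R um (items J)) => //; try exact: items_valid.
- exact: mum_th.
- exact: M_th.
- exact: um_th.
- by move=> i /negbTE ne; rewrite eX inE ne.
- by move=> i /fr /eqP.
- exact: itm_itv.
Qed.

Lemma ginv_delete J j g : jobs_ok J -> j \in J -> ginv J g ->
  ginv (J `\ j) (run_delete (raw j, (prms, g))).
Proof.
move=> ok hj [rp sub hI]; have [ok' eX] := deleteP ok hj.
have vX := items_valid ok; have [inj _ _] := vX.
have ji : itm j \in items J by apply: map_f.
have rp' : repcls (items (J `\ j)) (cls_del (itm j) g.1).
  by apply: eq_repcls (cls_del_rep rp inj ji) => i; rewrite eX.
split=> //=.
  by have [un _ _ _] := rp; rewrite -/(itm j) cls_delE // map_fst_upd.
apply: (@touch_inv R um (items J)) => //; try exact: items_valid.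
- exact: mum_th.
- exact: M_th.
- exact: um_th.
- by move=> i ne; rewrite eX mem_filter ne.
- by move=> i hi; apply: inj.
- by apply: itm_itv; case: ok => vl _; exact: vl.
Qed.

Lemma repcls_cs_ok X cs n : repcls X cs ->
  {subset map fst cs <= par_U M w eps} -> (size X <= n)%N -> cs_ok K um n cs.
Proof.
move=> [un _ rp _] sub sz; split.
  by rewrite -(size_par_U M w eps) -(size_map fst cs); exact: uniq_leq_size.
move=> c hc; have [wc sc h] := rp c hc; split=> //.
  apply: leq_trans sz; rewrite -(size_map (fun e => e.2.2)).
  apply: uniq_leq_size.
    rewrite map_inj_in_uniq; first exact: srt_uniq.
    move=> e e'; rewrite !h => /and3P[_ _ /eqP ->] /and3P[_ _ /eqP ->] /= ee.
    by rewrite ee.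
  by move=> x /mapP[e he ->]; move: he; rewrite h => /and3P[].
by apply: (@par_U_le R M w eps w1); apply: sub; exact: map_f.
Qed.

Lemma param_cost J j g n : valid_job w j -> ginv J g -> (#|` J| <= n)%N ->
  (derive_cost prms + item_cost prms (raw j) + size g.1 + maxdep g.1 <=
   8 * (th * (K * dlog n)))%N.
Proof.
move=> vj [rp sub _] sz; have okc : cs_ok K um n g.1.
  by apply: repcls_cs_ok rp sub _; rewrite size_items.
have d0 := maxdep_le okc; have [szc _] := okc.
have q1 := @Q_le_um R M w eps w1; have u1 := @um_th R M w eps M0.
have m1 := @M_th R M w eps w1.
have [/andP[_ uu] _ _ _] := itm_unit vj.
have gl : (glog (gbase R (par_q M w eps)) (reward j) <= K)%N.
  apply: leqW; apply: le_truncn.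
  have /and3P[_ _ /andP[r1 rw]] := vj; have hw := w1.
  by rewrite ler_pM2r ?invr_gt0 ?ln_gt0 ?gbase_gt1 // ler_ln ?posrE //; lra.
have k0 : (0 < K)%N by [].
have dd : (0 < dlog n)%N by [].
have t0 : (0 < th)%N by apply: leq_trans u1; exact: um_gt0.
have a1 : (th <= th * (K * dlog n))%N by rewrite leq_pmulr // muln_gt0 k0.
have a2 : (K <= th * (K * dlog n))%N.
  by rewrite mulnCA leq_pmulr // muln_gt0 t0.
have a3 : (dlog n <= th * (K * dlog n))%N by rewrite mulnA leq_pmull // muln_gt0 t0.
rewrite [derive_cost _](_ : _ = par_q M w eps + um + M)%N //.
rewrite [item_cost _ _](_ : _ = par_q M w eps +
  glog (gbase R (par_q M w eps)) (reward j) + iu (itm j))%N //.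
move: (th * (K * dlog n))%N (glog _ _) a1 a2 a3 gl => W l a1 a2 a3 gl.
move: (iu _) (maxdep _) (size _) (dlog n) uu szc d0 a3 => i m z d uu szc d0 a3.
move: (par_K M w eps) (par_um M w eps) (par_th M w eps) (par_q M w eps)
  u1 m1 q1 uu gl szc a1 a2 a3 d0 => k u t q.
by clear; lia.
Qed.

Lemma insert_cost_le J j g : jobs_ok J -> insertable w J j -> ginv J g ->
  (insert_cost (raw j, (prms, g)) <= 4908 * (th * (K * dlog (#|` J| + 5))))%N.
Proof.
move=> ok hins hg; have [ok' eX fr] := insertP ok hins.
have hg' := ginv_insert ok hins hg.
have /andP[vj _] := hins.
have c1 := @param_cost J j g (#|` J| + 5) vj hg (leq_addr _ _).
have sz' : (#|` j |` J| <= #|` J|.+1)%N.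
  by rewrite cardfsU1; case: (_ \in _) => /=; lia.
have [rp' sub' _] := hg'; have [rp sub hI] := hg.
rewrite /= -/(itm j) in rp' sub'.
have c2 : (touch_cost (drv_of M th) (cls_ins (itm j) g.1) g.2 (itm j) <=
    4900 * (th * (K * dlog (#|` J|.+1).+4)))%N.
  apply: (@touch_cost_le R K um #|` J|.+1 M th (items (j |` J))) hI => //.
  - exact: um_gt0.
  - exact: items_valid.
  - exact: mum_th.
  - by apply: repcls_cs_ok rp' sub' _; rewrite size_items.
  - by rewrite size_items.
  - exact: items_valid.
  - by rewrite size_items.
  - exact: um_th.
  - by move=> i /negbTE ne; rewrite eX inE ne.
  - by move=> i /fr /eqP.
  - exact: itm_itv.
rewrite -[(#|` J|.+1).+4]/(5 + #|` J|)%N addnC in c2.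
rewrite /insert_cost [leqRHS](_ : _ = 8 * (th * (K * dlog (#|` J| + 5))) +
  4900 * (th * (K * dlog (#|` J| + 5))))%N; last by rewrite -mulnDl.
exact: leq_add c1 c2.
Qed.

Lemma delete_cost_le J j g : jobs_ok J -> j \in J -> ginv J g ->
  (delete_cost (raw j, (prms, g)) <= 4908 * (th * (K * dlog (#|` J| + 5))))%N.
Proof.
move=> ok hj hg; have [ok' eX] := deleteP ok hj.
have hg' := ginv_delete ok hj hg.
have vj : valid_job w j by case: ok => vl _; exact: vl.
have vX := items_valid ok; have [inj _ _] := vX.
have ji : itm j \in items J by apply: map_f.
have c1 := @param_cost J j g (#|` J| + 5) vj hg (leq_addr _ _).
have sz' : (#|` J `\ j| <= #|` J|.+1)%N.
  by rewrite (cardfsD1 j J) hj; lia.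
have [rp' sub' _] := hg'; have [rp sub hI] := hg.
rewrite /= -/(itm j) in rp' sub'.
have c2 : (touch_cost (drv_of M th) (cls_del (itm j) g.1) g.2 (itm j) <=
    4900 * (th * (K * dlog (#|` J|.+1).+4)))%N.
  apply: (@touch_cost_le R K um #|` J|.+1 M th (items (J `\ j))) hI => //.
  - exact: um_gt0.
  - exact: items_valid.
  - exact: mum_th.
  - by apply: repcls_cs_ok rp' sub' _; rewrite size_items.
  - by rewrite size_items.
  - by rewrite size_items.
  - exact: um_th.
  - by move=> i ne; rewrite eX mem_filter ne.
  - by move=> i hi; apply: inj.
  - exact: itm_itv.
rewrite -[(#|` J|.+1).+4]/(5 + #|` J|)%N addnC in c2.
rewrite /delete_cost [leqRHS](_ : _ = 8 * (th * (K * dlog (#|` J| + 5))) +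
  4900 * (th * (K * dlog (#|` J| + 5))))%N; last by rewrite -mulnDl.
exact: leq_add c1 c2.
Qed.

Lemma query_cost_le J j g : jobs_ok J -> ginv J g ->
  (query_cost (raw j, (prms, g)) <= 2 * dlog (#|` J| + 5))%N.
Proof.
move=> ok [_ _ hI]; have vX := items_valid ok.
have t0 : (0 < th)%N.
  by apply: leq_trans (um_th w eps M0); exact: um_gt0.
have sz : (size (items J) <= #|` J|)%N by rewrite size_items.
have h := regs_size vX sz t0 hI; have [rs [[wf st ei sg] [gd _]]] := hI.
rewrite /query_cost mul2n -addnn; apply: leq_add.
  by apply: leq_trans (dep_dlog wf) _; apply: leq_dlog; apply: leq_trans h _; lia.
have := qpred_spec (start j) st; rewrite /=; case: (qpred _ _) => // e [].
rewrite ei => /mapP[r hr ->] _ _ /=.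
have [[wr sr _] okr _ _] := gd r hr.
apply: leq_trans (dep_dlog wr) _; apply: leq_dlog.
rewrite size_inorder_slist; have [_ hs] := okL_size vX okr.
by apply: leq_trans hs _; rewrite size_items leq_addr.
Qed.

(** The 56 is the product of the constants 4 of [par_K_le] and 14 of [dlog_le]. Two factors [Q] come
    from [th] and one from [K], and each is at most [17 / cap1 eps]. *)
Lemma update_le (n : nat) : ((th * (K * dlog (n + 5)))%:R <=
  (56%:R * 17%:R ^+ 3) * update_bound M w eps n :> R)%R.
Proof.
have hw := w1; have /andP[c0 c1] := cap1_itv eps0.
have q0 : (0 < Q%:R :> R)%R by rewrite ltr0n.
have lw : (0 <= ln (w + 1) :> R)%R by rewrite ln_ge0; lra.
have n0 : (0 <= n%:R :> R)%R by rewrite ler0n.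
have lnn : (0 <= ln (n%:R + 2) :> R)%R by rewrite ln_ge0; lra.
have w0 : (0 <= w)%R by lra.
have Mr : (0 <= M%:R :> R)%R by rewrite ler0n.
have k1 := @par_K_le R M w eps w1; have d1 := @dlog_le R n.
have u1 := @um_le R M w eps w1.
have t1 : (th%:R <= M%:R * (Q%:R * (w * Q%:R)) :> R)%R.
  by rewrite /par_th !natrM; apply: ler_wpM2l => //; apply: ler_wpM2l => //; exact: ltW.
rewrite (natrM _ th) (natrM _ K).
apply: (@le_trans _ _ ((M%:R * (Q%:R * (w * Q%:R))) *
  ((4%:R * Q%:R * ln (w + 1)) * (14%:R * ln (n%:R + 2))))%R).
  apply: ler_pM; [by rewrite ler0n | by rewrite mulr_ge0 ?ler0n | exact: t1 |].
  by apply: ler_pM; rewrite ?ler0n.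
have -> : ((M%:R * (Q%:R * (w * Q%:R))) *
  ((4%:R * Q%:R * ln (w + 1)) * (14%:R * ln (n%:R + 2))) =
  (56%:R * (M%:R * w * ln (w + 1) * ln (n%:R + 2))) * Q%:R ^+ 3 :> R)%R by ring.
rewrite /update_bound -cap1E.
have -> : (56%:R * 17%:R ^+ 3 * (M%:R * w * ln (w + 1) * ln (n%:R + 2) /
  cap1 eps ^+ 3) = (56%:R * (M%:R * w * ln (w + 1) * ln (n%:R + 2))) *
  (17%:R / cap1 eps) ^+ 3 :> R)%R.
  by field; rewrite gt_eqF.
apply: ler_wpM2l; first by rewrite !mulr_ge0.
apply: lerXn2r; [by rewrite nnegrE ltW | | exact: Q_le].
by rewrite nnegrE divr_ge0 ?ler0n // ltW.
Qed.

End Invariant.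

(** * From labelled items to schedules and rewards *)

Section Schedule.
Variables (R : realType) (M : nat) (w eps : R).
Hypotheses (M0 : (0 < M)%N) (w1 : (1 <= w)%R) (eps0 : (0 < eps)%R).
Local Open Scope fset_scope.
Local Notation item := ((R * R) * (nat * nat))%type.
Local Notation classes := (seq (nat * tree R item)).
Local Notation region := ((R * option R) * tree R (item * nat))%type.
Local Notation global := (classes * tree R region)%type.
Local Notation um := (par_um M w eps).
Local Notation th := (par_th M w eps).
Local Notation Q := (par_q M w eps).+1.
Local Notation prms := (M, (w, eps)).
Local Notation itm := (itm M w eps).
Local Notation items := (items M w eps).
Implicit Types (J : {fset job R}) (g : global).

Definition decode (k : nat) : option 'I_M := if k is k'.+1 then insub k' else None.

Lemma decodeK k : (k <= M)%N -> encode (decode k) = k.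
Proof. by case: k => //= k hk; rewrite insubT. Qed.

Lemma encode_gt0 (o : option 'I_M) : isSome o -> (0 < encode o <= M)%N.
Proof. by case: o => // m _ /=. Qed.

Lemma encode_inj : injective (@encode M).
Proof. by move=> [m|] [m'|] //= [] /val_inj ->. Qed.

Definition report J g : schedule J M :=
  [ffun j : J => decode (run_query (raw (val j), (prms, g)))].

Definition scheduled J (S : schedule J M) : seq J :=
  [seq j <- index_enum _ | isSome (S j)].

Definition units J (S : schedule J M) : nat :=
  \sum_(j : J | isSome (S j)) iu (itm (val j)).

Lemma isum_scheduled J (S : schedule J M) :
  isum [seq itm (val j) | j <- scheduled S] = units S.
Proof. by rewrite /isum big_map big_filter. Qed.

Lemma mem_scheduled J (S : schedule J M) (j : J) :
  (j \in scheduled S) = isSome (S j).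
Proof. by rewrite mem_filter mem_index_enum andbT. Qed.

Lemma value_units J (S : schedule J M) : jobs_ok w J ->
  ((units S)%:R / Q%:R <= value S)%R /\
  (value S <= (units S)%:R / Q%:R * (1 + Q%:R^-1) ^+ 2)%R.
Proof.
move=> [vl _]; rewrite /value /units natr_sum !mulr_suml; split.
  by apply: ler_sum => j _; have [] := itm_unit M eps w1 (vl _ (valP j)).
by apply: ler_sum => j _; have [] := itm_unit M eps w1 (vl _ (valP j)).
Qed.

Lemma itm_inj J (i j : J) : jobs_ok w J -> itm (val i) = itm (val j) -> i = j.
Proof.
move=> [_ inj] e; apply/val_inj/inj; try exact: valP.
by have := congr1 (@iid R) e.
Qed.

Lemma okL_schedule J (S : schedule J M) : jobs_ok w J -> feasible S ->
  okL (items J) 0%R None M [seq (itm (val j), encode (S j)) | j <- scheduled S].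
Proof.
move=> ok fS; split.
- rewrite -map_comp map_inj_in_uniq; first by rewrite filter_uniq ?index_enum_uniq.
  by move=> i j _ _ /=; exact: itm_inj.
- move=> _ /mapP[j hj ->]; rewrite mem_scheduled in hj; split=> /=.
  + by apply: map_f; exact: (valP j).
  + have [vl _] := ok.
    by rewrite /inR andbT; have /andP[] := itm_itv M eps (vl _ (valP j)).
  + exact: encode_gt0.
- move=> _ _ /mapP[i hi ->] /mapP[j hj ->] /= /encode_inj e ne.
  rewrite mem_scheduled in hi.
  have := fS => /forallP /(_ i) /forallP /(_ j) /implyP; apply.
  rewrite hi e eqxx !andbT; apply: contra ne => /eqP ->; exact: eqxx.
Qed.

(** [O] is a parameter for the sake of the last claim, where it is a competing schedule; the empty
    [O] gives the other two. *)
Lemma reportP J g O : jobs_ok w J -> ginv M w eps J g ->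
  okL (items J) 0%R None M O ->
  [/\ (forall j : J, run_query (raw (val j), (prms, g)) = encode (report J g j)),
      feasible (report J g) &
      ((M ^ M - M.-1 ^ M) * usum O * Q <= M ^ M * units (report J g) * Q.+1)%N].
Proof.
move=> ok [_ _ hI] okO; have vX := items_valid M eps w1 ok.
have [rs [ei sg gd okA rt]] := @global_ratio R um (items J) M th Q g.2 O M0 vX erefl hI okO.
have [_ [[wf st _ _] _]] := hI.
have qa (j : J) := @query_answer R um (items J) M th g.2 rs prms g.1 (raw (val j))
  (itm (val j)) vX wf st ei sg gd (map_f _ (valP j)) erefl erefl erefl.
have ist0 (j : J) : (0 <= ist (itm (val j)))%R.
  by have [vl _] := ok; have /andP[] := itm_itv M eps (vl _ (valP j)).
have {}qa j := qa j (ist0 j).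
have eg : (g.1, g.2) = g by case: (g).
rewrite eg in qa; have [uA mA nA] := okA.
have enc_ok (j : J) : run_query (raw (val j), (prms, g)) = encode (report J g j).
  rewrite ffunE decodeK //; case: (posnP (run_query (raw (val j), (prms, g)))) => [->//|].
  by rewrite lt0n => h; have [_ /(_ h) /mA [_ _ /andP[]]] := qa j.
have inA (j : J) : isSome (report J g j) ->
    (itm (val j), encode (report J g j)) \in allsol rs.
  move=> /encode_gt0 /andP[h _]; have [_] := qa j.
  by rewrite enc_ok -lt0n => /(_ h).
split=> //.
  apply/forallP => i; apply/forallP => j; apply/implyP => /and3P[ij hi /eqP e].
  have hj : isSome (report J g j) by rewrite -e.
  have := nA _ _ (inA i hi) (inA j hj); rewrite e => /(_ erefl); apply.
  by apply: contra ij => /eqP e'; rewrite (itm_inj ok e').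
apply: leq_trans rt _; rewrite leq_mul2r leq_mul2l -isum_scheduled.
rewrite (_ : usum (allsol rs) = isum (map fst (allsol rs))); last first.
  by rewrite usumE /isum big_map.
rewrite isum_subset ?orbT // => _ /mapP[p hp ->].
have [/mapP[j hj e] _ /andP[p0 _]] := mA p hp.
have ej : itm (val [` (hj : j \in J)]) = p.1 by rewrite e.
apply/mapP; exists [` (hj : j \in J)]; last by rewrite ej.
rewrite mem_scheduled; have [/(_ p.2) h _] := qa [` (hj : j \in J)].
have {}h : encode (report J g [` (hj : j \in J)]) = p.2.
  by rewrite -enc_ok; apply: h; rewrite ej -surjective_pairing.
by case: (report _ _ _) h => //= h; move: p0; rewrite -h.
Qed.

Lemma greedy_ratioE : greedy_ratio R M =
  ((M ^ M)%:R / (M ^ M - M.-1 ^ M)%:R :> R)%R.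
Proof.
rewrite /greedy_ratio natrB; last by rewrite leq_exp2r // leq_pred.
by rewrite !natrX -[in LHS](prednK M0) -natr1 addrK natr1 prednK.
Qed.

Lemma report_approx J g : jobs_ok w J -> ginv M w eps J g ->
  approximate (greedy_ratio R M * (1 + eps)) (report J g).
Proof.
move=> ok hg.
have nilok : okL (items J) 0%R None M [::] by split.
have [_ fG _] := reportP ok hg nilok; split=> //.
set G := report J g; have he := eps0; have [uG _] := value_units G ok.
have A0 : (0 < (M ^ M - M.-1 ^ M)%:R :> R)%R.
  rewrite ltr0n subn_gt0; have := double_pred_expn M0.
  have : (0 < M ^ M)%N by rewrite expn_gt0 M0.
  by move: (M ^ M)%N (M.-1 ^ M)%N; lia.
have B0 : (0 < (M ^ M)%:R :> R)%R by rewrite ltr0n expn_gt0 M0.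
have r0 : (0 < greedy_ratio R M :> R)%R by rewrite greedy_ratioE divr_gt0.
have al0 : (0 < greedy_ratio R M * (1 + eps))%R by rewrite mulr_gt0 //; lra.
have q0 : (0 < Q%:R :> R)%R by rewrite ltr0n.
have vG : (0 <= value G)%R by apply: le_trans uG; rewrite divr_ge0 ?ler0n.
rewrite mulrC ler_pdivrMr // mulrC; apply/bigmax_leP; split.
  by apply: mulr_ge0 => //; exact: ltW.
move=> S fS; have [_ uS] := value_units S ok.
have [_ _ rt] := reportP ok hg (okL_schedule ok fS).
rewrite usumE big_map big_filter -/(units S) in rt.
have x1 := @invQ_le R M w eps eps0; have /andP[c0 c1] := cap1_itv eps0.
have ce : (cap1 eps <= eps)%R by rewrite cap1E ge_min lexx.
set x := (Q%:R^-1 : R)%R in uS uG x1 *.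
have xq : (x * Q%:R = 1)%R by rewrite mulVf // gt_eqF.
have x0 : (0 < x)%R by rewrite invr_gt0.
(* Two factors [1 + x] stem from rounding and one from the boundaries. As [x <= 1], the coefficients
   3, 3, 1 of the cube add up to 7, and [x] is at most [cap1 eps / 16]. *)
have cube : ((1 + x) ^+ 3 <= 1 + eps)%R.
  have h : ((1 + x) ^+ 3 <= 1 + 7%:R * x)%R by rewrite !exprS expr0; nra.
  by apply: le_trans h _; lra.
have rt' : ((units S)%:R * x <=
    greedy_ratio R M * ((units G)%:R * x) * (1 + x) :> R)%R.
  have := rt; rewrite -(ler_nat R) !natrM -[Q.+1]addn1 natrD => h.
  rewrite greedy_ratioE -(ler_pM2l A0) -(ler_pM2r q0).
  have e1 : (((M ^ M - M.-1 ^ M)%:R * ((units S)%:R * x)) * Q%:R =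
    ((M ^ M - M.-1 ^ M)%:R * (units S)%:R * Q%:R) * x :> R)%R by ring.
  have e2 : ((M ^ M - M.-1 ^ M)%:R * ((M ^ M)%:R / (M ^ M - M.-1 ^ M)%:R *
     ((units G)%:R * x) * (1 + x)) * Q%:R =
     (M ^ M)%:R * (units G)%:R * (Q%:R + x * Q%:R) * x :> R)%R.
    by field; rewrite gt_eqF.
  by rewrite e1 e2 xq; apply: ler_wpM2r; first exact: ltW.
apply: le_trans uS _.
have y0 : (0 <= (1 + x) ^+ 2)%R by rewrite exprn_ge0 //; lra.
apply: le_trans (ler_wpM2r y0 rt') _.
have -> : (greedy_ratio R M * ((units G)%:R * x) * (1 + x) * (1 + x) ^+ 2 =
  greedy_ratio R M * (((units G)%:R * x) * (1 + x) ^+ 3) :> R)%R by ring.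
rewrite -[leRHS]mulrA; apply: ler_wpM2l; first exact: ltW.
rewrite [leRHS]mulrC; apply: ler_pM => //.
- by rewrite mulr_ge0 ?ler0n // ltW.
- by rewrite exprn_ge0 //; lra.
Qed.

End Schedule.

(** * Reachable memories *)

Section Reachable.
Variables (R : realType) (M : nat) (w eps : R) (A : dyn_alg).
Hypotheses (M0 : (0 < M)%N) (w1 : (1 <= w)%R) (eps0 : (0 < eps)%R).
Local Open Scope fset_scope.
Local Notation item := ((R * R) * (nat * nat))%type.
Local Notation classes := (seq (nat * tree R item)).
Local Notation region := ((R * option R) * tree R (item * nat))%type.
Local Notation global := (classes * tree R region)%type.
Local Notation prms := (M, (w, eps)).
Local Notation rawjob := (nat * (R * (R * R)))%type.
Local Notation uarg := (rawjob * ((nat * (R * R)) * global))%type.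
Implicit Types (J : {fset job R}) (j : job R) (g : global) (s : state R).

Definition runs_update (c : cmd) (F : uarg -> global) (T : uarg -> nat) (k : nat) :=
  forall s p (r : rawjob) g, args s r ->
    live p s g \/ (fresh p s /\ g = global0 R) ->
    exists s' t, [/\ exec c s s' t, (t <= k * (T (r, (p, g))).+1)%N &
      live p s' (F (r, (p, g)))].

Definition runs_query (c : cmd) (F : uarg -> nat) (T : uarg -> nat) (k : nat) :=
  forall s p (r : rawjob) g, args s r -> live p s g ->
    exists s' t, [/\ exec c s s' t, (t <= k * (T (r, (p, g))).+1)%N,
      live p s' g & zmem s' 0 = F (r, (p, g))].

Variables ki kd kq : nat.
Hypothesis run_ins : runs_update (insert A) (@run_insert R) (@insert_cost R) ki.
Hypothesis run_del : runs_update (delete A) (@run_delete R) (@delete_cost R) kd.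
Hypothesis run_qry : runs_query (query A) (@run_query R) (@query_cost R) kq.

Definition holds s g := live prms s g \/ (fresh prms s /\ g = global0 R).

Lemma holds_input s g j : holds s g ->
  holds (with_input j s) g /\ args (with_input j s) (raw j).
Proof.
move=> [/(live_input j) [h1 h2]|[/(fresh_input j) [h1 h2] e]]; split=> //.
  by left.
by right.
Qed.

(** Queries need a live memory. They occur only for nonempty [J], whereas only memories with empty
    [J] can still be fresh. *)
Lemma reach_inv J s : reach A M w eps J s -> jobs_ok w J /\
  exists g, [/\ ginv M w eps J g, holds s g & J != fset0 -> live prms s g].
Proof.
elim=> {J s} [|J s j s' t _ [ok [g [hg hs _]]] hj ex|
  J s j s' t _ [ok [g [hg hs hl]]] hj ex|J s j s' t _ [ok [g [hg hs hl]]] hj ex].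
- split; first exact: jobs_ok0; exists (global0 R); split.
  + exact: ginv0.
  + by right; split.
  + by rewrite eqxx.
- have [ok' _ _] := insertP M eps ok hj; split=> //.
  have [hi ha] := holds_input j hs.
  have [s1 [t1 [e1 _ l1]]] := run_ins ha hi.
  have [<- _] := exec_det e1 ex.
  exists (run_insert (raw j, (prms, g))); split=> //; last by left.
  exact: ginv_insert.
- have [ok' _] := deleteP M eps ok hj; split=> //.
  have [hi ha] := holds_input j hs.
  have [s1 [t1 [e1 _ l1]]] := run_del ha hi.
  have [<- _] := exec_det e1 ex.
  exists (run_delete (raw j, (prms, g))); split=> //; last by left.
  exact: ginv_delete.
- split=> //; have J0 : J != fset0 by apply/fset0Pn; exists j.
  have [hi ha] := live_input j (hl J0).
  have [s1 [t1 [e1 _ l1 _]]] := run_qry ha hi.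
  have [<- _] := exec_det e1 ex.
  by exists g; split=> //; left.
Qed.

Lemma run_query_inv J s (j : J) g : live prms s g ->
  exists s' t, [/\ exec (query A) (with_input (val j) s) s' t,
    (t <= kq * (query_cost (raw (val j), (prms, g))).+1)%N, live prms s' g &
    answer s' = run_query (raw (val j), (prms, g))].
Proof. by move=> /(live_input (val j)) [hl ha]; exact: run_qry ha hl. Qed.

Definition told J s (j : J) (k : nat) :=
  exists s' t, exec (query A) (with_input (val j) s) s' t /\ answer s' = k.

(* The maintained schedule is read off the answers of the queries. *)
Definition solution J s : schedule J M :=
  [ffun j : J => if pselect (exists k, told s j k) is left h
     then decode M (projT1 (cid h)) else None].

Lemma solutionE J s g : live prms s g -> solution J s = report M w eps J g.
Proof.
move=> hl; apply/ffunP => j; rewrite !ffunE.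
have [s1 [t1 [e1 _ _ a1]]] := run_query_inv j hl.
case: pselect => [h|]; last by case; exists (answer s1), s1, t1.
case: (cid h) => k /= [s2 [t2 [e2 <-]]].
by have [<- _] := exec_det e1 e2; rewrite a1.
Qed.

Lemma solution_report J s g : (J != fset0 -> live prms s g) ->
  solution J s = report M w eps J g.
Proof.
move=> hl; case: (eqVneq J fset0) => [e|/hl]; last exact: solutionE.
by apply/ffunP => j; case/negP: (negbT (in_fset0 (val j))); rewrite -e; exact: valP.
Qed.

Lemma reach_maintains : maintains_approx A M w eps (greedy_ratio R M * (1 + eps)).
Proof.
exists solution => J s /reach_inv [ok [g [hg hs hl]]].
have eS := solution_report hl; split; first by rewrite eS; exact: report_approx.
move=> j s' t ex; have J0 : J != fset0 by apply/fset0Pn; exists (val j); exact: valP.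
have [s1 [t1 [e1 _ l1 a1]]] := run_query_inv j (hl J0).
have [<- _] := exec_det e1 ex; rewrite eS (solutionE J l1); split=> //.
have nilok : okL (items M w eps J) 0%R None M [::] by split.
by have [h _ _] := reportP M0 w1 ok hg nilok; rewrite a1 h.
Qed.

(** Since [0 < W], the successor is absorbed by one more copy of [W], whence 4909. *)
Lemma time_le (k W t : nat) (B c x : R) : (t <= k * (4908 * W).+1)%N ->
  (0 < W)%N -> (W%:R <= B * x)%R -> ((k * 4909)%:R * B <= c)%R -> (0 <= x)%R ->
  (t%:R <= c * x)%R.
Proof.
move=> ht W0 hW hc x0; apply: (@le_trans _ _ ((k * 4909)%:R * W%:R)%R).
  rewrite -natrM ler_nat; apply: leq_trans ht _; rewrite -mulnA leq_mul2l.
  by apply/orP; right; lia.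
apply: le_trans (ler_wpM2l (ler0n _ _) hW) _.
by rewrite mulrA; apply: ler_wpM2r.
Qed.

Lemma reach_update (c : R) : (((ki + kd) * 4909)%:R * (56%:R * 17%:R ^+ 3) <= c)%R ->
  update_time A M w eps (fun n => c * update_bound M w eps n)%R.
Proof.
move=> hc J s /reach_inv [ok [g [hg hs hl]]].
have B0 : (0 < 56%:R * 17%:R ^+ 3 :> R)%R by rewrite mulr_gt0 ?exprn_gt0 ?ltr0n.
set W := (par_th M w eps * (par_K M w eps * dlog (#|` J| + 5)))%N.
have W0 : (0 < W)%N.
  by rewrite muln_gt0 (leq_trans M0 (@M_th R M w eps w1)).
have hW := @update_le R M w eps w1 eps0 #|` J|.
have x0 : (0 <= update_bound M w eps #|` J|)%R.
  by rewrite -(pmulr_rge0 _ B0); apply: le_trans hW; rewrite ler0n.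
have hki k : (k <= ki + kd)%N -> ((k * 4909)%:R * (56%:R * 17%:R ^+ 3) <= c)%R.
  move=> hk; apply: le_trans hc; apply: ler_wpM2r; first exact: ltW.
  by rewrite ler_nat leq_mul2r hk orbT.
split=> j hj; have [hi ha] := holds_input j hs.
  have [s1 [t1 [e1 h1 _]]] := run_ins ha hi; exists s1, t1; split=> //.
  apply: (time_le (k := ki) (W := W)) hW _ x0 => //; last by rewrite hki ?leq_addr.
  apply: leq_trans h1 _; rewrite leq_mul2l ltnS; apply/orP; right.
  exact: insert_cost_le.
have [s1 [t1 [e1 h1 _]]] := run_del ha hi; exists s1, t1; split=> //.
apply: (time_le (k := kd) (W := W)) hW _ x0 => //; last by rewrite hki ?leq_addl.
apply: leq_trans h1 _; rewrite leq_mul2l ltnS; apply/orP; right.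
exact: delete_cost_le.
Qed.

Lemma reach_query (c : R) : ((kq * 4909)%:R * 14%:R <= c)%R ->
  query_time A M w eps (fun n => c * query_bound R n)%R.
Proof.
move=> hc J s /reach_inv [ok [g [hg hs hl]]] j hj.
have J0 : J != fset0 by apply/fset0Pn; exists j.
have [s1 [t1 [e1 h1 _ _]]] := run_query_inv [` hj] (hl J0).
exists s1, t1; split=> //.
have x0 : (0 <= query_bound R #|` J|)%R.
  by rewrite /query_bound ln_ge0 // -natrD ler1n addn2.
have hW := dlog_le R #|` J|.
apply: (time_le (k := kq) (W := dlog (#|` J| + 5))) hW hc x0 => //.
apply: leq_trans h1 _; rewrite leq_mul2l ltnS; apply/orP; right.
have h2 : (query_cost (raw j, (prms, g)) <= 2 * dlog (#|` J| + 5))%N.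
  exact: query_cost_le.
apply: leq_trans h2 _.
by rewrite leq_mul2r orbT.
Qed.

End Reachable.

Local Open Scope ring_scope.

Theorem theorem6 (R : realType) :
  exists C : R, 0 < C /\
    forall (M : nat) (w eps : R), (0 < M)%N -> 1 <= w -> 0 < eps ->
      exists A : dyn_alg,
        maintains_approx A M w eps (greedy_ratio R M * (1 + eps)) /\
        update_time A M w eps (fun n => C * update_bound M w eps n) /\
        query_time A M w eps (fun n => C * query_bound R n).
Proof.
have [c0 [K0 hb]] := boot_exists R.
have [ci [ki hi]] := update_exists (@comp_run_insert R) hb.
have [cd [kd hd]] := update_exists (@comp_run_delete R) hb.
have [cq [kq hq]] := query_exists (@comp_run_query R).
pose a : R := ((ki + kd) * 4909)%:R * (56%:R * 17%:R ^+ 3).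
pose b : R := (kq * 4909)%:R * 14%:R.
have a0 : 0 <= a by rewrite !mulr_ge0 ?exprn_ge0 ?ler0n.
have b0 : 0 <= b by rewrite mulr_ge0 ?ler0n.
(* [ki], [kd] and [kq] belong to programs fixed before [M], [w] and [eps] are introduced, so the
   constant is absolute; the 1 makes it positive. *)
exists (1 + a + b); split; first by lra.
move=> M w eps M0 w1 eps0.
pose A := DynAlg (update_prog c0 ci) (update_prog c0 cd) (query_prog cq).
exists A; split; [|split].
- exact: (reach_maintains (A := A) M0 w1 eps0 hi hd hq).
- by apply: (reach_update (A := A) M0 w1 eps0 hi hd hq); rewrite -/a; lra.
- by apply: (reach_query (A := A) M0 w1 eps0 hi hd hq); rewrite -/b; lra.
Qed.
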